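(* Let $x_1,\dots,x_{K+1}$ be generated by the stagewise algorithm with SPG as subproblem solver, suppose there exists $\Delta>0$ such that $\mathbb{E}[F(x_k)-\min_xF(x)]\le\Delta$ for all $k\in\{1,\dots,K\}$, and let $\tau\in\{1,\dots,K\}$ be sampled according to the probabilities $p(\tau=k)=k^\alpha/\sum_{j=1}^Kj^\alpha$ with $\alpha\ge1$. (1) If condition (S) holds and SPG is run with Option 1, with $\gamma\ge3L$, $\eta_t=3/(\gamma(t+1))$ and number of iterations $T_k=3Lk/\gamma+3$ at stage $k$, then with a total of $K$ stages $$\mathbb{E}\big[\|G_\gamma(x_\tau)\|^2\big]\le\frac{8\gamma\Delta(\alpha+1)}{K}+\frac{32G^2\gamma(\alpha+1)}{LK}.$$ (2) If condition (N) holds and SPG is run with Option 2, with $\gamma>0$, $\eta_t=4/(\gamma t)$ and number of iterations $T_k=k/\gamma+1$ at stage $k$, then with a total of $K$ stages $$\mathbb{E}\big[\|G_\gamma(x_\tau)\|^2\big]\le\frac{8\gamma\Delta(\alpha+1)}{K}+\frac{448G^2\gamma(\alpha+1)}{K}.$$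
   Context: Problem: $\min_{x\in\mathbb{R}^d}F(x):=g(x)+r(x)-h(x)$ with $g(x)=\mathbb{E}_\xi[g(x;\xi)]$, $h(x)=\mathbb{E}_\varsigma[h(x;\varsigma)]$, where $g,h:\mathbb{R}^d\to\mathbb{R}$ are lower-semicontinuous convex and $r:\mathbb{R}^d\to\mathbb{R}\cup\{+\infty\}$ is proper lower-semicontinuous convex. $\|\cdot\|$ is the Euclidean norm. When $\partial h(z)$ is used as a vector it denotes a chosen subgradient of $h$ at $z$; $\partial g(x;\xi)$, $\partial h(x;\varsigma)$ denote stochastic subgradients, i.e. $\mathbb{E}_\xi[\partial g(x;\xi)]\in\partial g(x)$ and $\mathbb{E}_\varsigma[\partial h(x;\varsigma)]=\partial h(x)$. For $\gamma>0$, $z\in\mathbb{R}^d$: $$F^{\gamma}_{z}(x)=g(x)+r(x)-\big(h(z)+\partial h(z)^{\top}(x-z)\big)+\tfrac{\gamma}{2}\|x-z\|^2,$$ $P_\gamma(z)=\arg\min_xF^\gamma_z(x)$, $G_\gamma(z)=\gamma(z-P_\gamma(z))$. Stagewise algorithm: $x_1\in\mathrm{dom}(r)$; for $k=1,\dots,K$, $x_{k+1}$ is the output of SPG$(F^\gamma_{x_k},x_k,T_k)$. SPG$(F^\gamma_{y_1},y_1,T)$ with step sizes $\eta_t$: let $\Omega=\{x\in\mathrm{dom}(r):\|x-y_1\|\le3G/\gamma\}$. For $t=1,\dots,T$, draw fresh independent samples $\xi_t,\varsigma_t$, and set $$y_{t+1}=\arg\min_x\; x^\top(\partial g(y_t;\xi_t)-\partial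 h(y_1;\varsigma_t))+r(x)+\tfrac{\gamma}{2}\|x-y_1\|^2+\tfrac{1}{2\eta_t}\|x-y_t\|^2,$$ the minimum being over $\mathbb{R}^d$ in Option 1 and over $\Omega$ in Option 2. Output $\sum_{t=2}^{T+1}t\,y_t/\sum_{t=2}^{T+1}t$ (Option 1) or $\sum_{t=1}^{T}t\,y_t/\sum_{t=1}^{T}t$ (Option 2). Non-integer iteration numbers are understood as rounded up. Condition (S): $g$ is $L$-smooth (differentiable with $L$-Lipschitz gradient) and there exists $G>0$ such that $\mathbb{E}\big[\|(\nabla g(x;\xi)-\partial h(x;\varsigma))-\mathbb{E}[\nabla g(x;\xi)-\partial h(x;\varsigma)]\|^2\big]\le G^2$. Condition (N): there exists $G>0$ such that $\mathbb{E}[\|\partial g(x;\xi)\|^2]\le G^2$ and $\mathbb{E}[\|\partial h(x;\varsigma)\|^2]\le G^2$ for $x\in\mathrm{dom}(r)$, and either $r=\delta_{\mathcal X}$ is the indicator function of a closed convex set $\mathcal X$ or $\|\partial r(x)\|\le G$ for $x\in\mathrm{dom}(r)$. *)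

(* Defs.v *)
From HB Require Import structures.
From mathcomp Require Import all_boot all_order all_algebra finmap.
From mathcomp Require Import all_classical all_reals all_analysis.

Set Implicit Arguments.
Unset Strict Implicit.
Unset Printing Implicit Defensive.

Import Order.TTheory GRing.Theory Num.Theory.
Import numFieldNormedType.Exports.

Local Open Scope classical_set_scope.
Local Open Scope ring_scope.

Definition dotv (R : realType) (n : nat) (x y : 'rV[R]_n) : R :=
  \sum_(i < n) x 0 i * y 0 i.

(* [`|x|] on ['rV[R]_n] is the sup norm. *)
Definition enorm (R : realType) (n : nat) (x : 'rV[R]_n) : R :=
  Num.sqrt (dotv x x).

Definition edom (R : realType) (n : nat) (f : 'rV[R]_n -> \bar R) :
    set 'rV[R]_n :=
  [set x | (f x < +oo)%E].

Definition eproper (R : realType) (n : nat) (f : 'rV[R]_n -> \bar R) : Prop :=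
  (forall x, (-oo < f x)%E) /\ edom f !=set0.

(* The convention [0 * +oo = 0] makes the cases [t = 0] and [t = 1] harmless. *)
Definition econvex (R : realType) (n : nat) (f : 'rV[R]_n -> \bar R) : Prop :=
  forall (t : R) (x y : 'rV[R]_n), 0 <= t <= 1 ->
    (f (t *: x + (1 - t) *: y)%R <= t%:E * f x + (1 - t)%:E * f y)%E.

Definition subdifferential (R : realType) (n : nat) (f : 'rV[R]_n -> \bar R)
    (x : 'rV[R]_n) : set 'rV[R]_n :=
  [set v | forall y, (f x + (dotv v (y - x))%:E <= f y)%E].

Definition eindicator (R : realType) (n : nat) (X : set 'rV[R]_n)
    (x : 'rV[R]_n) : \bar R :=
  if x \in X then 0%E else +oo%E.

Definition gradient (R : realType) (n : nat) (f : 'rV[R]_n -> R)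
    (x : 'rV[R]_n) : 'rV[R]_n :=
  \row_i 'D_(delta_mx 0 i) f x.

Definition smooth (R : realType) (n : nat) (L : R) (f : 'rV[R]_n -> R) : Prop :=
  (forall x, differentiable f x) /\
  (forall x y, enorm (gradient f x - gradient f y) <= L * enorm (x - y)).

Definition is_argmin (R : realType) (n : nat) (D : set 'rV[R]_n)
    (f : 'rV[R]_n -> \bar R) (x : 'rV[R]_n) : Prop :=
  D x /\ forall y, D y -> (f x <= f y)%E.

(* The objectives below are strongly convex, so their minimizer is unique. *)
Definition argmin (R : realType) (n : nat) (D : set 'rV[R]_n)
    (f : 'rV[R]_n -> \bar R) : 'rV[R]_n :=
  get (is_argmin D f).

Definition borel_rV (R : realType) (n : nat) : measurableType _ :=
  g_sigma_algebraType (@open 'rV[R]_n).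

Definition vexpectation d (T : measurableType d) (R : realType) (n : nat)
    (mu : {measure set T -> \bar R}) (X : T -> 'rV[R]_n) : 'rV[R]_n :=
  \row_i (\int[mu]_w X w 0 i).

Definition vintegrable d (T : measurableType d) (R : realType) (n : nat)
    (mu : {measure set T -> \bar R}) (X : T -> 'rV[R]_n) : Prop :=
  forall i, mu.-integrable setT (fun w => (X w 0 i)%:E).

Definition jointly_measurable d (T : measurableType d) (R : realType) (n : nat)
    (X : 'rV[R]_n -> T -> 'rV[R]_n) : Prop :=
  forall i, measurable_fun setT
    (fun p : (borel_rV R n * T)%type => X p.1 p.2 0 i : R).

Definition mutually_independent d (T : measurableType d) (R : realType)
    (P : probability T R) (I : choiceType) (S : I -> set (set T)) : Prop :=
  forall (J : {fset I}) (A : I -> set T), (forall i, i \in J -> S i (A i)) ->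
    (P (\bigcap_(i in [set` J]) A i) = \prod_(i <- J) P (A i))%E.

Definition has_law d d' (T : measurableType d) (T' : measurableType d')
    (R : realType) (P : probability T R) (X : {RV P >-> T'})
    (mu : probability T' R) : Prop :=
  forall A, measurable A -> distribution P X A = mu A.

(* [dc_gs x xi] is g(x; xi), [dc_hs x vs] is h(x; vs); [dc_sg x xi] and
   [dc_sh x vs] are the stochastic subgradients of g and h at x; [dc_dh x] is
   the chosen subgradient of h at x. *)

Record dc_problem (R : realType) (n : nat) (Xi Vs : Type) := DCProblem {
  dc_g : 'rV[R]_n -> R;
  dc_h : 'rV[R]_n -> R;
  dc_r : 'rV[R]_n -> \bar R;
  dc_gs : 'rV[R]_n -> Xi -> R;
  dc_hs : 'rV[R]_n -> Vs -> R;
  dc_sg : 'rV[R]_n -> Xi -> 'rV[R]_n;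
  dc_sh : 'rV[R]_n -> Vs -> 'rV[R]_n;
  dc_dh : 'rV[R]_n -> 'rV[R]_n
}.

Record dc_assumptions d1 d2 (Xi : measurableType d1) (Vs : measurableType d2)
    (R : realType) (n : nat) (Pxi : probability Xi R) (Pvs : probability Vs R)
    (D : dc_problem R n Xi Vs) : Prop := DCAssumptions {
  dc_g_lsc : lower_semicontinuous (EFin \o dc_g D);
  dc_g_convex : convex_function [set: convex_lmodType 'rV[R]_n] (dc_g D);
  dc_h_lsc : lower_semicontinuous (EFin \o dc_h D);
  dc_h_convex : convex_function [set: convex_lmodType 'rV[R]_n] (dc_h D);
  dc_r_proper : eproper (dc_r D);
  dc_r_lsc : lower_semicontinuous (dc_r D);
  dc_r_convex : econvex (dc_r D);
  dc_g_integrable : forall x, Pxi.-integrable setT (EFin \o dc_gs D x);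
  dc_g_expectation : forall x, ((dc_g D x)%:E = 'E_Pxi[dc_gs D x])%E;
  dc_h_integrable : forall x, Pvs.-integrable setT (EFin \o dc_hs D x);
  dc_h_expectation : forall x, ((dc_h D x)%:E = 'E_Pvs[dc_hs D x])%E;
  dc_sg_measurable : jointly_measurable (dc_sg D);
  dc_sh_measurable : jointly_measurable (dc_sh D);
  dc_sg_integrable : forall x, vintegrable Pxi (dc_sg D x);
  dc_sh_integrable : forall x, vintegrable Pvs (dc_sh D x);
  dc_sg_unbiased : forall x,
    subdifferential (EFin \o dc_g D) x (vexpectation Pxi (dc_sg D x));
  dc_dh_subgradient : forall x, subdifferential (EFin \o dc_h D) x (dc_dh D x);
  dc_sh_unbiased : forall x, vexpectation Pvs (dc_sh D x) = dc_dh D x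
}.

Definition dc_objective (R : realType) (n : nat) (Xi Vs : Type)
    (D : dc_problem R n Xi Vs) (x : 'rV[R]_n) : \bar R :=
  ((dc_g D x)%:E + dc_r D x - (dc_h D x)%:E)%E.

Definition dc_surrogate (R : realType) (n : nat) (Xi Vs : Type)
    (D : dc_problem R n Xi Vs) (gamma : R) (z x : 'rV[R]_n) : \bar R :=
  ((dc_g D x)%:E + dc_r D x - (dc_h D z + dotv (dc_dh D z) (x - z))%:E
   + (gamma / 2 * enorm (x - z) ^+ 2)%:E)%E.

Definition prox_point (R : realType) (n : nat) (Xi Vs : Type)
    (D : dc_problem R n Xi Vs) (gamma : R) (z : 'rV[R]_n) : 'rV[R]_n :=
  argmin setT (dc_surrogate D gamma z).

Definition prox_gradient (R : realType) (n : nat) (Xi Vs : Type)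
    (D : dc_problem R n Xi Vs) (gamma : R) (z : 'rV[R]_n) : 'rV[R]_n :=
  gamma *: (z - prox_point D gamma z).

Definition spg_objective (R : realType) (n : nat) (Xi Vs : Type)
    (D : dc_problem R n Xi Vs) (gamma eta : R) (y1 y : 'rV[R]_n)
    (xi : Xi) (vs : Vs) (x : 'rV[R]_n) : \bar R :=
  ((dotv x (dc_sg D y xi - dc_sh D y1 vs))%:E + dc_r D x
   + (gamma / 2 * enorm (x - y1) ^+ 2)%:E
   + ((2 * eta)^-1 * enorm (x - y) ^+ 2)%:E)%E.

(* The iterate y_t, numbered from 1: y_(t+1) uses [eta t], [xi t] and [vs t].
   The value at [t = 0] is a placeholder. *)
Fixpoint spg_iterate (R : realType) (n : nat) (Xi Vs : Type)
    (D : dc_problem R n Xi Vs) (gamma : R) (eta : nat -> R)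
    (C : set 'rV[R]_n) (y1 : 'rV[R]_n) (xi : nat -> Xi) (vs : nat -> Vs)
    (t : nat) : 'rV[R]_n :=
  if t is s.+1 then
    if s == 0%N then y1 else
    argmin C (spg_objective D gamma (eta s) y1
                (spg_iterate D gamma eta C y1 xi vs s) (xi s) (vs s))
  else y1.

Definition weighted_average (R : realType) (n : nat) (a b : nat)
    (y : nat -> 'rV[R]_n) : 'rV[R]_n :=
  (\sum_(a <= t < b) t%:R)^-1 *: \sum_(a <= t < b) t%:R *: y t.

Definition spg_option1 (R : realType) (n : nat) (Xi Vs : Type)
    (D : dc_problem R n Xi Vs) (gamma : R) (eta : nat -> R)
    (y1 : 'rV[R]_n) (T : nat) (xi : nat -> Xi) (vs : nat -> Vs) : 'rV[R]_n :=
  weighted_average 2 T.+2 (spg_iterate D gamma eta setT y1 xi vs).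

Definition spg_region (R : realType) (n : nat) (Xi Vs : Type)
    (D : dc_problem R n Xi Vs) (gamma G : R) (y1 : 'rV[R]_n) :
    set 'rV[R]_n :=
  [set x | edom (dc_r D) x /\ enorm (x - y1) <= 3 * G / gamma].

Definition spg_option2 (R : realType) (n : nat) (Xi Vs : Type)
    (D : dc_problem R n Xi Vs) (gamma G : R) (eta : nat -> R)
    (y1 : 'rV[R]_n) (T : nat) (xi : nat -> Xi) (vs : nat -> Vs) : 'rV[R]_n :=
  weighted_average 1 T.+1
    (spg_iterate D gamma eta (spg_region D gamma G y1) y1 xi vs).

(* The stage point x_k, numbered from 1, for a subproblem solver [spg]; [xi k t]
   and [vs k t] are the samples drawn at step [t] of stage [k].  The value at
   [k = 0] is a placeholder. *)
Fixpoint stagewise (R : realType) (n : nat) (Xi Vs : Type)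
    (spg : 'rV[R]_n -> nat -> (nat -> Xi) -> (nat -> Vs) -> 'rV[R]_n)
    (x1 : 'rV[R]_n) (T : nat -> nat)
    (xi : nat -> nat -> Xi) (vs : nat -> nat -> Vs) (k : nat) : 'rV[R]_n :=
  if k is j.+1 then
    if j == 0%N then x1 else
    spg (stagewise spg x1 T xi vs j) (T j) (xi j) (vs j)
  else x1.

Definition nat_ceil (R : realType) (a : R) : nat := `|Num.ceil a|%N.

Definition draws_sigma d d1 d2 (Om : measurableType d) (Xi : measurableType d1)
    (Vs : measurableType d2) (xi : nat -> nat -> Om -> Xi)
    (vs : nat -> nat -> Om -> Vs) (tau : Om -> nat)
    (i : (nat * nat + nat * nat) + unit) : set (set Om) :=
  match i with
  | inl (inl kt) => g_sigma_algebra_preimage (xi kt.1 kt.2)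
  | inl (inr kt) => g_sigma_algebra_preimage (vs kt.1 kt.2)
  | inr _ => g_sigma_algebra_preimage tau
  end.

(* The two samples are independent, hence the product measure.  Since g is
   differentiable, [dc_sg D x] has expectation the gradient of g at x. *)

Definition condition_S d1 d2 (Xi : measurableType d1) (Vs : measurableType d2)
    (R : realType) (n : nat) (Pxi : probability Xi R) (Pvs : probability Vs R)
    (D : dc_problem R n Xi Vs) (L G : R) : Prop :=
  smooth L (dc_g D) /\
  forall x,
    let noise (p : Xi * Vs) := dc_sg D x p.1 - dc_sh D x p.2 in
    (\int[Pxi \x Pvs]_p
       (enorm (noise p - vexpectation (Pxi \x Pvs) noise) ^+ 2)%:E
     <= (G ^+ 2)%:E)%E.

(* The bound on the subgradients of r concerns a chosen one at each point: at a
   boundary point of its domain the subdifferential is empty or unbounded. *)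
Definition condition_N d1 d2 (Xi : measurableType d1) (Vs : measurableType d2)
    (R : realType) (n : nat) (Pxi : probability Xi R) (Pvs : probability Vs R)
    (D : dc_problem R n Xi Vs) (G : R) : Prop :=
  (forall x, edom (dc_r D) x ->
     ('E_Pxi[fun w => (enorm (dc_sg D x w) ^+ 2)%R] <= (G ^+ 2)%:E)%E /\
     ('E_Pvs[fun w => (enorm (dc_sh D x w) ^+ 2)%R] <= (G ^+ 2)%:E)%E) /\
  ((exists X : set 'rV[R]_n,
      [/\ closed X, convex_set (X : set (convex_lmodType 'rV[R]_n)) &
          dc_r D = eindicator X]) \/
   (forall x, edom (dc_r D) x ->
      exists2 v, subdifferential (dc_r D) x v & enorm v <= G)).

(* Main.v *)
Require Import Defs.
From HB Require Import structures.
From mathcomp Require Import all_boot all_order all_algebra finmap.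
From mathcomp Require Import all_classical all_reals all_analysis.
From mathcomp Require Import measurable_realfun ring lra.

Set Implicit Arguments.
Unset Strict Implicit.
Unset Printing Implicit Defensive.

Import Order.TTheory GRing.Theory Num.Theory.
Import numFieldNormedType.Exports.

Local Open Scope classical_set_scope.
Local Open Scope ring_scope.

(* Write F_x for the surrogate at x, P(x) for its minimizer, and
   D(x, y) = F_x(y) - F_x(P(x)).  Strong convexity of F_x and the subgradient
   inequality for h give, with x = x_k,
     F(x_(k+1)) + gamma/2 |x_k - P(x_k)|^2 <= D(x_k, x_(k+1)) + F(x_k),
   so it suffices to bound E D(x_k, x_(k+1)) by a small multiple of
   E|x_k - P(x_k)|^2 plus O(1/k), and then to sum against the weights k^alpha.
   Given (x_k, y_t), one proximal step with noise e satisfies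
     w_t D + A_(t+1) |P - y_(t+1)|^2 <= A_t |y_t - P - eta_t e|^2 + c |e|^2
   (with second moments of the subgradients in place of |e|^2 in the nonsmooth
   case); the fresh samples are independent of (x_k, y_t) and e is centered, so
   in expectation the right-hand side is A_t |y_t - P|^2 + O(G^2/gamma) and the
   inequalities telescope in t.  All integrands are nonnegative, so Tonelli
   applies although dh(x_k) need not be integrable.  The iterates are measurable
   because proximal points depend continuously on their data. *)

(** * Euclidean norm and strong convexity *)

(** Step sizes and averaging weights are tied by [w_t / (2 * eta_t) = A_t], and the strong convexity
    of the subproblem makes up the growth from [A_t] to [A_(t+1)], so linear weights cost nothing. A
    stage of [T] steps divides a noise of order [T * G^2 / gamma] by a weight of order [T^2 / 2];
    with [T_k] proportional to [k] the error is [e / k], and against the weights [k^alpha] such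
    errors sum to at most [e * K^alpha], with no logarithm. The obstacle is finiteness: only the
    expectation of [F(x_k)] is bounded, not the moments of the iterates. Inequalities between
    expectations are therefore kept additive, between nonnegative extended numbers, until
    [stage_recursion] has shown the terms finite. In Option 2 the comparison point [P(x_k)] must lie
    in the random ball; its radius [3 * G / gamma] is the bound on [|x - P(x)|] given by three
    subgradients of norm at most [G]. It also bounds the initial distance of a stage outright,
    whereas Option 1 absorbs that distance into the descent term. The process is built once, for a
    general feasible set [C] and shift [dl]. *)

Section dot.
Variables (R : realType) (n : nat).
Implicit Types x y z u v : 'rV[R]_n.

Lemma dotvC x y : dotv x y = dotv y x.
Proof. by apply: eq_bigr => i _; rewrite mulrC. Qed.

Lemma dotvDl x y z : dotv (x + y) z = dotv x z + dotv y z.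
Proof. by rewrite -big_split; apply: eq_bigr => i _; rewrite mxE mulrDl. Qed.

Lemma dotvZl (a : R) x y : dotv (a *: x) y = a * dotv x y.
Proof. by rewrite mulr_sumr; apply: eq_bigr => i _; rewrite mxE mulrA. Qed.

Lemma dotvDr x y z : dotv x (y + z) = dotv x y + dotv x z.
Proof. by rewrite dotvC dotvDl !(dotvC x). Qed.

Lemma dotvZr (a : R) x y : dotv x (a *: y) = a * dotv x y.
Proof. by rewrite dotvC dotvZl dotvC. Qed.

Lemma dotvNl x y : dotv (- x) y = - dotv x y.
Proof. by rewrite -scaleN1r dotvZl mulN1r. Qed.

Lemma dotvNr x y : dotv x (- y) = - dotv x y.
Proof. by rewrite dotvC dotvNl dotvC. Qed.

Definition dotvE := (dotvDl, dotvDr, dotvNl, dotvNr, dotvZl, dotvZr).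

Lemma dotv_ge0 x : 0 <= dotv x x.
Proof. by apply: sumr_ge0 => i _; rewrite -expr2 sqr_ge0. Qed.

Lemma enorm_sqr x : enorm x ^+ 2 = dotv x x.
Proof. by rewrite sqr_sqrtr ?dotv_ge0. Qed.

Lemma enorm_ge0 x : 0 <= enorm x.
Proof. exact: sqrtr_ge0. Qed.

Lemma dotv0l x : dotv 0 x = 0.
Proof. by rewrite -(scale0r 0) dotvZl mul0r. Qed.

Lemma enorm0 : enorm (0 : 'rV[R]_n) = 0.
Proof. by rewrite /enorm dotv0l sqrtr0. Qed.

Lemma enormN x : enorm (- x) = enorm x.
Proof. by rewrite /enorm !dotvE opprK. Qed.

Lemma enormB x y : enorm (x - y) = enorm (y - x).
Proof. by rewrite -enormN opprB. Qed.

Lemma enormZ (a : R) x : enorm (a *: x) = `|a| * enorm x.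
Proof. by rewrite /enorm !dotvE mulrA -expr2 sqrtrM ?sqr_ge0// sqrtr_sqr. Qed.

Lemma dotv_young (a : R) x y : 0 < a ->
  2 * dotv x y <= a * dotv x x + a^-1 * dotv y y.
Proof.
move=> a0; have := dotv_ge0 (a *: x - y); rewrite !dotvE (dotvC y x) => h.
rewrite -(ler_pM2l a0) mulrDr mulVKf ?gt_eqF//; lra.
Qed.

(** Young's inequality with the optimal parameter [enorm y / enorm x]; a vanishing norm calls for
    another parameter. *)
Lemma dotv_le_enorm x y : dotv x y <= enorm x * enorm y.
Proof.
have [x0|x0] := eqVneq (enorm x) 0.
  rewrite x0 mul0r; have xx0 : dotv x x = 0 by rewrite -enorm_sqr x0 expr0n.
  rewrite leNgt; apply/negP => xy.
  have y0 := dotv_ge0 y.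
  (* With [dotv x x = 0], Young at this parameter gives [2 * dotv x y <= dotv x y], against
     [dotv x y > 0]. *)
  have p : 0 < (1 + dotv y y) / dotv x y by rewrite divr_gt0//; lra.
  have := dotv_young x y p; rewrite xx0 mulr0 add0r invf_div => h1.
  have : dotv x y / (1 + dotv y y) * dotv y y <= dotv x y.
    rewrite -mulrA ler_piMr// ?(ltW xy)// mulrC ler_pdivrMr; lra.
  lra.
have [y0|y0] := eqVneq (enorm y) 0.
  rewrite y0 mulr0; have yy0 : dotv y y = 0 by rewrite -enorm_sqr y0 expr0n.
  rewrite leNgt; apply/negP => xy.
  have x1 := dotv_ge0 x.
  have p : 0 < dotv x y / (1 + dotv x x) by rewrite divr_gt0//; lra.
  have := dotv_young x y p; rewrite yy0 mulr0 addr0 => h1.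
  have : dotv x y / (1 + dotv x x) * dotv x x <= dotv x y.
    rewrite -mulrA ler_piMr// ?(ltW xy)// mulrC ler_pdivrMr; lra.
  lra.
have xp : 0 < enorm x by rewrite lt_neqAle eq_sym x0 enorm_ge0.
have yp : 0 < enorm y by rewrite lt_neqAle eq_sym y0 enorm_ge0.
have := dotv_young x y (divr_gt0 yp xp).
rewrite -!enorm_sqr invf_div.
have -> : enorm y / enorm x * enorm x ^+ 2 = enorm x * enorm y by field.
have -> : enorm x / enorm y * enorm y ^+ 2 = enorm x * enorm y by field.
lra.
Qed.

Lemma enormD x y : enorm (x + y) <= enorm x + enorm y.
Proof.
rewrite -(@ler_pXn2r _ 2)// ?nnegrE ?addr_ge0 ?enorm_ge0// sqrrD !enorm_sqr.
rewrite !dotvE (dotvC y x); have := dotv_le_enorm x y; lra.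
Qed.

Lemma enorm_dist_le x y z : enorm (x - z) <= enorm (x - y) + enorm (y - z).
Proof. by apply: le_trans (enormD _ _); rewrite subrKA. Qed.

Lemma enorm_le x (a : R) : 0 <= a -> (enorm x <= a) = (dotv x x <= a ^+ 2).
Proof.
by move=> a0; rewrite -enorm_sqr ler_pXn2r// ?nnegrE ?enorm_ge0.
Qed.

Lemma normr_le_enorm x : `|x| <= enorm x.
Proof.
rewrite [leLHS]/Num.norm/= mx_normrE; apply/bigmax_leP; split => [|i _]; first exact: enorm_ge0.
rewrite -sqrtr_sqr ler_wsqrtr// /dotv; case: i => i j/=; rewrite ord1 {i}.
by rewrite (bigD1 j)//= -expr2 lerDl sumr_ge0// => k _; rewrite -expr2 sqr_ge0.
Qed.

(** The factor [n] is not the sharp [sqrt n]: the comparison only serves to pass from Euclidean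
    distances to the sup-norm topology of ['rV[R]_n]. *)
Lemma enorm_le_normr x : enorm x <= n%:R * `|x|.
Proof.
rewrite enorm_le ?mulr_ge0//.
have h (i : 'I_n) : x 0 i * x 0 i <= `|x| ^+ 2.
  rewrite -expr2 -real_normK ?num_real// ler_pXn2r ?nnegrE// [leRHS]/Num.norm/= mx_normrE.
  exact: (le_bigmax_cond _ (fun ij => `|x ij.1 ij.2|) (j := (0, i))).
apply: (@le_trans _ _ (\sum_(i < n) `|x| ^+ 2)); first exact: ler_sum.
rewrite sumr_const card_ord exprMn -[leLHS]mulr_natl.
apply: ler_wpM2r; first exact: sqr_ge0.
by rewrite -natrX ler_nat; case: (n) => // k; rewrite expnS leq_pmulr.
Qed.

End dot.

Section convexity.
Variables (R : realType) (n : nat).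
Implicit Types (A : set 'rV[R]_n) (f g : 'rV[R]_n -> R) (x y z : 'rV[R]_n).

Definition cvx_set A := forall (t : R) x y, 0 <= t <= 1 -> A x -> A y ->
  A (t *: x + (1 - t) *: y).

(** [m = 0] is plain convexity, so that [sconvexD] covers every objective. Functions are real-valued
    on a set; the extended-valued [r] enters as [fine] on its domain. *)
Definition sconvex A (m : R) f := forall (t : R) x y, 0 <= t <= 1 -> A x -> A y ->
  f (t *: x + (1 - t) *: y) <=
  t * f x + (1 - t) * f y - m / 2 * (t * (1 - t)) * enorm (x - y) ^+ 2.

Lemma sconvexD A m1 m2 f g : sconvex A m1 f -> sconvex A m2 g ->
  sconvex A (m1 + m2) (fun x => f x + g x).
Proof.
move=> cf cg t x y t01 Ax Ay; have := cf t x y t01 Ax Ay.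
have := cg t x y t01 Ax Ay; lra.
Qed.

Lemma sconvexS A B m f : A `<=` B -> sconvex B m f -> sconvex A m f.
Proof. by move=> AB cf t x y t01 /AB Ax /AB Ay; apply: cf. Qed.

Lemma sconvex_affine A v (c : R) : sconvex A 0 (fun x => dotv x v + c).
Proof. by move=> t x y _ _ _; rewrite !dotvE; lra. Qed.

Lemma dotvBB x y : dotv (x - y) (x - y) = dotv x x - 2 * dotv x y + dotv y y.
Proof. by rewrite !dotvE (dotvC y x); ring. Qed.

Lemma sconvex_sqr A m c : sconvex A m (fun x => m / 2 * enorm (x - c) ^+ 2).
Proof.
move=> t x y _ _ _; rewrite !enorm_sqr !dotvBB !dotvE (dotvC y x).
by rewrite le_eqVlt; apply/orP; left; apply/eqP; field.
Qed.

Lemma convex_function_sconvex f :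
  convex_function [set: convex_lmodType 'rV[R]_n] f -> sconvex setT 0 f.
Proof.
move=> cf t x y /andP[t0 t1] _ _.
have := cf (Itv01 t0 t1) x y (mem_setT _) (mem_setT _).
by rewrite /= !mul0r subr0.
Qed.

(* Compare [p] with the points of the segment from [x] to [p], close to [p]. *)
Lemma sconvex_min A m f p x : cvx_set A -> sconvex A m f -> A p ->
  (forall y, A y -> f p <= f y) -> A x -> f p + m / 2 * enorm (x - p) ^+ 2 <= f x.
Proof.
move=> cA cf Ap minp Ax; set N := enorm (x - p) ^+ 2.
rewrite leNgt; apply/negP => lt_f.
have N0 : 0 <= N by rewrite sqr_ge0.
have h (t : R) : 0 < t <= 1 -> m / 2 * (1 - t) * N <= f x - f p.
  move=> /andP[t0 t1]; have t01 : 0 <= t <= 1 by rewrite (ltW t0).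
  have := le_trans (minp _ (cA t x p t01 Ax Ap)) (cf t x p t01 Ax Ap).
  rewrite -/N => H; rewrite -(ler_pM2l t0); lra.
have fx0 : 0 <= f x - f p by have := minp x Ax; lra.
(* [d] is the amount by which the claim fails; at [t = d / (2 * (m / 2 * N))] the bound [h] loses
   only [d / 2], a contradiction. *)
set d := m / 2 * N - (f x - f p).
have d0 : 0 < d by rewrite /d; lra.
have mN : 0 < m / 2 * N by rewrite /d in d0; lra.
have := h (d / (2 * (m / 2 * N))).
have -> : m / 2 * (1 - d / (2 * (m / 2 * N))) * N = m / 2 * N - d / 2.
  have m0 : m != 0 by apply/eqP => m0; rewrite m0 !mul0r ltxx in mN.
  have NN : N != 0 by apply/eqP => NN; rewrite NN mulr0 ltxx in mN.
  by field; rewrite m0 NN.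
have p0 : 0 < 2 * (m / 2 * N) by lra.
have t01 : 0 < d / (2 * (m / 2 * N)) <= 1.
  by rewrite divr_gt0//= ler_pdivrMr// mul1r /d; lra.
by move/(_ t01); rewrite {1}/d; lra.
Qed.

(** Induction on the list, joining the first point to the average of the others. Membership in [A]
    is carried along because convexity is applied at that average. *)
Lemma sconvex_jensen A f (I : eqType) (s : seq I) (w : I -> R) (y : I -> 'rV[R]_n) :
  cvx_set A -> sconvex A 0 f ->
  (forall i, 0 <= w i) -> (forall i, A (y i)) -> 0 < \sum_(i <- s) w i ->
  A ((\sum_(i <- s) w i)^-1 *: \sum_(i <- s) w i *: y i) /\
  (\sum_(i <- s) w i) * f ((\sum_(i <- s) w i)^-1 *: \sum_(i <- s) w i *: y i) <=
  \sum_(i <- s) w i * f (y i).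
Proof.
move=> cA cf w0 Ay; elim: s => [|i s IH]; first by rewrite big_nil ltxx.
rewrite !big_cons; set W := \sum_(j <- s) w j; set Y := \sum_(j <- s) _ *: _.
set F := \sum_(j <- s) _ * _ => p.
have W0 : 0 <= W by apply: sumr_ge0.
(* A tail of total weight [0] has no average; its terms vanish and the head alone remains. *)
have [W00|W00] := eqVneq W 0.
  have w00 j : j \in s -> w j = 0.
    by move: W00 => /eqP; rewrite /W psumr_eq0// => /allP h /h /= /eqP.
  have -> : Y = 0 by rewrite /Y big_seq big1// => j /w00 ->; rewrite scale0r.
  have -> : F = 0 by rewrite /F big_seq big1// => j /w00 ->; rewrite mul0r.
  move: p; rewrite W00 !addr0 => p.
  by rewrite scalerA mulVf ?lt0r_neq0// scale1r.
have Wp : 0 < W by rewrite lt_neqAle eq_sym W00.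
have [AY fY] := IH Wp.
have -> : (w i + W)^-1 *: (w i *: y i + Y) =
    (w i / (w i + W)) *: y i + (1 - w i / (w i + W)) *: (W^-1 *: Y).
  rewrite scalerDr !scalerA (mulrC _ (w i)); congr (_ + _ *: _); field.
  by rewrite W00 gt_eqF.
have t01 : 0 <= w i / (w i + W) <= 1.
  by rewrite divr_ge0 ?(ltW p)//= ler_pdivrMr// mul1r lerDl.
split; first exact: cA.
have h := cf _ _ _ t01 (Ay i) AY.
apply: (@le_trans _ _ ((w i + W) * (w i / (w i + W) * f (y i) +
    (1 - w i / (w i + W)) * f (W^-1 *: Y)))).
  by rewrite ler_pM2l//; apply: le_trans h _; rewrite !mul0r subr0.
have -> : (w i + W) * (w i / (w i + W) * f (y i) + (1 - w i / (w i + W)) * f (W^-1 *: Y))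
    = w i * f (y i) + W * f (W^-1 *: Y) by field; rewrite gt_eqF.
by rewrite lerD2l.
Qed.

End convexity.

Section lsc.
Variables (R : realType) (n : nat).
Implicit Types (f : 'rV[R]_n -> \bar R) (K : set 'rV[R]_n).

(** The sublevel sets of [f] in [K] at the values [f y] are nested and generate a filter. At a
    cluster point [p], [f y < f p] is impossible: lower semicontinuity would give a neighbourhood of
    [p] that misses the sublevel set of [y]. *)
Lemma lsc_compact_min f K : lower_semicontinuous f -> (forall x, -oo < f x)%E ->
  compact K -> K !=set0 -> exists2 p, K p & forall y, K y -> (f p <= f y)%E.
Proof.
move=> lf fNy cK [x0 Kx0].
pose F := filter_from K (fun y => [set x | K x /\ (f x <= f y)%E]).
have FF : ProperFilter F.
  apply: filter_from_proper; last by move=> y Ky; exists y.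
  apply: filter_from_filter; first by exists x0.
  move=> i j Ki Kj; have [ij|ji] := leP (f i) (f j).
    by exists i => // x [Kx xi]; split; split => //; exact: le_trans ij.
  by exists j => // x [Kx xj]; split; split => //; exact: le_trans (ltW ji).
have [] := cK F; first by exists x0 => // x [].
move=> p [Kp clp]; exists p => // y Ky; rewrite leNgt; apply/negP => yp.
have fyE : f y = (fine (f y))%:E.
  by rewrite fineK// fin_numE gt_eqF ?fNy//= lt_eqF// (lt_le_trans yp)// leey.
rewrite fyE in yp; have [V Vp Vf] := lf p _ yp.
have [] := clp [set x | K x /\ (f x <= f y)%E] V _ Vp.
  by exists y.
move=> z [[_ zy] /Vf]; rewrite -fyE => /(le_lt_trans zy).
by rewrite ltxx.
Qed.

Lemma continuous_enormB (c : 'rV[R]_n) : continuous (fun x : 'rV[R]_n => enorm (x - c) : R).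
Proof.
move=> x; apply/(@cvgrPdist_le _ _ _ (nbhs x) (nbhs_filter x)) => e e0.
have p : 0 < e / n.+1%:R by rewrite divr_gt0.
apply: (filterS _ (nbhsx_ballx x _ p)) => y.
rewrite -ball_normE/= => xy.
have h : `|enorm (x - c) - enorm (y - c)| <= enorm (x - y).
  rewrite ler_norml; apply/andP; split.
    by have := enorm_dist_le y x c; rewrite (enormB y x); lra.
  by have := enorm_dist_le x y c; lra.
apply: (le_trans h); apply: (le_trans (enorm_le_normr _)).
move: (ltW xy); rewrite ler_pdivlMr// => h2; apply: le_trans h2.
by rewrite mulrC ler_wpM2l// ler_nat.
Qed.

Lemma compact_enorm_ball (c : 'rV[R]_n) (r : R) :
  compact [set x : 'rV[R]_n | enorm (x - c) <= r].
Proof.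
apply: bounded_closed_compact.
  exists (`|c| + r); split; first by rewrite num_real.
  move=> M ltM x /= xr; apply: le_trans (ltW ltM).
  rewrite -lerBlDl; apply: le_trans xr; apply: le_trans (normr_le_enorm _).
  exact: lerB_dist.
rewrite (_ : [set x | _] = (fun x : 'rV[R]_n => enorm (x - c)) @^-1` [set y | y <= r]) //.
by apply: closed_comp; [move=> x _; exact: continuous_enormB|exact: closed_le].
Qed.

End lsc.

(** * Minimizers of regularized objectives *)

Section regularized.
Variables (R : realType) (n : nat) (r : 'rV[R]_n -> \bar R).
Hypotheses (rNy : forall x, (-oo < r x)%E) (rlsc : lower_semicontinuous r)
  (rcvx : econvex r).
Implicit Types (q : 'rV[R]_n -> R) (x y c : 'rV[R]_n) (C : set 'rV[R]_n).

Lemma edomE x : edom r x -> r x = (fine (r x))%:E.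
Proof. by move=> rx; rewrite fineK// fin_numE gt_eqF ?rNy//= lt_eqF. Qed.

Lemma econvex_fin (t : R) x y : 0 <= t <= 1 -> edom r x -> edom r y ->
  (r (t *: x + (1 - t) *: y) <= (t * fine (r x) + (1 - t) * fine (r y))%:E)%E.
Proof.
move=> t01 rx ry; apply: (le_trans (rcvx x y t01)).
by rewrite (edomE rx) (edomE ry) -!EFinM -EFinD.
Qed.

Lemma edom_cvx : cvx_set (edom r).
Proof.
move=> t x y t01 rx ry; rewrite /edom/=.
by apply: le_lt_trans (econvex_fin t01 rx ry) _; rewrite ltry.
Qed.

Lemma sconvex_fine : sconvex (edom r) 0 (fun x => fine (r x)).
Proof.
move=> t x y t01 rx ry; have h := econvex_fin t01 rx ry.
rewrite -lee_fin -edomE ?(le_trans h)//; last exact: edom_cvx.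
by rewrite lee_fin !mul0r subr0.
Qed.

(** Common shape of the surrogate and of the SPG subproblem: the finite terms are gathered in [q],
    and only [r] can be infinite. *)
Definition regularize q x : \bar R := (r x + (q x)%:E)%E.

Lemma regularizeNy q x : (-oo < regularize q x)%E.
Proof. by rewrite /regularize; move: (rNy x); case: (r x) => [a||]// _; rewrite -EFinD ltNyr. Qed.

Lemma regularize_lsc q : lower_semicontinuous (EFin \o q) ->
  lower_semicontinuous (regularize q).
Proof.
move=> lq x a; rewrite /regularize => lta.
suff [b [c [bx cx abc]]] : exists b c : R, [/\ (b%:E < r x)%E, c < q x & a <= b + c].
  have [V Vx Vr] := rlsc bx; have [W Wx Wq] := lq x c cx.
  exists (V `&` W); first exact: filterI.
  move=> y [/Vr ry /Wq qy]; apply: (@le_lt_trans _ _ (b + c)%:E).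
    by rewrite lee_fin.
  by rewrite EFinD lteD.
have := rNy x; move: lta; case: (r x) => [s|_ _|] //=.
  rewrite -EFinD lte_fin => lta _; exists (s - (s + q x - a) / 2), (q x - (s + q x - a) / 2).
  by rewrite lte_fin; split; lra.
by exists (a - q x + 1), (q x - 1); rewrite ltry; split => //; lra.
Qed.

Lemma regularize_fin q x : edom r x -> regularize q x = (fine (r x) + q x)%:E.
Proof. by move=> rx; rewrite /regularize {1}(edomE rx) EFinD. Qed.

Lemma edom_regularize q x : edom (regularize q) x <-> edom r x.
Proof. by rewrite /edom/= /regularize; have := rNy x; case: (r x) => [a||]// _; rewrite
  -EFinD !ltry. Qed.

(** The minimum is taken over the whole ball, which is compact; the minimizer falls in the domain
    because the value at the center is finite. *)
Lemma regularize_region_argmin q c (rho : R) :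
  lower_semicontinuous (EFin \o q) -> 0 <= rho -> edom r c ->
  exists p, is_argmin [set x | edom r x /\ enorm (x - c) <= rho] (regularize q) p.
Proof.
move=> lq rho0 rc.
have B0 : [set x : 'rV[R]_n | enorm (x - c) <= rho] !=set0.
  by exists c; rewrite /= subrr enorm0.
have [p /= pc minp] := lsc_compact_min (regularize_lsc lq) (regularizeNy q)
  (@compact_enorm_ball _ _ c rho) B0.
exists p; split; last by move=> y [_]; exact: minp.
split=> //; apply/(edom_regularize q).
have := minp c; rewrite /= subrr enorm0 => /(_ rho0) h.
by apply: le_lt_trans h _; apply/edom_regularize.
Qed.

Lemma sconvex_regularize q (m : R) : sconvex (edom r) m q ->
  sconvex (edom r) m (fun x => fine (r x) + q x).
Proof. by move=> cq; rewrite -[m]add0r; apply: sconvexD => //; exact: sconvex_fine. Qed.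

(* Outside a large ball around a point of the domain, strong convexity along
   the segment from that point pushes the objective above its value there. *)
Lemma regularize_argmin q (m : R) : edom r !=set0 -> 0 < m ->
  sconvex (edom r) m q -> lower_semicontinuous (EFin \o q) ->
  exists p, is_argmin setT (regularize q) p.
Proof.
move=> [c rc] m0 cq lq.
have [p [[rp _] minp]] := regularize_region_argmin lq (ler01 : 0 <= 1) rc.
pose f x := fine (r x) + q x.
have minpf y : edom r y -> enorm (y - c) <= 1 -> f p <= f y.
  by move=> ry yc; have := minp y (conj ry yc); rewrite !regularize_fin// lee_fin.
have pc0 : f p <= f c by apply: minpf => //; rewrite subrr enorm0.
(* On the segment from [c] to [y], the point at distance [1] from [c] has value at least [f p];
   strong convexity then yields [f y >= f c] once [m / 2 * (enorm (y - c) - 1) >= f c - f p], that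
   is, outside radius [rho]. *)
pose rho := 1 + 2 * (f c - f p) / m.
have rho1 : 1 <= rho by rewrite /rho lerDl divr_ge0 ?(ltW m0)//; lra.
have [p' [[rp' _] minp']] := regularize_region_argmin lq (le_trans ler01 rho1) rc.
exists p'; split=> // y _.
have p'c : f p' <= f c.
  have := minp' c; rewrite !regularize_fin// lee_fin; apply; split => //.
  by rewrite subrr enorm0; lra.
have [ry|] := boolP (r y < +oo)%E; last first.
  by rewrite -leNgt leye_eq => /eqP ry; rewrite /regularize ry addye ?leey.
have [yc|yc] := leP (enorm (y - c)) rho; first exact: minp'.
rewrite !regularize_fin// lee_fin -/(f _) -/(f _); apply: (le_trans p'c).
set s := enorm (y - c) in yc.
have s1 : 1 < s by apply: le_lt_trans yc.
have s0 : 0 < s by apply: lt_trans s1.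
have t01 : 0 <= s^-1 <= 1 by rewrite invr_ge0 (ltW s0)/= invf_le1 ?(ltW s1).
have h := sconvex_regularize cq t01 ry rc; rewrite -/(f _) -/(f y) -/(f c) -/s in h.
have h2 : f p <= f (s^-1 *: y + (1 - s^-1) *: c).
  apply: minpf; first exact: edom_cvx.
  rewrite scalerBl scale1r addrCA addrC addrK -scalerBr enormZ -/s.
  by rewrite ger0_norm ?mulVf ?gt_eqF//; lra.
have := le_trans h2 h; rewrite -(ler_pM2l s0).
have -> : s * (s^-1 * f y + (1 - s^-1) * f c - m / 2 * (s^-1 * (1 - s^-1)) * s ^+ 2)
   = f y + (s - 1) * f c - m / 2 * (s - 1) * s by field; rewrite gt_eqF.
move=> h3; have : f c - f p <= m / 2 * (s - 1).
  have : rho - 1 <= s - 1 by lra.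
  rewrite /rho addrC addKr ler_pdivrMr// => h4; lra.
move=> h4; have : s * (f c - f p) <= s * (m / 2 * (s - 1)) by rewrite ler_pM2l.
lra.
Qed.

(** On the intersection of [C] with the domain the objective is real-valued, so [sconvex_min]
    applies. Optimality is used below in this two-point form, in place of a stationarity
    condition. *)
Lemma regularize_argmin_strong C q (m : R) p y : cvx_set C ->
  sconvex (edom r) m q -> is_argmin C (regularize q) p -> C y -> edom r y ->
  edom r p /\
  fine (r p) + q p + m / 2 * enorm (y - p) ^+ 2 <= fine (r y) + q y.
Proof.
move=> cC cq [Cp minp] Cy ry.
have rp : edom r p.
  apply/(edom_regularize q); apply: le_lt_trans (minp _ Cy) _.
  exact/edom_regularize.
split=> //; apply: (@sconvex_min _ _ (C `&` edom r) m (fun x => fine (r x) + q x)) => //.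
- by move=> t x z t01 [Cx rx] [Cz rz]; split; [exact: cC|exact: edom_cvx].
- by apply: sconvexS (sconvex_regularize cq) => x [].
- by move=> x [Cx rx]; have := minp x Cx; rewrite !regularize_fin// lee_fin.
Qed.

Lemma region_cvx c (rho : R) : cvx_set [set x | edom r x /\ enorm (x - c) <= rho].
Proof.
move=> t x y t01 [rx xc] [ry yc]; split; first exact: edom_cvx.
have -> : t *: x + (1 - t) *: y - c = t *: (x - c) + (1 - t) *: (y - c).
  by rewrite !scalerBr addrACA -opprD -scalerDl [t + _]addrC subrK scale1r.
case/andP: t01 => t0 t1; apply: le_trans (enormD _ _) _.
rewrite !enormZ !ger0_norm ?subr_ge0//.
have : t * enorm (x - c) <= t * rho by apply: ler_wpM2l.
have : (1 - t) * enorm (y - c) <= (1 - t) * rho by apply: ler_wpM2l; rewrite ?subr_ge0.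
lra.
Qed.

End regularized.

(** * One proximal step *)

Section dotv_continuity.
Variables (R : realType) (n : nat).

Lemma continuous_dotv (v : 'rV[R]_n) :
  continuous (fun x : 'rV[R]_n => dotv x v : R).
Proof.
move=> x; apply/(@cvgrPdist_le _ _ _ (nbhs x) (nbhs_filter x)) => e e0.
have N0 : 0 < n%:R * enorm v + 1 by rewrite ltr_wpDl// mulr_ge0// enorm_ge0.
have p : 0 < e / (n%:R * enorm v + 1) by rewrite divr_gt0.
apply: (filterS _ (nbhsx_ballx x _ p)) => y.
rewrite -ball_normE/= => /ltW; rewrite ler_pdivlMr// => xy.
have -> : dotv x v - dotv y v = dotv (x - y) v by rewrite dotvDl dotvNl.
have h : `|dotv (x - y) v| <= enorm (x - y) * enorm v.
  rewrite ler_norml dotv_le_enorm andbT lerNl -dotvNl.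
  by rewrite -[leRHS](congr1 ( *%R^~ _) (enormN _)) dotv_le_enorm.
apply: (le_trans h); apply: le_trans xy.
apply: (@le_trans _ _ (n%:R * `|x - y| * enorm v)).
  by rewrite ler_wpM2r ?enorm_ge0// enorm_le_normr.
rewrite mulrAC [leRHS]mulrC ler_wpM2r//; lra.
Qed.

Lemma continuous_addf (p q : 'rV[R]_n -> R) : continuous p -> continuous q ->
  continuous (fun x => p x + q x).
Proof. by move=> cp cq x; apply: (@continuousD _ _ _ p q x); [exact: cp|exact: cq]. Qed.

Lemma continuous_sqr_enormB (a : R) (c : 'rV[R]_n) :
  continuous (fun x : 'rV[R]_n => a * enorm (x - c) ^+ 2 : R).
Proof.
move=> x; have cN := @continuous_enormB R n c x.
apply: (@continuous_comp _ _ _ (fun x : 'rV[R]_n => enorm (x - c)) (fun u : R => a * u ^+ 2)).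
  exact: cN.
by apply: cvgMl_tmp; exact: exprn_continuous.
Qed.

Lemma continuous_lsc (q : 'rV[R]_n -> R) : continuous q ->
  lower_semicontinuous (EFin \o q).
Proof.
move=> cq; apply/lower_semicontinuousP => a.
rewrite (_ : [set x | _] = q @^-1` [set y | a < y]).
  by apply: open_comp; [move=> x _; exact: cq|exact: open_gt].
by apply/seteqP; split => x /=; rewrite lte_fin.
Qed.

Lemma lscD_continuous (g q : 'rV[R]_n -> R) : lower_semicontinuous (EFin \o g) ->
  continuous q -> lower_semicontinuous (EFin \o (fun x => g x + q x)).
Proof.
move=> lg cq; apply: (regularize_lsc (r := EFin \o g)) => //=.
- by move=> x; rewrite ltNyr.
- exact: continuous_lsc.
Qed.

End dotv_continuity.

Section objectives.
Variables (R : realType) (n : nat) (Xi Vs : Type) (D : dc_problem R n Xi Vs).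
Variables (gamma : R) (gamma0 : 0 < gamma).
Local Notation g := (dc_g D).
Local Notation h := (dc_h D).
Local Notation r := (dc_r D).
Local Notation dh := (dc_dh D).
Hypotheses (glsc : lower_semicontinuous (EFin \o g)) (gcvx : sconvex setT 0 g)
  (rprop : eproper r) (rlsc : lower_semicontinuous r) (rcvx : econvex r).
Implicit Types (x y z v : 'rV[R]_n).

Let rNy := rprop.1.

(** The finite part of the surrogate; [g] may still be nondifferentiable. *)
Definition surrogate_smooth z x : R :=
  g x + (- (h z + dotv (dh z) (x - z)) + gamma / 2 * enorm (x - z) ^+ 2).

Lemma dc_surrogateE z : dc_surrogate D gamma z = regularize r (surrogate_smooth z).
Proof.
apply/funext => x; rewrite /dc_surrogate /regularize /surrogate_smooth.
have := rNy x; case: (r x) => [a||]//= _.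
by rewrite -?EFinN -?EFinD; congr EFin; ring.
Qed.

(** Meaningful on the domain of [r] only, since [fine +oo = 0]. *)
Definition surrogate_value z x : R := fine (r x) + surrogate_smooth z x.

Lemma sconvex_surrogate z : sconvex (edom r) gamma (surrogate_smooth z).
Proof.
have := sconvexD (sconvexS (@subsetT _ (edom r)) gcvx)
  (sconvexD (@sconvex_affine _ _ (edom r) (- dh z) (- (h z - dotv (dh z) z)))
  (@sconvex_sqr _ _ (edom r) gamma z)).
rewrite !add0r; congr sconvex; apply/funext => x.
rewrite /surrogate_smooth dotvDr !dotvNr (dotvC x); ring.
Qed.

Lemma lsc_surrogate z : lower_semicontinuous (EFin \o surrogate_smooth z).
Proof.
apply: lscD_continuous => //; apply: continuous_addf; last exact: continuous_sqr_enormB.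
rewrite (_ : (fun x => _) = (fun x => dotv x (- dh z) + (dotv (dh z) z - h z))).
  by apply: continuous_addf; [exact: continuous_dotv|exact: cst_continuous].
by apply/funext => x; rewrite dotvDr !dotvNr (dotvC x); ring.
Qed.

Lemma prox_point_argmin z :
  is_argmin setT (regularize r (surrogate_smooth z)) (prox_point D gamma z).
Proof.
rewrite /prox_point /argmin dc_surrogateE; apply: getPex.
apply: (@regularize_argmin _ _ _ _ _ _ _ gamma) => //.
- exact: rprop.2.
- exact: sconvex_surrogate.
- exact: lsc_surrogate.
Qed.

Lemma prox_point_strong z x : edom r x ->
  edom r (prox_point D gamma z) /\
  surrogate_value z (prox_point D gamma z) +
    gamma / 2 * enorm (x - prox_point D gamma z) ^+ 2 <= surrogate_value z x.
Proof.
move=> rx; apply: (regularize_argmin_strong _ _ _ _ (prox_point_argmin z)) => //.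
exact: sconvex_surrogate.
Qed.

Lemma prox_point_dom z : edom r (prox_point D gamma z).
Proof. by have [x rx] := rprop.2; have [] := prox_point_strong z rx. Qed.

Definition spg_smooth eta y1 y v x : R :=
  dotv x v + gamma / 2 * enorm (x - y1) ^+ 2 + (2 * eta)^-1 * enorm (x - y) ^+ 2.

Lemma spg_objectiveE eta y1 y xi vs :
  spg_objective D gamma eta y1 y xi vs =
  regularize r (spg_smooth eta y1 y (dc_sg D y xi - dc_sh D y1 vs)).
Proof.
apply/funext => x; rewrite /spg_objective /regularize /spg_smooth.
have := rNy x; case: (r x) => [a||]//= _.
by rewrite -!EFinD; congr EFin; ring.
Qed.

Lemma sconvex_spg A eta y1 y v : 0 < eta ->
  sconvex A (gamma + eta^-1) (spg_smooth eta y1 y v).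
Proof.
move=> eta0; have := sconvexD (sconvexD (@sconvex_affine _ _ A v 0)
   (@sconvex_sqr _ _ A gamma y1)) (@sconvex_sqr _ _ A eta^-1 y).
rewrite !add0r; congr sconvex; apply/funext => x.
by rewrite /spg_smooth addr0 invfM (mulrC 2^-1).
Qed.

Lemma lsc_spg eta y1 y v : lower_semicontinuous (EFin \o spg_smooth eta y1 y v).
Proof.
apply: continuous_lsc; apply: continuous_addf; last exact: continuous_sqr_enormB.
by apply: continuous_addf; [exact: continuous_dotv|exact: continuous_sqr_enormB].
Qed.

(** The direction is an arbitrary vector [v], so that the step is a map between vector spaces whose
    measurability can be studied apart from the samples. *)
Definition spg_argmin C eta y1 y v : 'rV[R]_n :=
  argmin C (regularize r (spg_smooth eta y1 y v)).

Lemma spg_argminT eta y1 y v : 0 < eta ->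
  is_argmin setT (regularize r (spg_smooth eta y1 y v)) (spg_argmin setT eta y1 y v).
Proof.
move=> eta0; apply: getPex; apply: (@regularize_argmin _ _ _ _ _ _ _ (gamma + eta^-1)) => //.
- exact: rprop.2.
- by rewrite addr_gt0 ?invr_gt0.
- exact: sconvex_spg.
- exact: lsc_spg.
Qed.

Lemma spg_argmin_region G eta y1 y v : 0 < G -> edom r y1 ->
  is_argmin (spg_region D gamma G y1) (regularize r (spg_smooth eta y1 y v))
    (spg_argmin (spg_region D gamma G y1) eta y1 y v).
Proof.
move=> G0 ry1; apply: getPex; apply: regularize_region_argmin => //.
- exact: lsc_spg.
- by rewrite divr_ge0 ?(ltW gamma0) ?mulr_ge0// ltW.
Qed.

Section step.
Variables (x1 y z v e m : 'rV[R]_n) (L : R).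
Hypotheses (vE : v = m - dh x1 + e) (rz : edom r z)
  (gz : g y + dotv m (z - y) <= g z).

(* The noise is left inside a square, so that only nonnegative functions are
   ever integrated along the process. *)
Lemma smooth_step (t : R) p : 1 <= t -> 0 < L -> 3 * L <= gamma ->
  g p <= g y + dotv m (p - y) + 3 / 4 * L * enorm (p - y) ^+ 2 ->
  is_argmin setT (regularize r (spg_smooth (3 / (gamma * (t + 1))) x1 y v)) p ->
  (t + 1) * (surrogate_value x1 p - surrogate_value x1 z) +
    gamma * (t + 2) ^+ 2 / 6 * enorm (z - p) ^+ 2 <=
  gamma * (t + 1) ^+ 2 / 6 * enorm (y - z - (3 / (gamma * (t + 1))) *: e) ^+ 2 +
    9 / (2 * gamma) * enorm e ^+ 2.
Proof.
move=> t1 L0 Lg gp pmin; set eta := 3 / (gamma * (t + 1)).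
have gt0 : 0 < gamma * (t + 1) by rewrite mulr_gt0//; lra.
have eta0 : 0 < eta by rewrite divr_gt0.
have [_ F1] := @regularize_argmin_strong _ _ _ rNy rcvx setT _ _ p z (fun _ _ _ _ _ _ => I)
  (@sconvex_spg (edom r) eta x1 y v eta0) pmin I rz.
(* Chosen so that [c / 2 + gamma / 4 = gamma * (t + 1) / 6]: the proximal term pays [gamma / 4] for
   the curvature of [g] and [c / 2] for the noise. *)
have [c cdef] : exists c, c = gamma * (2 * t - 1) / 6 by exists (gamma * (2 * t - 1) / 6).
have c0 : 0 < c by rewrite cdef divr_gt0// mulr_gt0//; lra.
have F4 := dotv_young (- e) (p - y) (ltac:(by rewrite invr_gt0) : 0 < c^-1).
rewrite invrK -!enorm_sqr enormN dotvNl in F4.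
have Ee : enorm (y - z - eta *: e) ^+ 2 =
    enorm (z - y) ^+ 2 - 2 * eta * dotv e (y - z) + eta ^+ 2 * enorm e ^+ 2.
  rewrite (enormB z) !enorm_sqr (dotvBB (y - z)) !dotvZl !dotvZr (dotvC _ e); ring.
have eV : eta^-1 = gamma * (t + 1) / 3 by rewrite /eta invf_div.
have eV2 : (2 * eta)^-1 = gamma * (t + 1) / 6.
  by rewrite invfM eV; field.
move: F1; rewrite /spg_smooth eV2 eV Ee /surrogate_value /surrogate_smooth.
have dE : dotv p v - dotv z v = dotv m (p - y) - dotv m (z - y)
    - dotv (dh x1) (p - x1) + dotv (dh x1) (z - x1) + dotv e (p - y) + dotv e (y - z).
  by rewrite vE !dotvE !(dotvC p) !(dotvC z); ring.
have N1 : 0 <= enorm (p - y) ^+ 2 by rewrite sqr_ge0.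
have N3 : 0 <= enorm (z - p) ^+ 2 by rewrite sqr_ge0.
have N4 : 0 <= enorm e ^+ 2 by rewrite sqr_ge0.
(* Here [3 * L <= gamma] absorbs the constant [3 / 4] of the descent inequality. *)
have Lp : 3 / 4 * L * enorm (p - y) ^+ 2 <= gamma / 4 * enorm (p - y) ^+ 2.
  by apply: ler_wpM2r => //; lra.
move=> F1.
pose Q := surrogate_value x1 p - surrogate_value x1 z.
have H : Q <= - dotv e (y - z) + c^-1 / 2 * enorm e ^+ 2
     + gamma * (t + 1) / 6 * enorm (z - y) ^+ 2 - gamma * (t + 4) / 6 * enorm (z - p) ^+ 2.
  have cE : c / 2 * enorm (p - y) ^+ 2 + gamma / 4 * enorm (p - y) ^+ 2 =
            gamma * (t + 1) / 6 * enorm (p - y) ^+ 2 by rewrite cdef; field.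
  have gE : (gamma + gamma * (t + 1) / 3) / 2 * enorm (z - p) ^+ 2 =
            gamma * (t + 4) / 6 * enorm (z - p) ^+ 2 by field.
  rewrite gE in F1; rewrite /Q /surrogate_value /surrogate_smooth.
  clear -F1 dE cE Lp F4 gp gz.
  move: (enorm (p - y) ^+ 2) (enorm (z - y) ^+ 2) (enorm (p - x1) ^+ 2) (enorm (z - x1)
    ^+ 2) (enorm e ^+ 2) (enorm (z - p) ^+ 2) F1 dE cE Lp F4 gp gz => a1 a2 a3 a4 a5 a6.
  move: (c^-1) (dotv e (p - y)) (dotv e (y - z)) (dotv m (p - y)) (dotv m (z - y)) (dotv
    (dh x1) (p - x1)) (dotv (dh x1) (z - x1)) (dotv p v) (dotv z v) (fine (r p)) (fine (r
    z)) (g p) (g z) (g y) (h x1) => b1 b2 b3 b4 b5 b6 b7 b8 b9 c1 c2 c3 c4 c5 c6.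
  lra.
have t10 : 0 < t + 1 by lra.
have H2 : (t + 1) * Q <= (t + 1) * (- dotv e (y - z) + c^-1 / 2 * enorm e ^+ 2
     + gamma * (t + 1) / 6 * enorm (z - y) ^+ 2 - gamma * (t + 4) / 6 * enorm (z - p) ^+ 2).
  by rewrite ler_pM2l.
(* Amounts to [3 * (t + 1) <= 6 * (2 * t - 1)], an equality at [t = 1]. *)
have cV : (t + 1) * (c^-1 / 2) <= 6 / gamma.
  have -> : (t + 1) * (c^-1 / 2) = (3 * (t + 1) / (2 * t - 1)) / gamma.
    by rewrite cdef; field; rewrite gt_eqF//=; apply/eqP; lra.
  by rewrite ler_pM2r ?invr_gt0// ler_pdivrMr; lra.
have H3 : (t + 1) * (c^-1 / 2) * enorm e ^+ 2 <= 6 / gamma * enorm e ^+ 2.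
  exact: ler_wpM2r.
(* Completing the square supplies [3 / (2 * gamma)] of the coefficient [6 / gamma] of
   [enorm e ^+ 2], which leaves the [9 / (2 * gamma)] of the statement. *)
have ee : gamma * (t + 1) ^+ 2 / 6 * (eta ^+ 2 * enorm e ^+ 2)
    = 3 / (2 * gamma) * enorm e ^+ 2.
  by rewrite /eta; field; rewrite !gt_eqF.
have ee1 : gamma * (t + 1) ^+ 2 / 6 * (2 * eta * dotv e (y - z)) = (t + 1) * dotv e (y - z).
  by rewrite /eta; field; rewrite !gt_eqF.
(* The next coefficient fits because [(t + 1) * (t + 4) - (t + 2) ^+ 2 = t]. *)
have g3 : gamma * (t + 2) ^+ 2 / 6 * enorm (z - p) ^+ 2 <=
    (t + 1) * (gamma * (t + 4) / 6 * enorm (z - p) ^+ 2).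
  rewrite [leRHS]mulrA; apply: ler_wpM2r => //; rewrite -subr_ge0.
  have -> : (t + 1) * (gamma * (t + 4) / 6) - gamma * (t + 2) ^+ 2 / 6 = gamma * t / 6 by field.
  by rewrite divr_ge0// mulr_ge0// ?ltW//; lra.
have gE2 : 9 / (2 * gamma) = 6 / gamma - 3 / (2 * gamma) by field; rewrite gt_eqF.
rewrite -/(surrogate_value x1 p) gE2.
rewrite -/Q; lra.
Qed.

(** Without smoothness the gap is controlled at the old point [y], not at [p]: subgradients at [y]
    move the objective from [p] to [y], and the proximal term pays for the displacement. Hence
    Option 2 averages from [t = 1]. *)
Lemma nonsmooth_step (G t : R) p s a b : 1 <= t -> 0 < G ->
  v = a - b -> (forall x, edom r x -> (r y + (dotv s (x - y))%:E <= r x)%E) ->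
  enorm s <= G -> edom r x1 -> spg_region D gamma G x1 y -> spg_region D gamma G x1 z ->
  is_argmin (spg_region D gamma G x1)
    (regularize r (spg_smooth (4 / (gamma * t)) x1 y v)) p ->
  t * (surrogate_value x1 y - surrogate_value x1 z) +
    gamma * (t + 1) ^+ 2 / 8 * enorm (z - p) ^+ 2 <=
  gamma * t ^+ 2 / 8 * enorm (y - z - (4 / (gamma * t)) *: e) ^+ 2 +
    12 / gamma * (enorm a ^+ 2 + enorm b ^+ 2 + 4 * G ^+ 2).
Proof.
move=> t1 G0 vab rs sG rx1 [ry yx1] Cz pmin; set eta := 4 / (gamma * t).
have t0 : 0 < t by lra.
have gt0 : 0 < gamma * t by rewrite mulr_gt0.
have eta0 : 0 < eta by rewrite divr_gt0.
have [rp F1] := @regularize_argmin_strong _ _ _ rNy rcvx _ _ _ p z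
  (region_cvx rNy rcvx (c := x1) (rho := 3 * G / gamma)) (@sconvex_spg (edom r) eta x1 y
    v eta0) pmin Cz rz.
have [[_ px1] _] := pmin.
have F3 : fine (r y) + dotv s (p - y) <= fine (r p).
  by have := rs p rp; rewrite (edomE rNy ry) (edomE rNy rp) -EFinD lee_fin.
(* Total slope at [y] of the linear term, of [r] and of the quadratic centered at [x1]. *)
set w := v + (s + gamma *: (y - x1)).
have F4 := dotv_young w (y - p) eta0.
rewrite -!enorm_sqr in F4.
have eV : eta^-1 = gamma * t / 4 by rewrite /eta invf_div.
have eV2 : (2 * eta)^-1 = gamma * t / 8 by rewrite invfM eV; field.
have Ee : enorm (y - z - eta *: e) ^+ 2 =
    enorm (z - y) ^+ 2 - 2 * eta * dotv e (y - z) + eta ^+ 2 * enorm e ^+ 2.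
  rewrite (enormB z) !enorm_sqr (dotvBB (y - z)) !dotvZl !dotvZr (dotvC _ e); ring.
have N1 : 0 <= enorm (p - y) ^+ 2 by rewrite sqr_ge0.
have N3 : 0 <= enorm (z - p) ^+ 2 by rewrite sqr_ge0.
have N4 : 0 <= enorm e ^+ 2 by rewrite sqr_ge0.
(* [4 * G] is [G] from [s] plus [gamma] times the radius [3 * G / gamma] of the region. *)
have wE : enorm w <= enorm a + enorm b + 4 * G.
  have h1 : enorm w <= enorm v + enorm (s + gamma *: (y - x1)) := enormD _ _.
  have h2 : enorm v <= enorm a + enorm b by rewrite vab -(enormN b) enormD.
  have h3 := enormD s (gamma *: (y - x1)).
  have h4 : enorm (gamma *: (y - x1)) <= 3 * G.
    by rewrite enormZ gtr0_norm// mulrC -ler_pdivlMr.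
  lra.
(* Cauchy-Schwarz on [1 * enorm a + 1 * enorm b + 2 * (2 * G)], whence [6 = 1 + 1 + 4]. *)
have w2 : enorm w ^+ 2 <= 6 * (enorm a ^+ 2 + enorm b ^+ 2 + 4 * G ^+ 2).
  apply: (@le_trans _ _ ((enorm a + enorm b + 4 * G) ^+ 2)).
    by rewrite ler_pXn2r// nnegrE ?enorm_ge0// !addr_ge0 ?enorm_ge0// mulr_ge0// ltW.
  have := sqr_ge0 (enorm a - enorm b); have := sqr_ge0 (enorm a - G).
  have := sqr_ge0 (enorm b - G); rewrite !sqrrB !sqrrD; lra.
have phi : gamma / 2 * enorm (y - x1) ^+ 2 - gamma / 2 * enorm (p - x1) ^+ 2 <=
    gamma * dotv (y - x1) (y - p).
  have h : 0 <= gamma / 2 * dotv (y - p) (y - p).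
    by rewrite mulr_ge0 ?dotv_ge0// divr_ge0// ltW.
  rewrite -subr_ge0; apply: le_trans h _; rewrite le_eqVlt; apply/orP; left.
  by apply/eqP; rewrite !enorm_sqr !dotvE !(dotvC x1) (dotvC p y); field.
have wdot : dotv w (y - p) = dotv v (y - p) + dotv s (y - p) + gamma * dotv (y - x1) (y - p).
  by rewrite /w dotvDl dotvDl dotvZl addrA.
have spE : dotv s (y - p) = - dotv s (p - y) by rewrite -dotvNr opprB.
have dE : dotv p v - dotv z v + dotv v (y - p) = dotv m (y - z)
    - dotv (dh x1) (y - x1) + dotv (dh x1) (z - x1) + dotv e (y - z).
  by rewrite vE !dotvE !(dotvC p) !(dotvC z); ring.
have mE : dotv m (z - y) = - dotv m (y - z) by rewrite -dotvNr opprB.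
pose Q := surrogate_value x1 y - surrogate_value x1 z.
have H : Q <= - dotv e (y - z) + eta / 2 * enorm w ^+ 2
     + gamma * t / 8 * enorm (z - y) ^+ 2 - gamma * (t + 4) / 8 * enorm (z - p) ^+ 2.
  move: F1; rewrite /spg_smooth eV2 eV.
  have -> : (gamma + gamma * t / 4) / 2 * enorm (z - p) ^+ 2 =
            gamma * (t + 4) / 8 * enorm (z - p) ^+ 2 by field.
  rewrite eV (enormB y p) in F4.
  have gz' := gz; rewrite mE in gz'.
  rewrite wdot spE in F4; rewrite /Q /surrogate_value /surrogate_smooth.
  clear -F3 F4 dE gz' phi.
  move: (enorm (p - y) ^+ 2) (enorm (z - y) ^+ 2) (enorm (y - x1) ^+ 2) (enorm (p - x1)
    ^+ 2) (enorm (z - x1) ^+ 2) (enorm w ^+ 2) (enorm (z - p) ^+ 2) F3 F4 dE gz' phi => a1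
    a2 a3 a4 a5 a6 a7.
  move: (dotv v (y - p)) (dotv s (p - y)) (dotv e (y - z)) (dotv m (y - z)) (dotv (y -
    x1) (y - p)) (dotv (dh x1) (y - x1)) (dotv (dh x1) (z - x1)) (dotv p v) (dotv z v)
    (fine (r p)) (fine (r y)) (fine (r z)) (g z) (g y) (h x1) => b1 b2 b3 b4 b5 b6 b7 b8
    b9 c1 c2 c3 c4 c5 c6.
  lra.
have H2 : t * Q <= t * (- dotv e (y - z) + eta / 2 * enorm w ^+ 2
     + gamma * t / 8 * enorm (z - y) ^+ 2 - gamma * (t + 4) / 8 * enorm (z - p) ^+ 2).
  by rewrite ler_pM2l.
have H3 : t * (eta / 2 * enorm w ^+ 2) <=
    12 / gamma * (enorm a ^+ 2 + enorm b ^+ 2 + 4 * G ^+ 2).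
  have -> : t * (eta / 2 * enorm w ^+ 2) = 2 / gamma * enorm w ^+ 2.
    by rewrite /eta; field; rewrite !gt_eqF.
  have -> : 12 / gamma * (enorm a ^+ 2 + enorm b ^+ 2 + 4 * G ^+ 2) =
    2 / gamma * (6 * (enorm a ^+ 2 + enorm b ^+ 2 + 4 * G ^+ 2)) by field; rewrite gt_eqF.
  by apply: ler_wpM2l => //; rewrite divr_ge0// ltW.
have ee : 0 <= gamma * t ^+ 2 / 8 * (eta ^+ 2 * enorm e ^+ 2).
  apply: mulr_ge0; first by rewrite divr_ge0// mulr_ge0 ?sqr_ge0// ltW.
  by rewrite mulr_ge0 ?sqr_ge0.
have ee1 : gamma * t ^+ 2 / 8 * (2 * eta * dotv e (y - z)) = t * dotv e (y - z).
  by rewrite /eta; field; rewrite !gt_eqF.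
have g3 : gamma * (t + 1) ^+ 2 / 8 * enorm (z - p) ^+ 2 <=
    t * (gamma * (t + 4) / 8 * enorm (z - p) ^+ 2).
  rewrite [leRHS]mulrA; apply: ler_wpM2r => //; rewrite -subr_ge0.
  have -> : t * (gamma * (t + 4) / 8) - gamma * (t + 1) ^+ 2 / 8 = gamma * (2 * t - 1) / 8 by field.
  by rewrite divr_ge0// mulr_ge0// ?ltW//; lra.
rewrite Ee -/Q; lra.
Qed.

End step.

End objectives.

(** * Subgradients and stability of minimizers *)

Section subgradients.
Variables (R : realType) (n : nat) (g : 'rV[R]_n -> R).
Implicit Types x y p : 'rV[R]_n.

(** The subgradient inequality along a coordinate, with positive and with negative increments,
    squeezes [v 0 i] between difference quotients of the same limit. Thus the mean stochastic
    subgradient inherits the Lipschitz bound of the gradient. *)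
Lemma subgradient_gradient x v : differentiable g x ->
  subdifferential (EFin \o g) x v -> v = gradient g x.
Proof.
move=> dg sv; apply/rowP => i; rewrite mxE.
have D : (fun h : R => h^-1 *: (g (h *: delta_mx 0 i + x) - g x)) @ 0^' -->
    'D_(delta_mx 0 i) g x by exact: diff_derivable.
have q (h : R) : h * v 0 i <= g (h *: delta_mx 0 i + x) - g x.
  have := sv (h *: delta_mx 0 i + x); rewrite -EFinD lee_fin addrK dotvZr.
  rewrite {1}/dotv (bigD1 i)//= big1 ?addr0; last first.
    by move=> j /negPf ji; rewrite mxE ji mulr0.
  by rewrite mxE !eqxx mulr1; lra.
have near_D e : 0 < e -> exists2 d : R, 0 < d & forall h, h != 0 -> `|h| < d ->
    `|'D_(delta_mx 0 i) g x - h^-1 * (g (h *: delta_mx 0 i + x) - g x)| <= e.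
  move=> e0; move/cvgrPdist_le: (D) => /(_ _ e0)/nbhs_ballP[d d0 H].
  exists d => // h h0 hd; apply: H => //.
  by rewrite -ball_normE/= sub0r normrN.
apply/eqP; rewrite eq_le; apply/andP; split; apply/ler_addgt0Pr => e e0;
  have [d d0 H] := near_D e e0.
- have h0 : 0 < d / 2 by rewrite divr_gt0.
  have := H (d / 2) (lt0r_neq0 h0); rewrite gtr0_norm// => /(_ ltac:(lra)).
  rewrite ler_norml => /andP[+ _]; have := q (d / 2).
  rewrite -ler_pdivlMl//; lra.
- have h0 : 0 < d / 2 by rewrite divr_gt0.
  have hn : - (d / 2) != 0 by rewrite oppr_eq0 lt0r_neq0.
  have := H (- (d / 2)) hn; rewrite normrN gtr0_norm// => /(_ ltac:(lra)).
  rewrite ler_norml => /andP[_ +]; have := q (- (d / 2)).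
  rewrite mulNr lerNl -ler_pdivrMl// invrN mulNr mulrN; lra.
Qed.

(* Convexity on each half of the segment replaces an integration along it; this
   costs 3/4 L instead of L/2. *)
Lemma descent (m : 'rV[R]_n -> 'rV[R]_n) (L : R) y p :
  (forall x y, g x + dotv (m x) (y - x) <= g y) ->
  (forall x y, enorm (m x - m y) <= L * enorm (x - y)) ->
  g p <= g y + dotv (m y) (p - y) + 3 / 4 * L * enorm (p - y) ^+ 2.
Proof.
move=> sg mL; set d := p - y; pose u := y + 2^-1 *: d.
have up : u - p = - (2^-1 *: d).
  by rewrite /u /d scalerBr opprB; apply/rowP => i; rewrite !mxE; field.
have yu : y - u = - (2^-1 *: d) by rewrite /u opprD addrA subrr sub0r.
have h1 := sg p u; have h2 := sg u y.
rewrite up dotvNr dotvZr in h1; rewrite yu dotvNr dotvZr in h2.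
(* Used at [p] with [a = 1] and at the midpoint with [a = 1 / 2]; each counts for half, and
   [(1 + 1 / 2) / 2 = 3 / 4]. *)
have lip x (a : R) : 0 <= a -> enorm (x - y) = a * enorm d ->
    dotv (m x) d <= dotv (m y) d + L * a * enorm d ^+ 2.
  move=> a0 xE; have -> : dotv (m x) d = dotv (m y) d + dotv (m x - m y) d.
    by rewrite dotvDl dotvNl; ring.
  rewrite lerD2l; apply: le_trans (dotv_le_enorm _ _) _.
  rewrite expr2 mulrA ler_wpM2r ?enorm_ge0//; apply: le_trans (mL _ _) _.
  by rewrite xE mulrA.
have l1 := lip p 1 ler01; rewrite mul1r mulr1 in l1.
have l2 : dotv (m u) d <= dotv (m y) d + L * 2^-1 * enorm d ^+ 2.
  by apply: lip => //; rewrite enormB yu enormN enormZ gtr0_norm.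
have {}l1 := l1 erefl.
rewrite -/(dotv (m y) d); lra.
Qed.

End subgradients.

(** * Dependence of minimizers on the proximal center and on the region *)

Section argmin_stability.
Variables (R : realType) (n : nat) (r : 'rV[R]_n -> \bar R).
Hypotheses (rNy : forall x, (-oo < r x)%E) (rlsc : lower_semicontinuous r)
  (rcvx : econvex r).
Variables (q : 'rV[R]_n -> R) (qcvx : sconvex setT 0 q).
Variables (b : R) (b0 : 0 < b).
Implicit Types (x y c p : 'rV[R]_n) (C : set 'rV[R]_n).

(** Completing the square brings the surrogate and the SPG objective to this form up to a constant,
    so their minimizers depend on the data only through [c] and the feasible set. *)
Definition prox_smooth c x : R := q x + b / 2 * enorm (x - c) ^+ 2.

Lemma sconvex_prox A c : sconvex A b (prox_smooth c).
Proof.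
have := sconvexD (sconvexS (@subsetT _ A) qcvx) (@sconvex_sqr _ _ A b c).
by rewrite add0r.
Qed.

(** Each minimizer is compared with the other one; the two strong convexity inequalities add up to
    [|p - p'|^2 <= <p - p', c - c'>], and Cauchy-Schwarz concludes. *)
Lemma prox_nonexpansive C c c' p p' : cvx_set C -> C `&` edom r !=set0 ->
  is_argmin C (regularize r (prox_smooth c)) p ->
  is_argmin C (regularize r (prox_smooth c')) p' ->
  enorm (p - p') <= enorm (c - c').
Proof.
move=> cC [x0 [Cx0 rx0]] mp mp'; have [[Cp _] [Cp' _]] := (mp, mp').
have H c1 p1 := @regularize_argmin_strong _ _ _ rNy rcvx C _ b p1 _ cC
  (@sconvex_prox (edom r) c1).
have [rp _] := H _ _ _ mp Cx0 rx0; have [rp' _] := H _ _ _ mp' Cx0 rx0.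
have [_ h1] := H _ _ _ mp Cp' rp'; have [_ h2] := H _ _ _ mp' Cp rp.
have {H} h3 : b * enorm (p - p') ^+ 2 <= b * dotv (p - p') (c - c').
  move: h1 h2; rewrite /prox_smooth (enormB p' p) !enorm_sqr !dotvBB !dotvE.

  move: (fine (r p)) (fine (r p')) (q p) (q p') (dotv p p) (dotv p' p') (dotv p p')
    (dotv p c) (dotv p c') (dotv p' c) (dotv p' c') (dotv c c) (dotv c' c').
  by move=> a1 a2 a3 a4 a5 a6 a7 a8 a9 a10 a11 a12 a13; lra.
rewrite ler_pM2l// in h3.
have {}h3 := le_trans h3 (dotv_le_enorm _ _).
have [->|N0] := eqVneq (enorm (p - p')) 0; first exact: enorm_ge0.
by rewrite -(@ler_pM2l _ (enorm (p - p'))) -?expr2// lt_neqAle eq_sym N0 enorm_ge0.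
Qed.

End argmin_stability.

(** An equality of predicates, because [argmin] is [get] of the predicate: the selected minimizers
    then coincide without an appeal to uniqueness. *)
Lemma argmin_addr (R : realType) (n : nat) (r : 'rV[R]_n -> \bar R) C
    (q1 q2 : 'rV[R]_n -> R) (k : R) : (forall x, q1 x = q2 x + k) ->
  is_argmin C (regularize r q1) = is_argmin C (regularize r q2).
Proof.
move=> q12; apply/funext => p; rewrite /is_argmin /regularize; apply/propext.
have e x : (r x + (q1 x)%:E = r x + (q2 x)%:E + k%:E)%E by rewrite q12 EFinD addeA.
by split=> -[Cp h]; split=> // y Cy; have := h y Cy; rewrite !e leeD2rE.
Qed.

Section bounded_subgradient.
Variables (R : realType) (n : nat) (Xi Vs : Type) (D : dc_problem R n Xi Vs).
Variables (gamma G : R) (gamma0 : 0 < gamma) (G0 : 0 < G).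
Local Notation r := (dc_r D).
Hypotheses (rprop : eproper r) (rlsc : lower_semicontinuous r) (rcvx : econvex r).
Hypothesis rsub : forall x, edom r x -> exists2 s,
  (forall y, edom r y -> (r x + (dotv s (y - x))%:E <= r y)%E) & enorm s <= G.
Implicit Types (x y z c p : 'rV[R]_n).

Let rNy := rprop.1.

Lemma edom_lipschitz x y : edom r x -> edom r y ->
  fine (r x) - fine (r y) <= G * enorm (x - y).
Proof.
move=> rx ry; have [s /(_ y ry)] := rsub rx.
rewrite (edomE rNy rx) (edomE rNy ry) -EFinD lee_fin => h sG.
have h2 : dotv s (x - y) <= G * enorm (x - y).
  by apply: le_trans (dotv_le_enorm _ _) _; rewrite ler_wpM2r ?enorm_ge0.
by rewrite -opprB dotvNr in h; lra.
Qed.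

(* The point is [p] shrunk towards the new center [y']. *)
Lemma region_near y y' p : edom r y' -> spg_region D gamma G y p ->
  exists2 x, spg_region D gamma G y' x & enorm (x - p) <= enorm (y - y').
Proof.
move=> ry' [rp]; rewrite /spg_region; set rho := 3 * G / gamma => py; set d := enorm (y - y').
have rho0 : 0 < rho by rewrite divr_gt0// mulr_gt0.
have d0 : 0 <= d by exact: enorm_ge0.
have pd : enorm (p - y') <= rho + d by have := enorm_dist_le p y y'; rewrite /d; lra.
have rd : 0 < rho + d by lra.
have t01 : 0 <= rho / (rho + d) <= 1.
  by rewrite (divr_ge0 (ltW rho0) (ltW rd))/= ler_pdivrMr// mul1r; lra.
have t1 : 1 - rho / (rho + d) = d / (rho + d) by field; rewrite gt_eqF.
exists ((rho / (rho + d)) *: p + (1 - rho / (rho + d)) *: y').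
  split; first exact: edom_cvx.
  have -> : (rho / (rho + d)) *: p + (1 - rho / (rho + d)) *: y' - y' =
    (rho / (rho + d)) *: (p - y') by apply/rowP => i; rewrite !mxE; ring.
  rewrite enormZ ger0_norm; last by case/andP: t01.
  rewrite -[leRHS](divfK (lt0r_neq0 rd)); apply: ler_wpM2l => //.
  by case/andP: t01.
have -> : (rho / (rho + d)) *: p + (1 - rho / (rho + d)) *: y' - p =
    (1 - rho / (rho + d)) *: (y' - p) by apply/rowP => i; rewrite !mxE; ring.
rewrite t1 enormZ ger0_norm; last by rewrite (divr_ge0 d0 (ltW rd)).
rewrite enormB -[leRHS](divfK (lt0r_neq0 rd)); apply: ler_wpM2l => //.
by rewrite (divr_ge0 d0 (ltW rd)).
Qed.

Variables (b : R) (b0 : 0 < b).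

Let Phi c x : R := fine (r x) + prox_smooth (fun=> 0) b c x.

Let Phi_lip B c x y : edom r x -> edom r y -> enorm (x - c) <= B ->
  enorm (y - c) <= B -> Phi c x - Phi c y <= (G + b * B) * enorm (x - y).
Proof.
move=> rx ry xB yB; have := edom_lipschitz rx ry.
rewrite /Phi /prox_smooth => h.
have h1 : enorm (x - c) ^+ 2 - enorm (y - c) ^+ 2 <= 2 * B * enorm (x - y).
  have l : enorm (x - c) - enorm (y - c) <= enorm (x - y).
    by have := enorm_dist_le x y c; lra.
  rewrite subr_sqr; have s0 : 0 <= enorm (x - c) + enorm (y - c).
    by rewrite addr_ge0 ?enorm_ge0.
  apply: (@le_trans _ _ (enorm (x - y) * (enorm (x - c) + enorm (y - c)))).
    exact: ler_wpM2r.
  by rewrite mulrC ler_wpM2r ?enorm_ge0//; lra.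
have h2 : b / 2 * (enorm (x - c) ^+ 2 - enorm (y - c) ^+ 2) <= b / 2 * (2 * B * enorm (x - y)).
  by apply: ler_wpM2l => //; rewrite divr_ge0// ltW.
lra.
Qed.

(* For a fixed region the minimizer is nonexpansive in [c]; moving the center by
   [d] moves every feasible point by at most [d], hence the minimal value by
   O(d), and strong convexity turns this into O(sqrt d) for the minimizer. *)
Lemma region_argmin_continuous y c (e : R) : edom r y -> 0 < e ->
  exists2 d : R, 0 < d & forall y' c' p p', edom r y' ->
    enorm (y - y') <= d -> enorm (c - c') <= d ->
    is_argmin (spg_region D gamma G y) (regularize r (prox_smooth (fun=> 0) b c)) p ->
    is_argmin (spg_region D gamma G y') (regularize r (prox_smooth (fun=> 0) b c')) p' ->
    enorm (p - p') <= e.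
Proof.
move=> ry e0; set rho := 3 * G / gamma.
have rho0 : 0 < rho by rewrite divr_gt0// mulr_gt0.
(* The points compared below lie within [rho + 2] of [y], hence within [B] of [c], and [M] is a
   Lipschitz constant of the objective on them. *)
pose B := rho + enorm (y - c) + 2.
have N0 := enorm_ge0 (y - c).
have B0 : 0 < B by rewrite /B; lra.
pose M := G + b * B.
have M0 : 0 < M by rewrite /M addr_gt0// mulr_gt0.
(* The path from [p] to [p'] through [x1] and [p2] has three pieces of length at most [e / 4]; the
   last bound on [d] gives [2 * M * d <= b / 2 * (e / 4) ^+ 2] for the middle one. *)
pose d := Num.min 1 (Num.min (e / 4) (b * e ^+ 2 / (64 * M))).
exists d; first by rewrite !lt_min ltr01/= !divr_gt0// mulr_gt0// exprn_gt0.
move=> y' c' p p' ry' yy' cc' mp mp'.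
have [d1 d2 d3] : [/\ d <= 1, d <= e / 4 & d <= b * e ^+ 2 / (64 * M)].
  by rewrite /d !ge_min !lexx ?orbT.
have q0 : sconvex setT 0 (fun _ : 'rV[R]_n => 0 : R).
  by move=> t x z _ _ _; rewrite !mulr0 !mul0r; lra.
have yC z : edom r z -> spg_region D gamma G z z.
  by move=> rz; split=> //; rewrite subrr enorm0 ltW.
(* [p2] belongs to the moved region with the old center, which separates the two perturbations. *)
have [p2 mp2] : exists p2,
    is_argmin (spg_region D gamma G y') (regularize r (prox_smooth (fun=> 0) b c)) p2.
  apply: regularize_region_argmin => //; last exact: ltW.
  apply: continuous_lsc; rewrite /prox_smooth; under eq_fun do rewrite add0r.
  exact: continuous_sqr_enormB.
have p2p' : enorm (p2 - p') <= e / 4.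
  apply: le_trans d2; apply: le_trans cc'.
  apply: (prox_nonexpansive rNy rcvx q0 b0 _ _ mp2 mp').
    exact: region_cvx.
  by exists y'; split => //; exact: yC.
suff pp2 : enorm (p - p2) <= e / 4 + e / 4.
  by have := enorm_dist_le p p2 p'; lra.
have [[Cp _] [Cp2 _]] := (mp, mp2).
have [x1 Cx1 x1p] := region_near ry' Cp.
have [x2 Cx2 x2p] := region_near ry Cp2.
rewrite (enormB y' y) in x2p.
have [_ h1] := regularize_argmin_strong rNy rcvx (region_cvx rNy rcvx (c := y') (rho := rho))
  (@sconvex_prox _ _ _ q0 b (edom r) c) mp2 Cx1 Cx1.1.
have [_ h2] := regularize_argmin_strong rNy rcvx (region_cvx rNy rcvx (c := y) (rho := rho))
  (@sconvex_prox _ _ _ q0 b (edom r) c) mp Cx2 Cx2.1.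
rewrite -/(Phi c p2) -/(Phi c x1) in h1; rewrite -/(Phi c p) -/(Phi c x2) in h2.
have bound z : enorm (z - y) <= rho + 2 -> enorm (z - c) <= B.
  by have := enorm_dist_le z y c; rewrite /B; lra.
have pB : enorm (p - y) <= rho by case: Cp.
have p2B : enorm (p2 - y) <= rho + d.
  by case: Cp2 => _; have := enorm_dist_le p2 y' y; rewrite (enormB y' y) -/rho; lra.
have x1B : enorm (x1 - y) <= rho + 1 by have := enorm_dist_le x1 p y; lra.
have x2B : enorm (x2 - y) <= rho + 2 by have := enorm_dist_le x2 p2 y; lra.
have h3 : Phi c x1 - Phi c p <= M * enorm (x1 - p).
  by apply: Phi_lip; [exact: Cx1.1|exact: Cp.1|apply: bound; lra|apply: bound; lra].
have h4 : Phi c x2 - Phi c p2 <= M * enorm (x2 - p2).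
  by apply: Phi_lip; [exact: Cx2.1|exact: Cp2.1|apply: bound; lra|apply: bound; lra].
have h5 : M * enorm (x1 - p) <= M * d by apply: ler_wpM2l; lra.
have h6 : M * enorm (x2 - p2) <= M * d by apply: ler_wpM2l; lra.
have h7 : 0 <= b / 2 * enorm (x2 - p) ^+ 2.
  by rewrite mulr_ge0 ?sqr_ge0// divr_ge0// ltW.
have h8 : M * d <= b * e ^+ 2 / 64.
  have -> : b * e ^+ 2 / 64 = M * (b * e ^+ 2 / (64 * M)).
    by field; rewrite lt0r_neq0.
  by apply: ler_wpM2l => //; exact: ltW.
have h9 : enorm (x1 - p2) <= e / 4.
  rewrite enorm_le; last by rewrite divr_ge0// ltW.
  rewrite -enorm_sqr -(@ler_pM2l _ (b / 2)); last by rewrite divr_gt0.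
  have -> : b / 2 * (e / 4) ^+ 2 = b * e ^+ 2 / 64 + b * e ^+ 2 / 64 by field.
  lra.
have := enorm_dist_le p x1 p2; rewrite (enormB p x1); lra.
Qed.

(** Strong convexity gives [gamma * |z - x|^2 <= - <m + s - dh x, z - x>], where each of the three
    vectors has norm at most [G]. The comparison point is therefore feasible in Option 2. *)
Lemma prox_point_dist x m :
  lower_semicontinuous (EFin \o dc_g D) -> sconvex setT 0 (dc_g D) ->
  (forall y, dc_g D x + dotv m (y - x) <= dc_g D y) ->
  enorm m <= G -> enorm (dc_dh D x) <= G -> edom r x ->
  enorm (prox_point D gamma x - x) <= 3 * G / gamma.
Proof.
move=> glsc gcvx gm mG hG rx; set z := prox_point D gamma x.
have [rz h] := prox_point_strong gamma0 glsc gcvx rprop rlsc rcvx x rx.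
rewrite -/z in rz h.
have [s /(_ z rz) sz sG] := rsub rx.
rewrite (edomE rNy rx) (edomE rNy rz) -EFinD lee_fin in sz.
have {}gm := gm z.
move: h; rewrite /surrogate_value /surrogate_smooth subrr enorm0 [dotv _ 0]dotvC dotv0l.
rewrite expr0n mulr0 !addr0 (enormB x z) => h.
have dw : - dotv (m + s - dc_dh D x) (z - x) <= 3 * G * enorm (z - x).
  rewrite -dotvNl; apply: le_trans (dotv_le_enorm _ _) _.
  apply: ler_wpM2r; first exact: enorm_ge0.
  rewrite enormN; have := enormD (m + s) (- dc_dh D x); have := enormD m s.
  by rewrite enormN; lra.
rewrite dotvDl dotvDl dotvNl in dw.
have h2 : gamma * enorm (z - x) ^+ 2 <= 3 * G * enorm (z - x) by lra.
have [z0|z0] := eqVneq (enorm (z - x)) 0.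
  by rewrite z0 divr_ge0 ?mulr_ge0// ltW.
rewrite ler_pdivlMr// -(@ler_pM2r _ (enorm (z - x))); first by lra.
by rewrite lt_neqAle eq_sym z0 enorm_ge0.
Qed.

End bounded_subgradient.

(** * Measurability and independence *)

Section borel_rV.
Variables (R : realType) (n : nat).

Lemma open_borel_rV (U : set 'rV[R]_n) : open U -> measurable (U : set (borel_rV R n)).
Proof. by move=> oU; exact: sub_sigma_algebra. Qed.

Lemma measurable_coord (i : 'I_n) :
  measurable_fun setT (fun x : borel_rV R n => x 0 i : R).
Proof.
apply: (measurability _ (RGenOInfty.measurableE R)) => //.
move=> /= _ [_ [a ->] <-]; rewrite setTI; apply: open_borel_rV.
rewrite preimage_itvoy; have oa := @open_gt R a.
by apply: (@open_comp _ _ (fun x : 'rV[R]_n => x 0 i) [set y | a < y]) => // x _; exact: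
  coord_continuous.
Qed.

Lemma lower_semicontinuous_borel (f : 'rV[R]_n -> \bar R) :
  lower_semicontinuous f -> measurable_fun setT (f : borel_rV R n -> \bar R).
Proof.
move=> lf; apply: (measurability _ (ErealGenOInfty.measurableE R)).
move=> /= _ [_ [a ->]] <-; rewrite setTI; apply: open_borel_rV.
by rewrite preimage_itvoy; move/lower_semicontinuousP : lf; exact.
Qed.

Lemma borel_rV_measurable d (T : measurableType d) (X : T -> borel_rV R n) :
  (forall i, measurable_fun setT (fun w => X w 0 i : R)) -> measurable_fun setT X.
Proof.
move=> mX; apply: (measurability (@open 'rV[R]_n : set (set (borel_rV R n)))) => //.
move=> /= _ [U oU <-]; rewrite setTI.
(* [U] is the union of the countably many rational cubes it contains. *)
pose B (p : 'rV[rat]_n * nat) : set 'rV[R]_n :=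
  [set x | forall i, ball (ratr (p.1 0 i) : R) p.2.+1%:R^-1 (x 0 i)].
have -> : X @^-1` U = \bigcup_p (if `[< B p `<=` U >] then X @^-1` B p else set0).
  apply/seteqP; split => [w UXw|w [p _]]; last first.
    by case: asboolP => [BU /BU|//].
  have /nbhs_ballP[e e0 eU] : nbhs (X w) U by apply: open_nbhs_nbhs.
  have [k ke] : exists k, k.+1%:R^-1 < e / 2.
    by have [k _ H] := near_infty_natSinv_lt (PosNum (divr_gt0 e0 (ltr0n _ 2))); exists
      k; apply: (H k) => /=.
  have H i : exists q : rat, ball (ratr q : R) k.+1%:R^-1 (X w 0 i).
    have : X w 0 i - k.+1%:R^-1 < X w 0 i + k.+1%:R^-1.
      by rewrite ltrD2l gtrN// invr_gt0.
    move=> /rat_in_itvoo[q]; rewrite in_itv/= => /andP[q1 q2]; exists q.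
    by rewrite /ball/= ltr_distl q1.
  have [q qP] := choice H.
  exists (\row_i q i, k) => //; case: asboolP => [_ i /=|[]].
    by rewrite mxE; exact: qP.
  move=> x Bx; apply: eU; split => // i j; rewrite ord1.
  have := Bx j; have := qP j; rewrite /= mxE /ball/= => h1 h2.
  rewrite (le_lt_trans (ler_distD (ratr (q j)) _ _))//.
  by rewrite [e in _ < e]splitr ltrD// (lt_trans _ ke)// distrC.
apply: countable_bigcupT_measurable => // p; case: asboolP => // _.
have -> : X @^-1` B p =
    \bigcap_(i in [set: 'I_n]) ((fun w => X w 0 i) @^-1` ball (ratr (p.1 0 i) : R) p.2.+1%:R^-1).
  by apply/seteqP; split => [w h i _|w h i]; [exact: h|exact: h].
apply: fin_bigcap_measurable => // i _; rewrite -[X in measurable X]setTI.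
by apply: mX => //; apply: open_measurable; exact: ball_open.
Qed.

End borel_rV.

(* [A] need not be measurable: [p \o X] pulls [U] back to the preimage under [X]
   of an open set. *)
Lemma continuous_within_measurable (R : realType) n m d (T : measurableType d) (A : set 'rV[R]_m)
    (p : 'rV[R]_m -> 'rV[R]_n) (X : T -> borel_rV R m) :
  measurable_fun setT X -> (forall w, A (X w)) ->
  (forall x (e : R), A x -> 0 < e -> exists2 d : R, 0 < d &
    forall y, A y -> enorm (x - y) <= d -> enorm (p x - p y) <= e) ->
  measurable_fun setT (p \o X : T -> borel_rV R n).
Proof.
move=> mX AX cp; apply: (measurability (@open 'rV[R]_n : set (set (borel_rV R n)))) => //.
move=> /= _ [U oU <-]; rewrite setTI.
pose V := \bigcup_(s in [set s : 'rV[R]_m * R | 0 < s.2 /\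
  forall y, A y -> ball s.1 s.2 y -> U (p y)]) ball s.1 s.2.
have oV : open V by apply: bigcup_open => s [s0 _]; exact: ball_open.
rewrite (_ : _ @^-1` _ = X @^-1` V).
  have := mX measurableT V (open_borel_rV oV); by rewrite setTI.
apply/seteqP; split => [w /= Uw|w [s [s0 sU] sw]]; last exact: sU.
have /nbhs_ballP[e e0 eU] : nbhs (p (X w)) U by apply: open_nbhs_nbhs.
have [d0 d00 dP] := cp (X w) (e / 2) (AX w) ltac:(by rewrite divr_gt0).
exists (X w, d0 / m.+1%:R); last by apply: ballxx; rewrite divr_gt0.
split; first by rewrite /= divr_gt0.
move=> y Ay; rewrite -ball_normE/= ltr_pdivlMr// => xy; apply: eU.
rewrite -ball_normE/=; apply: le_lt_trans (normr_le_enorm _) _.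
apply: (@le_lt_trans _ _ (e / 2)); last by rewrite ltr_pdivrMr// mulr2n mulrDr mulr1 ltrDl.
apply: dP => //; apply: le_trans (enorm_le_normr _) _.
by apply: le_trans (ltW xy); rewrite mulrC ler_wpM2l// ler_nat.
Qed.

(** * Independence of a draw from the past *)

Section independence.
Variables (d : measure_display) (Om : measurableType d) (R : realType)
  (P : probability Om R) (I : choiceType) (S : I -> set (set Om)).
Hypotheses (ST : forall i, S i setT) (SI : forall i, setI_closed (S i))
  (Sm : forall i, S i `<=` measurable) (indep : mutually_independent P S).

Definition joint_system (J : set I) : set (set Om) := \bigcup_(i in J) S i.

Let pi_system (J : set I) : set (set Om) := [set B | exists F : {fset I}, exists A : I -> set Om,
  [/\ [set` F] `<=` J, forall i, i \in F -> S i (A i) & B = \bigcap_(i in [set` F]) A i]].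

(** For fixed [B], the finite measures [m1] (restriction to [B]) and [m2] (scaling by [P B]) agree
    on the finite intersections of events of index in [J], a pi-system that generates the
    sigma-algebra. *)
Lemma independent_joint (J : set I) i A B : ~ J i -> <<s joint_system J >> A -> S i B ->
  (P (A `&` B) = P A * P B)%E.
Proof.
move=> Ji SA SB; have mB := Sm SB.
have PBfin : P B \is a fin_num by apply: fin_num_measure.
have r0 : 0 <= fine (P B) by apply: fine_ge0.
pose m1 : measure _ _ := mrestr P mB.
pose m2 : measure _ _ := mscale (NngNum r0) P.
have m2E C : m2 C = (P C * P B)%E by rewrite /m2/= /mscale/= fineK// muleC.
have m1E C : m1 C = P (C `&` B) by [].
have pim : pi_system J `<=` measurable.
  move=> _ [F [C [_ FC ->]]]; apply: fin_bigcap_measurable => // j Fj.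
  exact/(Sm (i := j))/FC.
have piI : setI_closed (pi_system J).
  move=> _ _ [F [C [FJ FC ->]]] [F' [C' [FJ' FC' ->]]].
  (* Both intersections are written over the union of their index sets, absent events being
     [setT]. *)
  pose E j := (if j \in F then C j else setT) `&` (if j \in F' then C' j else setT).
  exists (F `|` F')%fset, E; split.
  - by move=> j /=; rewrite in_fsetU => /orP[/FJ|/FJ'].
  - move=> j _; rewrite /E; apply: SI; case: ifP => // jF; [exact: FC|exact: FC'].
  - apply/seteqP; split => [w [h h'] j _|w h].
      by rewrite /E; split; case: ifP => // jF; [exact: h|exact: h'].
    split => j /= jF; have := h j; rewrite /= in_fsetU jF ?orbT/= => /(_ isT) [];
      by rewrite jF.
have m12 C : pi_system J C -> m1 C = m2 C.
  move=> [F [C' [FJ FC ->]]]; rewrite m1E m2E indep// muleC.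
  have iF : i \notin F by apply/negP => /FJ.
  (* [B] is adjoined to the family as the event of index [i], a new index because [J] omits it. *)
  pose E j := if j == i then B else C' j.
  rewrite (_ : _ `&` B = \bigcap_(j in [set` (i |` F)%fset]) E j).
    rewrite indep; last first.
      move=> j; rewrite in_fset1U /E; case: eqVneq => [->//|ji /= jF]; exact: FC.
    rewrite big_fsetU1//= {1}/E eqxx; congr (_ * _)%E.
    rewrite big_seq [in RHS]big_seq; apply: eq_bigr => j jF; rewrite /E ifF//.
    by apply/negbTE; apply: contra iF => /eqP <-.
  apply/seteqP; split => [w [h hB] j|w h].
    rewrite /= in_fset1U /E; case: eqVneq => [//|ji /= jF]; exact: h.
  split; last by have := h i; rewrite /= in_fset1U eqxx /E eqxx; apply.
  move=> j jF; have := h j; rewrite /= in_fset1U /E jF orbT => /(_ isT).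
  by case: eqVneq => // ji; rewrite -ji jF in iF.
have piT : pi_system J setT.
  by exists fset0, (fun=> setT); split => //; apply/seteqP; split.
have : m1 A = m2 A.
  apply: (@g_sigma_algebra_measure_unique _ _ _ (pi_system J) pim (fun=> setT)) => //.
  - by apply/seteqP; split => // w _; exists 0%N.
  - by move=> _; rewrite m1E setTI ltey_eq PBfin.
  apply: sub_sigma_algebra2 SA => C [j Jj SC].
  exists [fset j]%fset, (fun=> C); split.
  - by move=> k /=; rewrite in_fset1 => /eqP ->.
  - by move=> k; rewrite in_fset1 => /eqP ->.
  - apply/seteqP; split => [w Cw k _ //|w /(_ j)]; apply; by rewrite /= in_fset1.
by rewrite m1E m2E.
Qed.

Definition adapted d' (T : measurableType d') (J : set I) (X : Om -> T) :=
  forall B, measurable B -> <<s joint_system J >> (X @^-1` B).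

Lemma joint_system_measurable J : <<s joint_system J >> `<=` measurable.
Proof.
apply: smallest_sub; first exact: sigma_algebra_measurable.
by move=> A [i _ /Sm].
Qed.

Lemma adapted_measurable d' (T : measurableType d') J (X : Om -> T) :
  adapted J X -> measurable_fun setT X.
Proof. by move=> aX _ B mB; rewrite setTI; apply: (@joint_system_measurable J); exact: aX. Qed.

Lemma adaptedS d' (T : measurableType d') J J' (X : Om -> T) :
  J `<=` J' -> adapted J X -> adapted J' X.
Proof.
move=> JJ aX B mB; apply: sub_sigma_algebra2 (aX _ mB) => A [i Ji SA].
by exists i => //; exact: JJ.
Qed.

(** Read as measurability on another space, adaptedness is covered by every measurability lemma;
    this is why those on the iterates are stated on an arbitrary space. *)
Lemma adaptedP d' (T : measurableType d') J (X : Om -> T) : adapted J X <->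
  measurable_fun [set: g_sigma_algebraType (joint_system J)] (X : g_sigma_algebraType
    (joint_system J) -> T).
Proof.
split=> [aX _ B mB|mX B mB]; first by rewrite setTI; exact: aX.
by have := mX measurableT B mB; rewrite setTI.
Qed.

(** By independence the law of [(X, Y)] and the product of the marginal laws agree on rectangles,
    hence everywhere; Tonelli then applies to [f >= 0]. *)
Lemma integral_independent d1 d2 (T1 : measurableType d1) (T2 : measurableType d2)
    (J : set I) i (X : Om -> T1) (Y : {RV P >-> T2}) (nu : probability T2 R)
    (f : T1 * T2 -> \bar R) :
  adapted J X -> ~ J i -> S i = g_sigma_algebra_preimage (Y : Om -> T2) -> has_law Y nu ->
  measurable_fun setT f -> (forall x, (0 <= f x)%E) ->
  (\int[P]_w f (X w, Y w) = \int[P]_w \int[nu]_b f (X w, b))%E.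
Proof.
move=> aX Ji SY Ynu mf f0.
have mX : measurable_fun setT X := adapted_measurable aX.
pose X' : {mfun Om >-> T1} := HB.pack X (isMeasurableFun.Build _ _ _ _ X mX).
have mZ : measurable_fun setT (fun w => (X w, Y w)).
  by apply: measurable_fun_pair => //; exact: measurable_funPT.
pose Z : {mfun Om >-> (T1 * T2)%type} :=
  HB.pack (fun w => (X w, Y w)) (isMeasurableFun.Build _ _ _ _ _ mZ).
have rect (A : set T1) (B : set T2) : measurable A -> measurable B ->
    distribution P Z (A `*` B) = (distribution P X' A * nu B)%E.
  move=> mA mB; rewrite -Ynu// /distribution/= /pushforward.
  rewrite (_ : _ @^-1` (A `*` B) = X @^-1` A `&` Y @^-1` B) //.
  apply: independent_joint Ji (aX _ mA) _.
  by rewrite SY; exists B => //; rewrite setTI.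
transitivity (\int[distribution P Z]_z f z)%E.
  by rewrite (ge0_integral_pushforward mZ) ?preimage_setT.
transitivity (\int[distribution P X' \x nu]_z f z)%E.
  apply: eq_measure_integral => A mA _; symmetry.
  exact: (product_measure_unique rect).
rewrite fubini_tonelli1// /fubini_F.
rewrite (ge0_integral_pushforward mX) ?preimage_setT//.
  exact: measurable_fun_fubini_tonelli_F.
by move=> x _; apply: integral_ge0.
Qed.

End independence.

(** * Centered noise *)

Lemma integral_probability_cst (R : realType) d (T : measurableType d)
  (mu : probability T R) (a : R) : (\int[mu]_w a%:E)%E = a%:E.
Proof.
rewrite integral_cst// -[RHS]mule1; congr (_ * _)%E; exact: probability_setT.
Qed.

Section noise.
Variables (R : realType) (n : nat).

Lemma measurable_dotv d (T : measurableType d) (X Y : T -> 'rV[R]_n) :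
  (forall i, measurable_fun setT (fun w => X w 0 i)) ->
  (forall i, measurable_fun setT (fun w => Y w 0 i)) ->
  measurable_fun setT (fun w => dotv (X w) (Y w)).
Proof. by move=> mX mY; apply: measurable_sum => i; exact: measurable_funM. Qed.

Lemma measurable_enorm2 d (T : measurableType d) (X : T -> 'rV[R]_n) :
  (forall i, measurable_fun setT (fun w => X w 0 i)) ->
  measurable_fun setT (fun w => enorm (X w) ^+ 2).
Proof. by move=> mX; under eq_fun do rewrite enorm_sqr; exact: measurable_dotv. Qed.

Lemma enormD_sqr_le (x y : 'rV[R]_n) :
  enorm (x + y) ^+ 2 <= 2 * enorm x ^+ 2 + 2 * enorm y ^+ 2.
Proof.
have := dotv_ge0 (x - y); rewrite !enorm_sqr dotvBB !dotvDl !dotvDr (dotvC y x).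
move: (dotv x x) (dotv x y) (dotv y y) => a b c; lra.
Qed.

Variables (d : measure_display) (T : measurableType d) (mu : probability T R).
Variable (X : T -> 'rV[R]_n).
Hypothesis iX : vintegrable mu X.
Variable m : 'rV[R]_n.
Hypothesis mE : m = vexpectation mu X.
Implicit Types u : 'rV[R]_n.

Let mX i : measurable_fun setT (fun w => X w 0 i).
Proof. by have /integrableP[/measurable_EFinP] := iX i. Qed.

Let icst (a : R) : mu.-integrable setT (EFin \o cst a).
Proof. exact: finite_measure_integrable_cst. Qed.

Let Ecst := integral_probability_cst mu.

Let iXm i : mu.-integrable setT (fun w => ((X w - m) 0 i)%:E).
Proof.
under eq_fun do rewrite !mxE EFinB.
by apply: integrableB => //; exact: icst.
Qed.

Let mXm i : measurable_fun setT (fun w => (X w - m) 0 i).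
Proof. by have /integrableP[/measurable_EFinP] := iXm i. Qed.

Lemma integrable_dotv_centered u :
  mu.-integrable setT (fun w => (dotv u (X w - m))%:E).
Proof.
rewrite /dotv; under eq_fun do rewrite -sumEFin.
apply: integrable_sum => // i _; under eq_fun do rewrite EFinM.
exact: integrableZl.
Qed.

Lemma integral_dotv_centered u : (\int[mu]_w (dotv u (X w - m))%:E = 0)%E.
Proof.
rewrite /dotv; under eq_integral do rewrite -sumEFin.
rewrite integral_sum//; last first.
  by move=> i; under eq_fun do rewrite EFinM; exact: integrableZl.
rewrite big1// => i _; under eq_integral do rewrite EFinM.
rewrite integralZl//; under eq_integral do rewrite !mxE EFinB.
rewrite integralB//; last exact: icst.
rewrite (_ : (\int[mu]_w (X w 0 i)%:E)%E = (m 0 i)%:E).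
  by rewrite Ecst subee// mule0.
rewrite mE mxE /Rintegral fineK//; exact: integrable_fin_num.
Qed.

Let mN u (c : R) : measurable_fun setT (fun w => (enorm (u + c *: (X w - m)) ^+ 2)%:E).
Proof.
apply/measurable_EFinP; apply: measurable_enorm2 => i.
under eq_fun do rewrite mxE; apply: measurable_funD => //.
by under eq_fun do rewrite mxE; apply: measurable_funM.
Qed.

Let N_ge0 u (c : R) w : (0 <= (enorm (u + c *: (X w - m)) ^+ 2)%:E)%E.
Proof. by rewrite lee_fin sqr_ge0. Qed.

(** Jensen from first moments: the square dominates [|u|^2 + 2 c <u, X - m>], whose last term is
    centered. An infinite integral is harmless. *)
Lemma integral_enorm2_ge u (c : R) :
  ((enorm u ^+ 2)%:E <= \int[mu]_w (enorm (u + c *: (X w - m)) ^+ 2)%:E)%E.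
Proof.
have [->|fin] := eqVneq (\int[mu]_w (enorm (u + c *: (X w - m)) ^+ 2)%:E)%E +oo%E.
  by rewrite leey.
have iN : mu.-integrable setT (fun w => (enorm (u + c *: (X w - m)) ^+ 2)%:E).
  apply/integrableP; split => //.
  by under eq_integral do rewrite gee0_abs//; rewrite ltey.
have iL : mu.-integrable setT (fun w => (enorm u ^+ 2)%:E + (2 * c)%:E * (dotv u (X w - m))%:E)%E.
  apply: integrableD => //; first exact: icst.
  exact/integrableZl/integrable_dotv_centered.
have : (\int[mu]_w ((enorm u ^+ 2)%:E + (2 * c)%:E * (dotv u (X w - m))%:E) = (enorm u ^+ 2)%:E)%E.
  rewrite integralD//; [|exact: icst|exact/integrableZl/integrable_dotv_centered].
  rewrite integralZl//; last exact: integrable_dotv_centered.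
  by rewrite integral_dotv_centered mule0 adde0 Ecst.
move=> <-; apply: le_integral => // w _.
rewrite -EFinM -EFinD lee_fin !enorm_sqr; move: (X w - m) => y.
have := dotv_ge0 (c *: y); rewrite !dotvE (dotvC y u).
by move: (dotv u u) (dotv u y) (dotv y y) => a1 a2 a3; lra.
Qed.

Lemma integral_enorm2 u (c : R) : (\int[mu]_w (enorm (X w - m) ^+ 2)%:E < +oo)%E ->
  (\int[mu]_w (enorm (u + c *: (X w - m)) ^+ 2)%:E =
   (enorm u ^+ 2)%:E + (c ^+ 2)%:E * \int[mu]_w (enorm (X w - m) ^+ 2)%:E)%E.
Proof.
move=> fin.
have iN : mu.-integrable setT (fun w => (enorm (X w - m) ^+ 2)%:E).
  apply/integrableP; split; first by apply/measurable_EFinP; exact: measurable_enorm2.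
  by under eq_integral do rewrite gee0_abs// ?lee_fin ?sqr_ge0//.
transitivity (\int[mu]_w (((enorm u ^+ 2)%:E + (2 * c)%:E * (dotv u (X w - m))%:E) +
    (c ^+ 2)%:E * (enorm (X w - m) ^+ 2)%:E))%E.
  apply: eq_integral => w _; rewrite -!EFinM -!EFinD; congr EFin.
  by rewrite !enorm_sqr; move: (X w - m) => y; rewrite !dotvE (dotvC y u); ring.
have iA : mu.-integrable setT (fun w => (2 * c)%:E * (dotv u (X w - m))%:E)%E.
  exact/integrableZl/integrable_dotv_centered.
rewrite integralD//; [|by apply: integrableD => //; exact: icst|exact: integrableZl].
rewrite integralD//; last exact: icst.
rewrite integralZl//; last exact: integrable_dotv_centered.
by rewrite integral_dotv_centered mule0 adde0 Ecst integralZl.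
Qed.

(** The second moment is [|u|^2] plus the variance, so it bounds both. The sign of [c] is left open
    because the two oracles enter with opposite signs. *)
Lemma integral_enorm2_le u (c s : R) : c ^+ 2 = 1 ->
  (\int[mu]_w (enorm (u + c *: (X w - m)) ^+ 2)%:E <= s%:E)%E ->
  enorm u ^+ 2 <= s /\ (\int[mu]_w (enorm (X w - m) ^+ 2)%:E <= s%:E)%E.
Proof.
move=> c1 le_s; split.
  by rewrite -lee_fin; exact: le_trans (integral_enorm2_ge u c) _.
(* [integral_enorm2] asks for a finite variance, first obtained from
   [|a + b|^2 <= 2 |a|^2 + 2 |b|^2]. *)
have fin : (\int[mu]_w (enorm (X w - m) ^+ 2)%:E < +oo)%E.
  apply: (@le_lt_trans _ _ (\int[mu]_w (2%:E * (enorm (u + c *: (X w - m)) ^+ 2)%:E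
      + (2 * enorm u ^+ 2)%:E))%E).
    apply: ge0_le_integral => //.
    - by move=> w _; rewrite lee_fin sqr_ge0.
    - by apply/measurable_EFinP; exact: measurable_enorm2.
    - apply: emeasurable_funD => //; exact: measurable_funeM.
    - move=> w _; rewrite -EFinM -EFinD lee_fin.
      have := enormD_sqr_le (u + c *: (X w - m)) (- u).
      rewrite addrAC subrr add0r enormN; congr (_ <= _).
      by rewrite enormZ exprMn real_normK ?num_real// c1 mul1r.
  rewrite ge0_integralD//; last 3 first.
  - by move=> w _; rewrite -EFinM lee_fin mulr_ge0 ?sqr_ge0.
  - exact: measurable_funeM.
  - by move=> w _; rewrite lee_fin mulr_ge0 ?sqr_ge0.
  rewrite ge0_integralZl_EFin// Ecst lte_add_pinfty ?ltry//.
  by apply: lte_mul_pinfty => //; apply: le_lt_trans le_s _; rewrite ltry.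
apply: le_trans le_s; rewrite integral_enorm2// c1 mul1e.
by rewrite leeDr// lee_fin sqr_ge0.
Qed.

End noise.

Section coordinates.
Variables (R : realType) (n : nat) (i : 'I_n).
Implicit Types x y : 'rV[R]_n.

Lemma coordD x y : (x + y) 0 i = x 0 i + y 0 i. Proof. by rewrite mxE. Qed.
Lemma coordN x : (- x) 0 i = - x 0 i. Proof. by rewrite mxE. Qed.
Lemma coordZ (a : R) x : (a *: x) 0 i = a * x 0 i. Proof. by rewrite mxE. Qed.

End coordinates.

(** Tonelli makes the integrals of the positive and of the negative part measurable in the
    parameter, whether finite or not; their difference and its [fine] remain measurable. *)
Lemma measurable_vexpectation (R : realType) n d0 d (T0 : measurableType d0)
    (T : measurableType d) (mu : probability T R) (Y : T0 -> T -> 'rV[R]_n) :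
  (forall i, measurable_fun setT (fun p : T0 * T => Y p.1 p.2 0 i)) ->
  forall i, measurable_fun setT (fun x => vexpectation mu (Y x) 0 i).
Proof.
move=> mY i; under eq_fun do rewrite mxE /Rintegral.
apply: (measurableT_comp (@fine_measurable R setT measurableT)).
have mYi : measurable_fun setT (fun p : T0 * T => (Y p.1 p.2 0 i)%:E).
  exact/measurable_EFinP.
have h := measurable_fun_fubini_tonelli_F (m2 := mu) _ (measurable_funepos mYi).
have h' := measurable_fun_fubini_tonelli_F (m2 := mu) _ (measurable_funeneg mYi).
rewrite (_ : (fun x => _) = (fun x => fubini_F mu (fun p => (Y p.1 p.2 0 i)%:E)^\+ x
   - fubini_F mu (fun p => (Y p.1 p.2 0 i)%:E)^\- x)%E).
  by apply: emeasurable_funB; [apply: h|apply: h'].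
apply/funext => x; rewrite integralE; congr (_ - _)%E; apply: eq_integral => y _; by
  rewrite ?funepos.unlock ?funeneg.unlock.
Qed.

Section noise_bound.
Variables (R : realType) (n : nat) (d1 d2 : measure_display).
Variables (T1 : measurableType d1) (T2 : measurableType d2).
Variables (mu1 : probability T1 R) (mu2 : probability T2 R).
Variables (X1 : T1 -> 'rV[R]_n) (X2 : T2 -> 'rV[R]_n).
Hypotheses (i1 : vintegrable mu1 X1) (i2 : vintegrable mu2 X2).
Variables (m1 m2 : 'rV[R]_n).
Hypotheses (m1E : m1 = vexpectation mu1 X1) (m2E : m2 = vexpectation mu2 X2).

Definition dnoise (p : T1 * T2) : 'rV[R]_n := (X1 p.1 - m1) - (X2 p.2 - m2).

Let mX1 i : measurable_fun setT (fun w => X1 w 0 i).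
Proof. by have /integrableP[/measurable_EFinP] := i1 i. Qed.

Let mX2 i : measurable_fun setT (fun w => X2 w 0 i).
Proof. by have /integrableP[/measurable_EFinP] := i2 i. Qed.

Let mD i : measurable_fun setT (fun p => dnoise p 0 i).
Proof.
under eq_fun do rewrite !(coordD, coordN); apply: measurable_funB; apply: measurable_funB => //.
  exact: (measurableT_comp (mX1 i) measurable_fst).
exact: (measurableT_comp (mX2 i) measurable_snd).
Qed.

Let mN u (c : R) : measurable_fun setT (fun p => (enorm (u - c *: dnoise p) ^+ 2)%:E).
Proof.
apply/measurable_EFinP; apply: measurable_enorm2 => i.
under eq_fun do rewrite coordD coordN coordZ.
by apply: measurable_funB => //; apply: measurable_funM.
Qed.

(** [integral_enorm2] used twice: integrating out the second sample and then the first removes both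
    cross terms and leaves [c ^+ 2 * s] for each. *)
Lemma integral_dnoise_le (s c : R) u : 0 <= s ->
  (\int[mu1]_w (enorm (X1 w - m1) ^+ 2)%:E <= s%:E)%E ->
  (\int[mu2]_w (enorm (X2 w - m2) ^+ 2)%:E <= s%:E)%E ->
  (\int[mu1 \x mu2]_p (enorm (u - c *: dnoise p) ^+ 2)%:E <=
    (enorm u ^+ 2 + 2 * c ^+ 2 * s)%:E)%E.
Proof.
move=> s0 h1 h2; rewrite fubini_tonelli1//; last by move=> p; rewrite lee_fin sqr_ge0.
have lt x : (x <= s%:E -> x < +oo)%E by move=> h; exact: le_lt_trans h (ltry _).
have mo : measurable_fun setT (fun a => (enorm (u + (- c) *: (X1 a - m1)) ^+ 2)%:E).
  apply/measurable_EFinP; apply: measurable_enorm2 => i.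
  under eq_fun do rewrite coordD coordZ coordD coordN.
  by apply: measurable_funD => //; apply: measurable_funM => //; exact: measurable_funB.
have inner a : (fubini_F mu2 (fun p => (enorm (u - c *: dnoise p) ^+ 2)%:E) a <=
   (enorm (u + (- c) *: (X1 a - m1)) ^+ 2)%:E + (c ^+ 2 * s)%:E)%E.
  have split b : u - c *: dnoise (a, b) = (u + (- c) *: (X1 a - m1)) + c *: (X2 b - m2).
    by apply/rowP => i; rewrite /dnoise !mxE /=; ring.
  rewrite /fubini_F; under eq_integral do rewrite split.
  rewrite (integral_enorm2 i2 m2E _ _ (lt _ h2)) leeD2l// (EFinM (c ^+ 2) s).
  by apply: lee_wpmul2l => //; rewrite lee_fin sqr_ge0.
have c20 : (0 <= (c ^+ 2 * s)%:E)%E by rewrite lee_fin mulr_ge0// sqr_ge0.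
apply: (@le_trans _ _ (\int[mu1]_a
   ((enorm (u + (- c) *: (X1 a - m1)) ^+ 2)%:E + (c ^+ 2 * s)%:E))%E).
  apply: ge0_le_integral => //.
  - by move=> a _; apply: integral_ge0 => b _; rewrite lee_fin sqr_ge0.
  - by apply: measurable_fun_fubini_tonelli_F => // p; rewrite lee_fin sqr_ge0.
  - exact: emeasurable_funD.
rewrite ge0_integralD//; last by move=> a _; rewrite lee_fin sqr_ge0.
rewrite (integral_enorm2 i1 m1E _ _ (lt _ h1)) sqrrN integral_probability_cst.
apply: (@le_trans _ _ ((enorm u ^+ 2)%:E + (c ^+ 2)%:E * s%:E + (c ^+ 2 * s)%:E)%E).
  by apply: leeD2r; apply: leeD2l; apply: lee_wpmul2l => //; rewrite lee_fin sqr_ge0.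
by rewrite -EFinM -!EFinD lee_fin; lra.
Qed.

(* Nothing is assumed on [w]: the variance is the least second moment. *)
Lemma variance_le (s : R) w :
  (\int[mu1 \x mu2]_p (enorm (X1 p.1 - X2 p.2 - w) ^+ 2)%:E <= s%:E)%E ->
  (\int[mu1]_w (enorm (X1 w - m1) ^+ 2)%:E <= s%:E)%E /\
  (\int[mu2]_w (enorm (X2 w - m2) ^+ 2)%:E <= s%:E)%E.
Proof.
move=> le_s; have [k kE] : exists k, k = m1 - m2 - w by exists (m1 - m2 - w).
have mP : measurable_fun setT (fun p : T1 * T2 => (enorm (X1 p.1 - X2 p.2 - w) ^+ 2)%:E).
  apply/measurable_EFinP; apply: measurable_enorm2 => i.
  under eq_fun do rewrite !(coordD, coordN); apply: measurable_funB => //; apply: measurable_funB.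
    exact: (measurableT_comp (mX1 i) measurable_fst).
  exact: (measurableT_comp (mX2 i) measurable_snd).
have P0 (p : T1 * T2) : (0 <= (enorm (X1 p.1 - X2 p.2 - w) ^+ 2)%:E)%E.
  by rewrite lee_fin sqr_ge0.
split.
- have : (\int[mu1]_a (enorm (k + 1 *: (X1 a - m1)) ^+ 2)%:E <= s%:E)%E.
    apply: le_trans le_s; rewrite fubini_tonelli1//; apply: ge0_le_integral => //.
    + by move=> a _; rewrite lee_fin sqr_ge0.
    + apply/measurable_EFinP; apply: measurable_enorm2 => i.
      under eq_fun do rewrite coordD scale1r coordD coordN.
      by apply: measurable_funD => //; exact: measurable_funB.
    + exact: measurable_fun_fubini_tonelli_F.
    (* At fixed [a], Jensen over the second sample replaces [X2 b] by its mean, which leaves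
       [k + (X1 a - m1)]. *)
    + move=> a _; apply: le_trans (integral_enorm2_ge i2 m2E _ (-1)) _.
      rewrite le_eqVlt; apply/orP; left; apply/eqP; apply: eq_integral => b _.
      congr ((enorm _ ^+ 2)%:E); rewrite kE ?scale1r ?scaleN1r /=.
      by apply/rowP => i; rewrite !mxE; ring.
  by move=> /(integral_enorm2_le i1 m1E (expr1n _ _)) [].
- have : (\int[mu2]_b (enorm (k + -1 *: (X2 b - m2)) ^+ 2)%:E <= s%:E)%E.
    apply: le_trans le_s; rewrite fubini_tonelli2//; apply: ge0_le_integral => //.
    + by move=> a _; rewrite lee_fin sqr_ge0.
    + apply/measurable_EFinP; apply: measurable_enorm2 => i.
      under eq_fun do rewrite coordD coordZ coordD coordN.
      by apply: measurable_funD => //; apply: measurable_funM => //; exact: measurable_funB.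
    + exact: measurable_fun_fubini_tonelli_G.
    + move=> b _; apply: le_trans (integral_enorm2_ge i1 m1E _ 1) _.
      rewrite le_eqVlt; apply/orP; left; apply/eqP; apply: eq_integral => a _.
      congr ((enorm _ ^+ 2)%:E); rewrite kE ?scale1r ?scaleN1r /=.
      by apply/rowP => i; rewrite !mxE; ring.
  by move=> /(integral_enorm2_le i2 m2E (sqrr_sign _ 1)) [].
Qed.

End noise_bound.

(** * Power weights *)

Section power_sums.
Variables (R : realType) (alpha : R) (alpha1 : 1 <= alpha).

Let w (k : nat) : R := k%:R `^ alpha.

Let a0 : 0 < alpha. Proof. exact: lt_le_trans alpha1. Qed.

Let w0 : w 0 = 0.
Proof. by rewrite /w powR0// gt_eqF. Qed.

Let w_ge0 k : 0 <= w k. Proof. exact: powR_ge0. Qed.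

Let w_mono i j : (i <= j)%N -> w i <= w j.
Proof. by move=> ij; rewrite ge0_ler_powR ?nnegrE ?ler_nat// ltW. Qed.

Let w_gt0 k : (0 < k)%N -> 0 < w k.
Proof. by move=> k0; rewrite powR_gt0 ?ltr0n. Qed.

(** The quotient is [i] to the power [alpha - 1], nondecreasing because [alpha >= 1]; errors [e / k]
    weighted by [w k] thus cost at most [w K / K * e] each. *)
Let w_div i j : (0 < i <= j)%N -> w i / i%:R <= w j / j%:R.
Proof.
move=> /andP[i0 ij].
have E k : (0 < k)%N -> w k / k%:R = k%:R `^ (alpha - 1).
  move=> k0; have kR : k%:R != 0 :> R by rewrite pnatr_eq0 -lt0n.
  suff -> : w k = k%:R `^ (alpha - 1) * k%:R by rewrite mulfK.
  by rewrite -[X in _ * X](powRr1 (ler0n R k)) -powRD ?subrK// kR implybT.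
rewrite !E ?(leq_trans i0)//.
by rewrite ge0_ler_powR ?nnegrE ?ler_nat// subr_ge0.
Qed.

(* Young's inequality [u * 1 <= u^p / p + 1 / q], multiplied by [p]. *)
Lemma bernoulli_powR (u p : R) : 1 < p -> 0 <= u -> 1 + p * (u - 1) <= u `^ p.
Proof.
move=> p1 u0; have p0 : 0 < p by lra.
pose q := (1 - p^-1)^-1.
have ip : p^-1 < 1 by rewrite invf_lt1.
have q0 : 0 < q by rewrite invr_gt0 subr_gt0.
have qE : q^-1 = 1 - p^-1 by rewrite invrK.
have pq : p^-1 + q^-1 = 1 by rewrite qE addrC subrK.
have := conjugate_powR u0 ler01 p0 q0 pq; rewrite powR1 mulr1 mul1r qE.
rewrite -(ler_pM2l p0) mulrDr mulrCA divff ?gt_eqF// mulr1.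
by rewrite mulrBr mulr1 divff ?gt_eqF//; lra.
Qed.

(** Discrete counterpart of integrating the power [alpha]. The induction step, divided by [m + 1] to
    the power [alpha + 1], is Bernoulli's inequality at [m / (m + 1)]. *)
Lemma power_sum_ge m : m%:R * w m <= (alpha + 1) * \sum_(i < m) w i.+1.
Proof.
elim: m => [|m IH]; first by rewrite big_ord0 mul0r mulr0.
rewrite big_ord_recr/= mulrDr; apply: le_trans (lerD IH (lexx _)).
set c : R := m.+1%:R; have c0 : 0 < c by rewrite ltr0n.
have mE : m%:R = c - 1 :> R by rewrite /c -natr1; ring.
have u0 : 0 <= m%:R / c by rewrite divr_ge0// ltW.
have p1 : 1 < alpha + 1 by rewrite ltrDr a0.
have h := bernoulli_powR p1 u0.
have wE : w m = (m%:R / c) `^ alpha * w m.+1.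
  by rewrite /w -powRM//; rewrite ?ltW// divfK// gt_eqF.
have uE : (m%:R / c) `^ (alpha + 1) = (m%:R / c) `^ alpha * (m%:R / c).
  have [->|m0] := eqVneq (m%:R / c) 0; first by rewrite powR0 ?mulr0// gt_eqF//; lra.
  by rewrite powRD ?m0 ?implybT// powRr1.
rewrite uE in h.
have -> : m%:R * w m = c * w m.+1 * ((m%:R / c) `^ alpha * (m%:R / c)).
  by rewrite wE; field; rewrite gt_eqF.
have : c * w m.+1 * (1 + (alpha + 1) * (m%:R / c - 1)) <=
   c * w m.+1 * ((m%:R / c) `^ alpha * (m%:R / c)).
  by rewrite ler_pM2l// mulr_gt0// w_gt0.
have -> : c * w m.+1 * (1 + (alpha + 1) * (m%:R / c - 1)) =
   c * w m.+1 - (alpha + 1) * w m.+1.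
  by rewrite mE; field; rewrite gt_eqF.
by rewrite lerBlDr.
Qed.

Variables (K : nat) (K0 : (0 < K)%N) (a q : nat -> R) (Delta e c : R).
Hypotheses (e0 : 0 <= e) (aK : 0 <= a K.+1) (c0 : 0 < c) (Delta0 : 0 <= Delta)
  (a_le : forall k, (0 < k <= K)%N -> a k <= Delta)
  (rec : forall k, (0 < k <= K)%N -> c * q k + a k.+1 <= a k + e / k%:R).

(** Summation by parts: since [w] is nondecreasing, each [a] may be replaced by [Delta]. The term in
    [a m.+1] makes the induction close. *)
Let abel m : (m <= K)%N ->
  \sum_(i < m) w i.+1 * (a i.+1 - a i.+2) <= w m * (Delta - a m.+1).
Proof.
elim: m => [|m IH] mK; first by rewrite big_ord0 w0 mul0r.
rewrite big_ord_recr/=.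
have h1 := IH (ltnW mK).
have h2 : (w m.+1 - w m) * a m.+1 <= (w m.+1 - w m) * Delta.
  by apply: ler_wpM2l; rewrite ?subr_ge0 ?w_mono// a_le.
lra.
Qed.

(** The recursion summed against [w] gives [w K * (Delta + e)]; dividing by the total weight,
    [power_sum_ge] leaves the factor [(alpha + 1) / K]. *)
Lemma weighted_average_le :
  \sum_(i < K) w i.+1 / (\sum_(1 <= j < K.+1) w j) * q i.+1 <=
  (alpha + 1) / (c * K%:R) * (Delta + e).
Proof.
have SE : \sum_(1 <= j < K.+1) w j = \sum_(i < K) w i.+1.
  by rewrite big_add1 big_mkord.
rewrite SE; set s := \sum_(i < K) w i.+1.
have KR : 0 < K%:R :> R by rewrite ltr0n.
have wK := w_gt0 K0.
have s0 : 0 < s.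
  have := power_sum_ge K; have : 0 < K%:R * w K by rewrite mulr_gt0.
  move=> h1 h2; have := lt_le_trans h1 h2.
  by rewrite pmulr_rgt0// addr_gt0.
have -> : \sum_(i < K) w i.+1 / s * q i.+1 = s^-1 * \sum_(i < K) w i.+1 * q i.+1.
  by rewrite mulr_sumr; apply: eq_bigr => i _; rewrite mulrA (mulrC s^-1).
have h : c * \sum_(i < K) w i.+1 * q i.+1 <= w K * (Delta + e).
  have h1 : c * \sum_(i < K) w i.+1 * q i.+1 <=
      \sum_(i < K) w i.+1 * (a i.+1 - a i.+2) + \sum_(i < K) w i.+1 / i.+1%:R * e.
    rewrite mulr_sumr -big_split/=; apply: ler_sum => i _.
    have h2 := rec (ltn_ord i : (0 < i.+1 <= K)%N).
    have := ler_wpM2l (w_ge0 i.+1) h2.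
    by move: (i.+1%:R^-1) (w i.+1) => v u; lra.
  have h2 : \sum_(i < K) w i.+1 / i.+1%:R * e <= w K * e.
    apply: (@le_trans _ _ (\sum_(i < K) w K / K%:R * e)).
      by apply: ler_sum => i _; apply: ler_wpM2r => //; apply: w_div; rewrite /= ltn_ord.
    by rewrite sumr_const card_ord -[leLHS]mulr_natl mulrA (mulrCA K%:R) divff ?mulr1 ?gt_eqF.
  have h3 := abel (leqnn K).
  have h4 : 0 <= w K * a K.+1 by rewrite mulr_ge0.
  lra.
have p := power_sum_ge K; rewrite -/s in p.
have De : 0 <= Delta + e by rewrite addr_ge0.
rewrite mulrC ler_pdivrMr//.
rewrite -(ler_pM2l c0); apply: le_trans h _.
have -> : c * ((alpha + 1) / (c * K%:R) * (Delta + e) * s) =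
   ((alpha + 1) * s) / K%:R * (Delta + e) by field; rewrite !gt_eqF.
by apply: ler_wpM2r => //; rewrite ler_pdivlMr// mulrC.
Qed.

End power_sums.

(** * The stagewise process *)

Section data_measurability.
Variables (R : realType) (n : nat) (d1 d2 : measure_display).
Variables (Xi : measurableType d1) (Pxi : probability Xi R).
Variables (Vs : measurableType d2) (Pvs : probability Vs R).
Variables (D : dc_problem R n Xi Vs) (HD : dc_assumptions Pxi Pvs D).
Variables (gamma : R) (gamma0 : 0 < gamma).

Definition mean_sg x : 'rV[R]_n := vexpectation Pxi (dc_sg D x).

Lemma dc_gcvx : sconvex setT 0 (dc_g D).
Proof. exact: convex_function_sconvex (dc_g_convex HD). Qed.

Let rNy : forall x, (-oo < dc_r D x)%E := (dc_r_proper HD).1.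

Lemma mean_sg_subgradient x y : dc_g D x + dotv (mean_sg x) (y - x) <= dc_g D y.
Proof. by have := dc_sg_unbiased HD x y; rewrite -EFinD lee_fin. Qed.

Definition gap x y : R := surrogate_value D gamma x y -
  surrogate_value D gamma x (prox_point D gamma x).

Lemma gap_strong x y : edom (dc_r D) y ->
  gamma / 2 * enorm (y - prox_point D gamma x) ^+ 2 <= gap x y.
Proof.
move=> ry; rewrite /gap.
have [_] := prox_point_strong gamma0 (dc_g_lsc HD) dc_gcvx (dc_r_proper HD)
  (dc_r_lsc HD) (dc_r_convex HD) x ry.
lra.
Qed.

Lemma gap_ge0 x y : edom (dc_r D) y -> 0 <= gap x y.
Proof.
move=> ry; apply: le_trans (gap_strong x ry).
by rewrite mulr_ge0 ?sqr_ge0// divr_ge0// ltW.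
Qed.

Definition objective_value x : R := dc_g D x + fine (dc_r D x) - dc_h D x.

Lemma objective_fin x : edom (dc_r D) x -> dc_objective D x = (objective_value x)%:E.
Proof. by move=> rx; rewrite /dc_objective (edomE rNy rx). Qed.

Lemma objective_le_surrogate z x : objective_value x <= surrogate_value D gamma z x.
Proof.
have := dc_dh_subgradient HD z x; rewrite -EFinD lee_fin => h.
have : 0 <= gamma / 2 * enorm (x - z) ^+ 2.
  by rewrite mulr_ge0 ?sqr_ge0// divr_ge0// ltW.
rewrite /objective_value /surrogate_value /surrogate_smooth; lra.
Qed.

Lemma surrogate_self x : surrogate_value D gamma x x = objective_value x.
Proof.
rewrite /surrogate_value /surrogate_smooth /objective_value subrr enorm0 [dotv _ 0]dotvC dotv0l.
by rewrite expr0n mulr0 !addr0; ring.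
Qed.

Lemma objective_descent x y : edom (dc_r D) x ->
  objective_value y + gamma / 2 * enorm (x - prox_point D gamma x) ^+ 2 <=
  gap x y + objective_value x.
Proof.
move=> rx; have := gap_strong x rx; rewrite /gap surrogate_self.
have := objective_le_surrogate x y; lra.
Qed.

(** Serves to deduce finiteness of the expected squared distance from that of the expected
    excess. *)
Lemma prox_point_objective (m : R) x :
  (forall y, edom (dc_r D) y -> m <= objective_value y) -> edom (dc_r D) x ->
  gamma / 2 * enorm (x - prox_point D gamma x) ^+ 2 <= objective_value x - m.
Proof.
move=> mle rx; have rp := prox_point_dom gamma0 (dc_g_lsc HD) dc_gcvx (dc_r_proper HD)
  (dc_r_lsc HD) (dc_r_convex HD) x.
have := gap_strong x rx; rewrite /gap surrogate_self.
have := objective_le_surrogate x (prox_point D gamma x); have := mle _ rp; lra.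
Qed.

Definition prox_center x : 'rV[R]_n := x + gamma^-1 *: dc_dh D x.

Lemma surrogate_prox z : is_argmin setT (regularize (dc_r D) (surrogate_smooth D gamma z))
  = is_argmin setT (regularize (dc_r D) (prox_smooth (dc_g D) gamma (prox_center z))).
Proof.
apply: (@argmin_addr _ _ _ _ _ _ (- dc_h D z - (2 * gamma)^-1 * enorm (dc_dh D z) ^+ 2)) => x.
rewrite /surrogate_smooth /prox_smooth /prox_center.
rewrite (_ : x - (z + gamma^-1 *: dc_dh D z) = x - z - gamma^-1 *: dc_dh D z); last first.
  by rewrite opprD addrA.
move: (x - z) => u; rewrite !enorm_sqr dotvBB !dotvE (dotvC (dc_dh D z) u).
by field; rewrite lt0r_neq0.
Qed.

Section composition.
Variables (d : measure_display) (T : measurableType d).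
Implicit Types (X Y : T -> borel_rV R n).

Lemma measurable_coord_comp X i : measurable_fun setT X ->
  measurable_fun setT (fun w => X w 0 i : R).
Proof. by move=> mX; exact: (measurableT_comp (measurable_coord i) mX). Qed.

Lemma measurable_sg X (A : T -> Xi) i : measurable_fun setT X -> measurable_fun setT A ->
  measurable_fun setT (fun w => dc_sg D (X w) (A w) 0 i).
Proof.
move=> mX mA.
exact: (measurableT_comp (dc_sg_measurable HD i) (measurable_fun_pair mX mA)).
Qed.

Lemma measurable_sh X (A : T -> Vs) i : measurable_fun setT X -> measurable_fun setT A ->
  measurable_fun setT (fun w => dc_sh D (X w) (A w) 0 i).
Proof.
move=> mX mA.
exact: (measurableT_comp (dc_sh_measurable HD i) (measurable_fun_pair mX mA)).
Qed.

Lemma measurable_mean_sg X i : measurable_fun setT X ->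
  measurable_fun setT (fun w => mean_sg (X w) 0 i).
Proof.
move=> mX; exact: (measurableT_comp (@measurable_vexpectation _ _ _ _ (borel_rV R n) _ Pxi
  (dc_sg D) (dc_sg_measurable HD) i) mX).
Qed.

(** Measurability of the selection comes from the stochastic subgradients, of which it is the
    mean. *)
Lemma measurable_dh X i : measurable_fun setT X ->
  measurable_fun setT (fun w => dc_dh D (X w) 0 i).
Proof.
move=> mX; under eq_fun do rewrite -(dc_sh_unbiased HD).
exact: (measurableT_comp (@measurable_vexpectation _ _ _ _ (borel_rV R n) _ Pvs
  (dc_sh D) (dc_sh_measurable HD) i) mX).
Qed.

(** [prox_point] may jump together with the selection [dc_dh], but it is a nonexpansive function of
    [prox_center x], which is measurable in [x]. *)
Lemma measurable_prox_point X : measurable_fun setT X ->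
  measurable_fun setT (fun w => prox_point D gamma (X w) : borel_rV R n).
Proof.
move=> mX; pose p c := argmin setT (regularize (dc_r D) (prox_smooth (dc_g D) gamma c)).
have argp c : is_argmin setT (regularize (dc_r D) (prox_smooth (dc_g D) gamma c)) (p c).
  apply: getPex; apply: (@regularize_argmin _ _ _ _ _ _ _ gamma) => //.
  - exact: dc_r_lsc HD.
  - exact: dc_r_convex HD.
  - exact: (dc_r_proper HD).2.
  - exact: sconvex_prox dc_gcvx _ _ _.
  - apply: lscD_continuous; first exact: dc_g_lsc HD.
    exact: continuous_sqr_enormB.
have -> : (fun w => prox_point D gamma (X w)) = p \o (fun w => prox_center (X w)).
  apply/funext => w; rewrite /prox_point /p /argmin dc_surrogateE ?surrogate_prox//.
  exact: dc_r_proper HD.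
apply: (continuous_within_measurable (A := setT)) => //.
  apply: borel_rV_measurable => i; rewrite /prox_center.
  under eq_fun do rewrite coordD coordZ.
  apply: measurable_funD; first exact: measurable_coord_comp.
  by apply: measurable_funM => //; exact: measurable_dh.
move=> x e _ e0; exists e => // y _; apply: le_trans.
apply: (prox_nonexpansive rNy (dc_r_convex HD) dc_gcvx gamma0 _ _ (argp x) (argp y)) => //.
by have [x0 rx0] := (dc_r_proper HD).2; exists x0.
Qed.

Lemma measurable_enorm2B X Y : measurable_fun setT X -> measurable_fun setT Y ->
  measurable_fun setT (fun w => enorm (X w - Y w : 'rV[R]_n) ^+ 2).
Proof.
move=> mX mY; apply: measurable_enorm2 => i; under eq_fun do rewrite coordD coordN.
by apply: measurable_funB; exact: measurable_coord_comp.
Qed.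

Lemma measurable_surrogate X Y : measurable_fun setT X -> measurable_fun setT Y ->
  measurable_fun setT (fun w => surrogate_value D gamma (X w) (Y w)).
Proof.
move=> mX mY; rewrite /surrogate_value /surrogate_smooth.
have lm (f : 'rV[R]_n -> \bar R) (Z : T -> borel_rV R n) : lower_semicontinuous f ->
  measurable_fun setT Z ->
    measurable_fun setT (fun w => f (Z w)).
  move=> lf mZ; exact: (measurableT_comp (lower_semicontinuous_borel lf) mZ).
apply: measurable_funD.
  apply: (measurableT_comp (@fine_measurable R setT measurableT)).
  exact: (lm _ _ (dc_r_lsc HD)).
apply: measurable_funD.
  apply/measurable_EFinP; exact: (lm _ _ (dc_g_lsc HD)).
apply: measurable_funD; last first.
  by apply: measurable_funM => //; exact: measurable_enorm2B.
apply: measurable_funN; apply: measurable_funD.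
  apply/measurable_EFinP; exact: (lm _ _ (dc_h_lsc HD)).
apply: measurable_dotv => i; first exact: measurable_dh.
under eq_fun do rewrite coordD coordN.
by apply: measurable_funB; exact: measurable_coord_comp.
Qed.

Lemma measurable_gap X Y : measurable_fun setT X -> measurable_fun setT Y ->
  measurable_fun setT (fun w => gap (X w) (Y w)).
Proof.
move=> mX mY; apply: measurable_funB; apply: measurable_surrogate => //.
exact: measurable_prox_point.
Qed.

Lemma measurable_objective X : measurable_fun setT X ->
  measurable_fun setT (fun w => objective_value (X w)).
Proof.
by move=> mX; under eq_fun do rewrite -surrogate_self; exact: measurable_surrogate.
Qed.

End composition.

(** What the process uses of the feasible set of a stage started at [x]; both options are instances.
    [region_stable] is continuity of the minimizer in the start and the proximal center jointly, and
    serves measurability. *)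
Record solver_region (C : 'rV[R]_n -> set 'rV[R]_n) : Prop := SolverRegion {
  region_self : forall x, edom (dc_r D) x -> C x x;
  region_convex : forall x, cvx_set (C x);
  region_argmin : forall (eta : R) x y v, 0 < eta -> edom (dc_r D) x ->
    is_argmin (C x) (regularize (dc_r D) (spg_smooth gamma eta x y v))
      (spg_argmin D gamma (C x) eta x y v);
  region_stable : forall (b e : R) y c, 0 < b -> edom (dc_r D) y -> 0 < e ->
    exists2 d : R, 0 < d & forall y' c' p p', edom (dc_r D) y' ->
      enorm (y - y') <= d -> enorm (c - c') <= d ->
      is_argmin (C y) (regularize (dc_r D) (prox_smooth (fun=> 0) b c)) p ->
      is_argmin (C y') (regularize (dc_r D) (prox_smooth (fun=> 0) b c')) p' ->
      enorm (p - p') <= e }.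

Section solver.
Variables (C : 'rV[R]_n -> set 'rV[R]_n) (HC : solver_region C).
Local Notation r := (dc_r D).

(** The three terms form one quadratic of curvature [gamma + eta^-1] around the weighted mean of [x]
    and [y], shifted by [v]. *)
Lemma spg_prox eta x y v A : 0 < eta ->
  is_argmin A (regularize r (spg_smooth gamma eta x y v)) =
  is_argmin A (regularize r (prox_smooth (fun=> 0) (gamma + eta^-1)
    ((gamma + eta^-1)^-1 *: (gamma *: x + eta^-1 *: y - v)))).
Proof.
move=> eta0; have b0 : 0 < gamma + eta^-1 by rewrite addr_gt0 ?invr_gt0.
set b := gamma + eta^-1 in b0 *; set c := _ *: _.
apply: (@argmin_addr _ _ _ _ _ _
  (gamma / 2 * dotv x x + eta^-1 / 2 * dotv y y - b / 2 * dotv c c)) => z.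
rewrite /spg_smooth /prox_smooth !enorm_sqr !dotvBB.
have -> : v = gamma *: x + eta^-1 *: y - b *: c.
  by rewrite /c scalerA divff ?scale1r ?lt0r_neq0// opprB [RHS]addrC subrK.
have -> : (2 * eta)^-1 = eta^-1 / 2 by rewrite invfM mulrC.
rewrite !dotvE /b.
move: (dotv z z) (dotv z x) (dotv z y) (dotv z c) => a1 a2 a3 a4; lra.
Qed.

(* The pair (center of the region, proximal center) is packed into one vector of
   ['rV_(n + n)], on which the minimizer is continuous. *)
Lemma measurable_spg_argmin d (T : measurableType d) eta (X Y V : T -> borel_rV R n) :
  0 < eta -> measurable_fun setT X -> measurable_fun setT Y -> measurable_fun setT V ->
  (forall w, edom r (X w)) ->
  measurable_fun setT
    (fun w => spg_argmin D gamma (C (X w)) eta (X w) (Y w) (V w) : borel_rV R n).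
Proof.
move=> eta0 mX mY mV rX; set b := gamma + eta^-1.
have b0 : 0 < b by rewrite addr_gt0 ?invr_gt0.
pose c w : 'rV[R]_n := b^-1 *: (gamma *: X w + eta^-1 *: Y w - V w).
pose p (z : 'rV[R]_(n + n)) : 'rV[R]_n := argmin (C (lsubmx z))
  (regularize r (prox_smooth (fun=> 0) b (rsubmx z))).
have -> : (fun w => spg_argmin D gamma (C (X w)) eta (X w) (Y w) (V w)) =
    p \o (fun w => row_mx (X w) (c w)).
  apply/funext => w; rewrite /spg_argmin /p /argmin /= row_mxKl row_mxKr.
  by rewrite spg_prox.
apply: (continuous_within_measurable (A := [set z | edom r (lsubmx z)])).
- apply: borel_rV_measurable => i; case: (splitP i) => j ij.
    have -> : i = lshift n j by apply/val_inj.
    under eq_fun do rewrite row_mxEl.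
    exact: measurable_coord_comp.
  have -> : i = rshift n j by apply/val_inj.
  under eq_fun do rewrite row_mxEr coordZ coordD coordN coordD !coordZ.
  apply: measurable_funM => //; apply: measurable_funB; last exact: measurable_coord_comp.
  by apply: measurable_funD; apply: measurable_funM => //; exact: measurable_coord_comp.
- by move=> w; rewrite /= row_mxKl.
move=> z e rz e0.
have [d0 d00 H] := region_stable HC (rsubmx z) b0 rz e0.
have argp z' : edom r (lsubmx z') -> is_argmin (C (lsubmx z'))
    (regularize r (prox_smooth (fun=> 0) b (rsubmx z'))) (p z').
  move=> rz'; apply: getPex.
  (* With [y = 0] and this [v] the center in [spg_prox] is [rsubmx z'], so every center arises from
     a step and the minimizer exists. *)
  have := region_argmin HC 0 (gamma *: lsubmx z' - b *: rsubmx z') eta0 rz'.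
  rewrite spg_prox// scaler0 addr0 opprB [_ + (_ - _)]addrC subrK scalerA mulVf ?lt0r_neq0//.
  by rewrite scale1r; exists (spg_argmin D gamma (C (lsubmx z')) eta (lsubmx z') 0
    (gamma *: lsubmx z' - b *: rsubmx z')).
exists d0 => // z' rz' zz'.
have E : dotv (z - z') (z - z') = dotv (lsubmx z - lsubmx z') (lsubmx z - lsubmx z') +
    dotv (rsubmx z - rsubmx z') (rsubmx z - rsubmx z').
  rewrite /dotv big_split_ord; congr (_ + _); apply: eq_bigr => i _.
    by rewrite !mxE.
  by rewrite !mxE.
move: zz'; rewrite enorm_le ?(ltW d00)// E => zz'.
apply: (H _ _ _ _ rz') (argp _ rz) (argp _ rz').
- rewrite enorm_le ?(ltW d00)//; apply: le_trans zz'.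
  by rewrite lerDl dotv_ge0.
- rewrite enorm_le ?(ltW d00)//; apply: le_trans zz'.
  by rewrite lerDr dotv_ge0.
Qed.

End solver.

End data_measurability.

Section process.
Variables (R : realType) (n : nat) (d d1 d2 : measure_display).
Variables (Om : measurableType d) (P : probability Om R).
Variables (Xi : measurableType d1) (Pxi : probability Xi R).
Variables (Vs : measurableType d2) (Pvs : probability Vs R).
Variables (D : dc_problem R n Xi Vs) (HD : dc_assumptions Pxi Pvs D).
Variables (xi : nat -> nat -> {RV P >-> Xi}) (vs : nat -> nat -> {RV P >-> Vs}).
Variable tau : {RV P >-> nat}.
Hypotheses (Hxi : forall k t, has_law (xi k t) Pxi)
  (Hvs : forall k t, has_law (vs k t) Pvs).
Local Notation S := (draws_sigma (fun k t => xi k t : Om -> Xi)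
                  (fun k t => vs k t : Om -> Vs) tau).
Hypothesis Hindep : mutually_independent P S.
Variables (gamma : R) (gamma0 : 0 < gamma).
Local Notation r := (dc_r D).
Variables (C : 'rV[R]_n -> set 'rV[R]_n) (HC : solver_region D gamma C).
Variables (eta : nat -> R) (eta0 : forall t, (0 < t)%N -> 0 < eta t).
Variables (T : nat -> nat) (T0 : forall k, (0 < k)%N -> (0 < T k)%N).
Variable dl : nat.
Variables (x1 : 'rV[R]_n) (rx1 : edom r x1).

Let rNy : forall x, (-oo < r x)%E := (dc_r_proper HD).1.

(* [dl = 1] averages as in Option 1 and [dl = 0] as in Option 2. *)
Definition spg_average y1 Tk (a : nat -> Xi) (b : nat -> Vs) : 'rV[R]_n :=
  weighted_average dl.+1 (dl + Tk).+1 (spg_iterate D gamma eta (C y1) y1 a b).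

Definition stage k w : 'rV[R]_n :=
  stagewise spg_average x1 T (fun j t => xi j t w) (fun j t => vs j t w) k.

Definition inner k t w : 'rV[R]_n :=
  spg_iterate D gamma eta (C (stage k w)) (stage k w)
    (fun s => xi k s w) (fun s => vs k s w) t.

Definition direction k t w : 'rV[R]_n :=
  dc_sg D (inner k t w) (xi k t w) - dc_sh D (stage k w) (vs k t w).

Lemma innerS k t w : (0 < t)%N -> inner k t.+1 w =
  spg_argmin D gamma (C (stage k w)) (eta t) (stage k w) (inner k t w) (direction k t w).
Proof.
case: t => // t _; rewrite /inner /spg_argmin /=.
by rewrite spg_objectiveE//; exact: dc_r_proper HD.
Qed.

Lemma stageS k w : (0 < k)%N ->
  stage k.+1 w = weighted_average dl.+1 (dl + T k).+1 (fun t => inner k t w).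
Proof. by case: k. Qed.

Lemma weights_gt0 k : (0 < k)%N ->
  0 < \sum_(dl.+1 <= t < (dl + T k).+1) (t%:R : R).
Proof.
move=> k0; rewrite big_ltn; last by rewrite ltnS -[X in (X < _)%N]addn0 ltn_add2l T0.
by rewrite ltr_pwDl// sumr_ge0.
Qed.

Lemma inner_dom k t w : edom r (stage k w) ->
  edom r (inner k t w) /\ C (stage k w) (inner k t w).
Proof.
(* Iterates [0] (placeholder) and [1] are both the starting point. *)
move=> rk; elim: t => [|[|t] [rt Ct]]; [by split=> //; exact: region_self HC _ rk..|].
rewrite innerS//.
have arg := region_argmin HC (inner k t.+1 w) (direction k t.+1 w) (eta0 (ltn0Sn t)) rk.
split; last by case: arg.
have [] // := regularize_argmin_strong rNy (dc_r_convex HD) (region_convex HC (x := stage k w))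
  (@sconvex_spg _ _ gamma (edom r) _ (stage k w) (inner k t.+1 w) (direction k t.+1 w)
    (eta0 (ltn0Sn t)))
  arg Ct rt.
Qed.

Lemma stage_dom k w : edom r (stage k w).
Proof.
elim: k => [|[|k] IH]; [exact: rx1..|].
rewrite stageS//.
have [] // := sconvex_jensen (w := fun t => t%:R) (y := fun t => inner k.+1 t w)
  (edom_cvx rNy (dc_r_convex HD)) (sconvex_fine rNy (dc_r_convex HD)) _ _ (weights_gt0 (ltn0Sn k)).
by move=> t; have [] := inner_dom t IH.
Qed.

(** Draws before step [t] of stage [k] in lexicographic order. The index of [tau] never belongs to
    it, whence the independence of [tau] from each stage point. *)
Definition past k t : set ((nat * nat + nat * nat) + unit) :=
  [set i | match i with
           | inl (inl js) | inl (inr js) => (js.1 < k)%N || ((js.1 == k) && (js.2 < t)%N)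
           | inr _ => false
           end].

Lemma pastS k t t' : (t <= t')%N -> past k t `<=` past k t'.
Proof.
move=> tt' [[[j s]|[j s]]|] //= /orP[->//|/andP[-> st]];
  by rewrite (leq_trans st) ?orbT.
Qed.

Lemma past_stage k t : past k t `<=` past k.+1 1.
Proof.
move=> [[[j s]|[j s]]|] //= /orP[jk|/andP[/eqP -> _]];
  by rewrite ?ltnSn// ltnS (ltnW jk).
Qed.

Lemma draws_sigmaT i : S i setT.
Proof.
by case: i => [[[k t]|[k t]]|u]; exists setT => //; rewrite preimage_setT setTI.
Qed.

Lemma draws_sigmaI i : setI_closed (S i).
Proof.
by case: i => [[[k t]|[k t]]|u] _ _ [A mA <-] [B mB <-]; exists (A `&` B) => //;
  rewrite ?setTI ?preimage_setI//; apply: measurableI.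
Qed.

Lemma draws_sigma_measurable i : S i `<=` measurable.
Proof.
by case: i => [[[k t]|[k t]]|u] _ [A mA <-]; exact: measurable_funPT.
Qed.

Lemma adapted_xi k t J : J (inl (inl (k, t))) -> adapted S J (xi k t : Om -> Xi).
Proof.
move=> Ji B mB; apply: sub_sigma_algebra; exists (inl (inl (k, t))) => //.
by exists B => //; rewrite setTI.
Qed.

Lemma adapted_vs k t J : J (inl (inr (k, t))) -> adapted S J (vs k t : Om -> Vs).
Proof.
move=> Ji B mB; apply: sub_sigma_algebra; exists (inl (inr (k, t))) => //.
by exists B => //; rewrite setTI.
Qed.

Lemma adapted_innerS k t : (0 < t)%N ->
  adapted S (past k t) (stage k : Om -> borel_rV R n) ->
  adapted S (past k t) (inner k t : Om -> borel_rV R n) ->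
  adapted S (past k t.+1) (inner k t.+1 : Om -> borel_rV R n).
Proof.
move=> t0 /(adaptedS (@pastS k _ _ (leqnSn t)))/adaptedP mx
  /(adaptedS (@pastS k _ _ (leqnSn t)))/adaptedP my.
have p1 : past k t.+1 (inl (inl (k, t))) by rewrite /past/= eqxx ltnSn orbT.
have p2 : past k t.+1 (inl (inr (k, t))) by rewrite /past/= eqxx ltnSn orbT.
have /adaptedP mxi := adapted_xi p1; have /adaptedP mvs := adapted_vs p2.
apply/adaptedP; rewrite (_ : inner k t.+1 = fun w =>
    spg_argmin D gamma (C (stage k w)) (eta t) (stage k w) (inner k t w) (direction k t w)).
  2: by apply/funext => w; rewrite innerS.
have mv : measurable_fun setT (direction k t :
    g_sigma_algebraType (joint_system S (past k t.+1)) -> borel_rV R n).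
  apply: borel_rV_measurable => i; rewrite (_ : (fun w => _) =
      fun w => dc_sg D (inner k t w) (xi k t w) 0 i - dc_sh D (stage k w) (vs k t w) 0 i).
    2: by apply/funext => w; rewrite /direction coordD coordN.
  by apply: measurable_funB; [exact: (measurable_sg HD)|exact: (measurable_sh HD)].
exact: (measurable_spg_argmin gamma0 HC (eta0 t0) mx my mv (stage_dom k)).
Qed.

Lemma adapted_inner k t : (0 < t)%N ->
  adapted S (past k 1) (stage k : Om -> borel_rV R n) ->
  adapted S (past k t) (inner k t : Om -> borel_rV R n).
Proof.
move=> + mx; case: t => // t _; elim: t => [//|t IH].
by apply: adapted_innerS => //; apply: adaptedS mx; exact: pastS.
Qed.

Lemma adapted_stage k : (0 < k)%N ->
  adapted S (past k 1) (stage k : Om -> borel_rV R n).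
Proof.
case: k => // k _; elim: k => [|k IH].
  by apply/adaptedP; rewrite (_ : stage 1 = cst x1)//; exact: measurable_cst.
apply/adaptedP; rewrite (_ : stage k.+2 = fun w =>
    weighted_average dl.+1 (dl + T k.+1).+1 (fun t => inner k.+1 t w)).
  2: by apply/funext => w; rewrite stageS.
(* The membership test provides [0 < t] for the terms of the average and makes the others
   constant. *)
apply: borel_rV_measurable => i; rewrite (_ : (fun w => _) = fun w =>
    (\sum_(dl.+1 <= t < (dl + T k.+1).+1) t%:R)^-1 *
    \sum_(t <- index_iota dl.+1 (dl + T k.+1).+1)
      (if t \in index_iota dl.+1 (dl + T k.+1).+1 then t%:R * inner k.+1 t w 0 i else 0)).
  2: {
    apply/funext => w; rewrite /weighted_average coordZ summxE; congr (_ * _).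
    rewrite big_seq_cond [RHS]big_seq_cond; apply: eq_bigr => t /andP[-> _].
    by rewrite coordZ. }
apply: measurable_funM => //.
apply: measurable_sum => t; case: (boolP (t \in index_iota _ _)) => [|_] //.
rewrite mem_index_iota => /andP[t0 _].
apply: measurable_funM => //; apply: measurable_coord_comp; apply/adaptedP.
apply: (adaptedS (@past_stage k.+1 t)); apply: adapted_inner => //.
by case: (t) t0.
Qed.

Lemma adapted_state k t : (0 < k)%N -> (0 < t)%N ->
  adapted S (past k t) (stage k : Om -> borel_rV R n) /\
  adapted S (past k t) (inner k t : Om -> borel_rV R n).
Proof.
move=> k0 t0; split; last by apply: adapted_inner => //; exact: adapted_stage.
by apply: (adaptedS (@pastS k _ _ t0)); exact: adapted_stage.
Qed.

Lemma measurable_stage k : (0 < k)%N -> measurable_fun setT (stage k : Om -> borel_rV R n).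
Proof.
by move=> k0; apply: (adapted_measurable draws_sigma_measurable (adapted_stage k0)).
Qed.

Lemma measurable_inner k t : (0 < k)%N -> (0 < t)%N ->
  measurable_fun setT (inner k t : Om -> borel_rV R n).
Proof.
move=> k0 t0; apply: (adapted_measurable draws_sigma_measurable).
exact: (adapted_state k0 t0).2.
Qed.

(** The fresh samples are integrated out one at a time: [vs k t] against the past enlarged by
    [xi k t], then [xi k t] against the past. What remains depends on the state only and is bounded
    pointwise. *)
Lemma step_expectation k t (psi : ((borel_rV R n * borel_rV R n) * Xi) * Vs -> R)
    (B : 'rV[R]_n -> 'rV[R]_n -> R) : (0 < k)%N -> (0 < t)%N ->
  measurable_fun setT psi -> (forall z, 0 <= psi z) ->
  measurable_fun setT (fun w => B (stage k w) (inner k t w)) ->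
  (forall x y, edom r x -> edom r y -> C x y ->
     (\int[Pxi \x Pvs]_p (psi (((x, y), p.1), p.2))%:E <= (B x y)%:E)%E) ->
  (\int[P]_w (psi (((stage k w, inner k t w), xi k t w), vs k t w))%:E <=
   \int[P]_w (B (stage k w) (inner k t w))%:E)%E.
Proof.
move=> k0 t0 mpsi psi0 mB H; have [ax ay] := adapted_state k0 t0.
pose J' := past k t `|` [set inl (inl (k, t))].
have JJ : past k t `<=` J' by move=> i; left.
have aX : adapted S J' (fun w => ((stage k w, inner k t w), xi k t w) :
    (borel_rV R n * borel_rV R n) * Xi).
  apply/adaptedP; apply: measurable_fun_pair; last first.
    by apply/adaptedP; apply: adapted_xi; right.
  by apply: measurable_fun_pair; apply/adaptedP; exact: adaptedS JJ _.
have aY : adapted S (past k t) (fun w => (stage k w, inner k t w) :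
    (borel_rV R n * borel_rV R n)).
  by apply/adaptedP; apply: measurable_fun_pair; apply/adaptedP.
have mE : measurable_fun setT (EFin \o psi) by exact/measurable_EFinP.
have E0 z : (0 <= (EFin \o psi) z)%E by rewrite lee_fin.
rewrite (integral_independent draws_sigmaT draws_sigmaI draws_sigma_measurable Hindep
  (i := inl (inr (k, t))) aX _ erefl (Hvs k t) mE E0); last first.
  by move=> [|//]; rewrite /past/= ltnn eqxx ltnn.
have mF := measurable_fun_fubini_tonelli_F (m2 := Pvs) _ mE E0.
have F0 z : (0 <= fubini_F Pvs (EFin \o psi) z)%E by apply: integral_ge0.
rewrite (integral_independent draws_sigmaT draws_sigmaI draws_sigma_measurable Hindep
  (i := inl (inl (k, t))) aY _ erefl (Hxi k t) mF F0); last first.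
  by rewrite /past/= ltnn eqxx ltnn.
have mG := measurable_fun_fubini_tonelli_F (m2 := Pxi) _ mF F0.
apply: ge0_le_integral => //.
- by move=> w _; apply: integral_ge0.
- exact: (measurableT_comp mG (adapted_measurable draws_sigma_measurable aY)).
- exact/measurable_EFinP.
- move=> w _; have [] := inner_dom t (stage_dom k w) => ry Cy.
  apply: le_trans (H _ _ (stage_dom k w) ry Cy).
  rewrite fubini_tonelli1//; last by move=> p; rewrite lee_fin.
  apply: (measurableT_comp mE); apply: measurable_fun_pair => //.
  by apply: measurable_fun_pair => //; exact: measurable_cst.
Qed.

Lemma gap_stageS k w : (0 < k)%N ->
  (\sum_(dl.+1 <= t < (dl + T k).+1) t%:R) * gap D gamma (stage k w) (stage k.+1 w) <=
  \sum_(dl.+1 <= t < (dl + T k).+1) t%:R * gap D gamma (stage k w) (inner k t w).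
Proof.
move=> k0; rewrite stageS//.
apply: (sconvex_jensen (A := edom r) (f := gap D gamma (stage k w))
  (w := fun t => t%:R) (y := fun t => inner k t w) _ _ _ _ (weights_gt0 k0)).2 => //.
- exact: edom_cvx rNy (dc_r_convex HD).
- move=> s y z s01 ry rz; rewrite /gap.
  have := sconvex_regularize rNy (dc_r_convex HD)
    (@sconvex_surrogate _ _ _ _ D gamma (dc_gcvx HD) (stage k w)) s01 ry rz.
  have : 0 <= gamma / 2 * (s * (1 - s)) * enorm (y - z) ^+ 2.
    case/andP: s01 => s0 s1.
    by rewrite mulr_ge0 ?sqr_ge0// mulr_ge0 ?divr_ge0 ?(ltW gamma0)// mulr_ge0 ?subr_ge0.
  rewrite -/(surrogate_value D gamma (stage k w) _) -/(surrogate_value D gamma (stage k w) y)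
    -/(surrogate_value D gamma (stage k w) z); lra.
- by move=> t; have [] := inner_dom t (stage_dom k w).
Qed.

Local Notation pt k w := (prox_point D gamma (stage k w)).

Lemma measurable_dist_inner k t : (0 < k)%N -> (0 < t)%N ->
  measurable_fun setT (fun w => (enorm (pt k w - inner k t w) ^+ 2)).
Proof.
move=> k0 t0; apply: measurable_enorm2B; last exact: measurable_inner.
by apply: (measurable_prox_point HD) => //; exact: measurable_stage.
Qed.

Lemma measurable_dist_stage k : (0 < k)%N ->
  measurable_fun setT (fun w => (enorm (stage k w - pt k w) ^+ 2)).
Proof.
move=> k0; apply: measurable_enorm2B; first exact: measurable_stage.
by apply: (measurable_prox_point HD) => //; exact: measurable_stage.
Qed.

Definition sqdist k : \bar R := (\int[P]_w (enorm (stage k w - pt k w) ^+ 2)%:E)%E.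

(** * Telescoping the steps of one stage *)

Section telescoping.
Variables (A : nat -> R) (N : R).
Hypotheses (A0 : forall t, 0 <= A t) (N0 : 0 <= N).
Variables (k : nat) (k0 : (0 < k)%N).
Hypothesis step : forall t, (0 < t)%N ->
  (\int[P]_w ((t + dl)%:R * gap D gamma (stage k w) (inner k (t + dl) w) +
     A t.+1 * enorm (pt k w - inner k t.+1 w) ^+ 2)%:E <=
   \int[P]_w (A t * enorm (pt k w - inner k t w) ^+ 2 + N)%:E)%E.

Let gap_ge0' t w : 0 <= gap D gamma (stage k w) (inner k t w).
Proof. by apply: (gap_ge0 HD gamma0); have [] := inner_dom t (stage_dom k w). Qed.

Let mgap t : (0 < t)%N ->
  measurable_fun setT (fun w => gap D gamma (stage k w) (inner k t w)).
Proof.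
by move=> t0; apply: (measurable_gap HD) => //; [exact: measurable_stage|exact: measurable_inner].
Qed.

(** The distance stays on the left with a plus sign, so that possibly infinite integrals are never
    subtracted. In the base case [inner k 1] is the stage point. *)
Lemma telescope_steps m :
  (\sum_(i < m) \int[P]_w ((i.+1 + dl)%:R * gap D gamma (stage k w) (inner k (i.+1 + dl) w))%:E
   + \int[P]_w (A m.+1 * enorm (pt k w - inner k m.+1 w) ^+ 2)%:E
   <= (A 1)%:E * sqdist k + (m%:R * N)%:E)%E.
Proof.
elim: m => [|m IH].
  rewrite big_ord0 add0e mul0r adde0 /sqdist; under eq_integral do rewrite EFinM.
  rewrite ge0_integralZl_EFin//.
  - rewrite lee_wpmul2l ?lee_fin//; under eq_integral => w _ do rewrite [inner _ _ _]/= enormB.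
    by [].
  - by move=> w _; rewrite lee_fin sqr_ge0.
  - apply/measurable_EFinP; exact: measurable_dist_inner.
rewrite big_ord_recr/= -addeA.
have := step (ltn0Sn m).
under eq_integral do rewrite EFinD.
rewrite ge0_integralD//; last 4 first.
- by move=> w _; rewrite lee_fin mulr_ge0.
- by apply/measurable_EFinP/measurable_funM => //; exact: mgap.
- by move=> w _; rewrite lee_fin mulr_ge0 ?sqr_ge0.
- by apply/measurable_EFinP/measurable_funM => //; exact: measurable_dist_inner.
under [leRHS]eq_integral do rewrite EFinD.
rewrite [leRHS]ge0_integralD//; last 2 first.
- by move=> w _; rewrite lee_fin mulr_ge0 ?sqr_ge0.
- by apply/measurable_EFinP/measurable_funM => //; exact: measurable_dist_inner.
rewrite integral_probability_cst => h.
rewrite -[X in (_ <= _ + X)%E]/((m.+1%:R * N)%:E) -natr1 mulrDl mul1r EFinD.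
apply: le_trans (leeD2l _ h) _; rewrite [leLHS]addeA [leRHS]addeA; apply: leeD2r; exact: IH.
Qed.

Lemma gap_stage_bound :
  ((\sum_(dl.+1 <= t < (dl + T k).+1) t%:R)%:E *
     \int[P]_w (gap D gamma (stage k w) (stage k.+1 w))%:E
   <= (A 1)%:E * sqdist k + ((T k)%:R * N)%:E)%E.
Proof.
have W0 := weights_gt0 k0; set W := \sum_(_ <= _ < _) _ in W0 *.
have mS : measurable_fun setT (fun w => gap D gamma (stage k w) (stage k.+1 w)).
  by apply: (measurable_gap HD) => //; exact: measurable_stage.
apply: le_trans (telescope_steps (T k)).
rewrite -ge0_integralZl_EFin//; last 3 first.
- by move=> w _; rewrite lee_fin; apply: (gap_ge0 HD gamma0); exact: stage_dom.
- exact/measurable_EFinP.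
- exact: ltW.
apply: (@le_trans _ _ (\int[P]_w (\sum_(i < T k)
    ((i.+1 + dl)%:R * gap D gamma (stage k w) (inner k (i.+1 + dl) w))%:E))%E).
  apply: ge0_le_integral => //.
  - move=> w _; rewrite -EFinM lee_fin mulr_ge0 ?(ltW W0)//.
    by apply: (gap_ge0 HD gamma0); exact: stage_dom.
  - by apply/measurable_EFinP/measurable_funM.
  - under eq_fun do rewrite sumEFin; apply/measurable_EFinP.
    apply: measurable_sum => i; apply: measurable_funM => //; exact: mgap.
  move=> w _; rewrite sumEFin -EFinM lee_fin; apply: le_trans (gap_stageS w k0) _.
  (* Step [i.+1] contributes iterate [i.+1 + dl]: indices [2] to [T + 1] in Option 1 and [1] to [T]
     in Option 2. *)
  rewrite le_eqVlt; apply/orP; left; apply/eqP.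
  by rewrite -[dl.+1]add1n big_addn -addnS addKn big_add1 big_mkord.
rewrite ge0_integral_sum//.
- by rewrite leeDl// integral_ge0// => w _; rewrite lee_fin mulr_ge0 ?sqr_ge0.
- by move=> i; apply/measurable_EFinP/measurable_funM => //; exact: mgap.
- by move=> i w _; rewrite lee_fin mulr_ge0.
Qed.

End telescoping.

(** * Recursion over the stages *)

Section recursion.
Variables (m : R).
Hypothesis m_le : forall y, edom r y -> m <= objective_value D y.

Definition excess k : \bar R := (\int[P]_w (objective_value D (stage k w) - m)%:E)%E.

Let e0 k w : 0 <= objective_value D (stage k w) - m.
Proof. by rewrite subr_ge0 m_le//; exact: stage_dom. Qed.

Let me k : (0 < k)%N -> measurable_fun setT (fun w => objective_value D (stage k w) - m).
Proof.
move=> k0; apply: measurable_funB => //.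
by apply: (measurable_objective HD gamma); exact: measurable_stage.
Qed.

Lemma excess_ge0 k : (0 <= excess k)%E.
Proof. by apply: integral_ge0 => w _; rewrite lee_fin. Qed.

Lemma sqdist_ge0 k : (0 <= sqdist k)%E.
Proof. by apply: integral_ge0 => w _; rewrite lee_fin sqr_ge0. Qed.

Let half_sqdist k : (0 < k)%N ->
  (\int[P]_w (gamma / 2 * enorm (stage k w - pt k w) ^+ 2)%:E = (gamma / 2)%:E * sqdist k)%E.
Proof.
move=> k0; under eq_integral do rewrite EFinM.
rewrite ge0_integralZl_EFin//.
- by move=> w _; rewrite lee_fin sqr_ge0.
- by apply/measurable_EFinP; exact: measurable_dist_stage.
- by rewrite divr_ge0// ltW.
Qed.

Lemma sqdist_le_excess k : (0 < k)%N -> ((gamma / 2)%:E * sqdist k <= excess k)%E.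
Proof.
move=> k0; rewrite -half_sqdist//; apply: ge0_le_integral => //.
- by move=> w _; rewrite lee_fin mulr_ge0 ?sqr_ge0// divr_ge0// ltW.
- by apply/measurable_EFinP/measurable_funM => //; exact: measurable_dist_stage.
- by apply/measurable_EFinP; exact: me.
- move=> w _; rewrite lee_fin; apply: (prox_point_objective HD gamma0 m_le).
  exact: stage_dom.
Qed.

Lemma excess_descent k : (0 < k)%N ->
  (excess k.+1 + (gamma / 2)%:E * sqdist k <=
   \int[P]_w (gap D gamma (stage k w) (stage k.+1 w))%:E + excess k)%E.
Proof.
move=> k0; have g0 w : 0 <= gap D gamma (stage k w) (stage k.+1 w).
  by apply: (gap_ge0 HD gamma0); exact: stage_dom.
have mg : measurable_fun setT (fun w => gap D gamma (stage k w) (stage k.+1 w)).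
  by apply: (measurable_gap HD) => //; exact: measurable_stage.
have d0 w : 0 <= gamma / 2 * enorm (stage k w - pt k w) ^+ 2.
  by rewrite mulr_ge0 ?sqr_ge0// divr_ge0// ltW.
have md : measurable_fun setT (fun w => gamma / 2 * enorm (stage k w - pt k w) ^+ 2).
  by apply: measurable_funM => //; exact: measurable_dist_stage.
rewrite -half_sqdist// /excess -!ge0_integralD//; do ?[by move=> w _; rewrite lee_fin];
  do ?[by apply/measurable_EFinP => //; exact: me].
apply: ge0_le_integral => //.
- by move=> w _; rewrite -EFinD lee_fin addr_ge0.
- by apply: emeasurable_funD; apply/measurable_EFinP => //; exact: me.
- by apply: emeasurable_funD; apply/measurable_EFinP => //; exact: me.
- move=> w _; rewrite -!EFinD lee_fin.
  have := objective_descent HD gamma0 (stage k.+1 w) (stage_dom k w); lra.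
Qed.

Variables (K : nat) (Delta : R).
Hypothesis excess_le : forall k, (0 < k <= K)%N -> (excess k <= Delta%:E)%E.
Variables (A1 N : R) (W : nat -> R).
Hypotheses (W0 : forall k, (0 < k)%N -> 0 < W k).
Hypothesis gap_le : forall k, (0 < k)%N -> ((W k)%:E *
  \int[P]_w (gap D gamma (stage k w) (stage k.+1 w))%:E <=
  A1%:E * sqdist k + ((T k)%:R * N)%:E)%E.

(** Return to real numbers: [excess k] is finite by assumption, [sqdist k] by [sqdist_le_excess],
    the gap by [gap_le], and [excess k.+1] by the descent inequality, even at [k = K] where no bound
    on it is assumed. *)
Lemma stage_recursion k : (0 < k <= K)%N ->
  [/\ sqdist k = (fine (sqdist k))%:E, fine (excess k) <= Delta &
   fine (excess k.+1) + gamma / 2 * fine (sqdist k) <=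
     (A1 * fine (sqdist k) + (T k)%:R * N) / W k + fine (excess k)].
Proof.
move=> kK; have k0 : (0 < k)%N by case/andP: kK.
have g20 : 0 < gamma / 2 by rewrite divr_gt0.
have eE : excess k = (fine (excess k))%:E.
  rewrite fineK// ge0_fin_numE ?excess_ge0//.
  by apply: le_lt_trans (excess_le kK) _; rewrite ltry.
have qE : sqdist k = (fine (sqdist k))%:E.
  rewrite fineK// ge0_fin_numE ?sqdist_ge0//.
  have := sqdist_le_excess k0; rewrite eE; have := sqdist_ge0 k.
  by case: (sqdist k) => [q||] // _; rewrite ?ltry// gt0_muley// leye_eq.
have eD : fine (excess k) <= Delta by rewrite -lee_fin -eE excess_le.
split=> //.
have g0 : (0 <= (\int[P]_w (gap D gamma (stage k w) (stage k.+1 w))%:E))%E.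
  by apply: integral_ge0 => w _; rewrite lee_fin; apply: (gap_ge0 HD gamma0); exact: stage_dom.
move: g0 (gap_le k0) (excess_descent k0); move: (fine (sqdist k)) (fine (excess k)) qE
  eE => q e -> ->.
case: (integral _ _ _) => [g'||] //.
  rewrite -!EFinM -!EFinD lee_fin => g'0; rewrite lee_fin => h.
  have := excess_ge0 k.+1; case: (excess k.+1) => [e'||] // e'0.
  rewrite -EFinD lee_fin => h2; apply: le_trans h2 _; rewrite lerD2r.
  by rewrite ler_pdivlMr ?W0// mulrC.
by move=> _; rewrite gt0_muley ?lte_fin ?W0// -EFinM -EFinD leye_eq.
Qed.

End recursion.

(** Decomposition along the values of [tau]: by independence from stage [k], the indicator of
    [tau = k] integrates separately to [p k]. *)
Lemma expectation_tau K (p : nat -> R) : (forall w, (0 < tau w <= K)%N) ->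
  (forall k, (0 < k <= K)%N -> P (tau @^-1` [set k]) = (p k)%:E) ->
  (\int[P]_w (enorm (prox_gradient D gamma (stage (tau w) w)) ^+ 2)%:E =
   \sum_(i < K) (gamma ^+ 2 * p i.+1)%:E * sqdist i.+1)%E.
Proof.
move=> tauK Htau.
have GE k w : enorm (prox_gradient D gamma (stage k w)) ^+ 2 =
    gamma ^+ 2 * enorm (stage k w - pt k w) ^+ 2.
  by rewrite /prox_gradient enormZ exprMn real_normK ?num_real.
pose f k (z : borel_rV R n * nat) : \bar R :=
  (gamma ^+ 2 * enorm (z.1 - prox_point D gamma z.1 : 'rV[R]_n) ^+ 2 * \1_[set k] z.2)%:E.
have f0 k z : (0 <= f k z)%E.
  by rewrite lee_fin mulr_ge0// mulr_ge0 ?sqr_ge0.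
have mf k : measurable_fun setT (f k).
  apply/measurable_EFinP; apply: measurable_funM.
    apply: measurable_funM => //; apply: measurable_enorm2B; first exact: measurable_fst.
    by apply: (measurable_prox_point HD gamma0); exact: measurable_fst.
  have m1 : measurable_fun setT (\1_[set k] : nat -> R) by exact: measurable_indic.
  exact: (measurableT_comp m1 measurable_snd).
transitivity (\int[P]_w (\sum_(i < K) f i.+1 (stage i.+1 w, tau w)))%E.
  apply: eq_integral => w _; rewrite /f sumEFin; congr EFin; rewrite GE.
  case/andP: (tauK w); case: (tau w) => // j _ jK.
  rewrite (bigD1 (Ordinal jK)) // big1 ?addr0; last first.
    move=> i /eqP iw; rewrite indicE memNset ?mulr0// => -[ji].
    by apply: iw; apply: val_inj; exact: esym ji.
  by rewrite [RHS]addr0 indicE mem_set // [RHS]mulr1.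
rewrite ge0_integral_sum//; last first.
  move=> i; apply: (measurableT_comp (mf i.+1)); apply: measurable_fun_pair.
    exact: measurable_stage.
  exact: measurable_funPT.
apply: eq_bigr => i _; set k := i.+1.
have mS := measurable_dist_stage (ltn0Sn i).
rewrite (integral_independent draws_sigmaT draws_sigmaI draws_sigma_measurable Hindep
  (i := inr tt) (nu := distribution P tau) (adapted_stage (ltn0Sn i)) _ erefl _ (mf k) (f0 k)) //.
have Pk : (\int[distribution P tau]_j (\1_[set k] j)%:E = (p k)%:E)%E.
  by rewrite integral_indic// setIT; apply: Htau; rewrite /= ltn_ord.
have I1 w : (\int[distribution P tau]_j f k (stage k w, j) =
    (gamma ^+ 2 * p k)%:E * (enorm (stage k w - pt k w) ^+ 2)%:E)%E.
  transitivity (\int[distribution P tau]_j ((gamma ^+ 2 * enorm (stage k w - pt k w) ^+ 2)%:E *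
      (\1_[set k] j)%:E))%E; first by apply: eq_integral => j _; rewrite -EFinM.
  rewrite ge0_integralZl_EFin//.
  - by rewrite Pk -!EFinM mulrAC.
  - by apply: mulr_ge0; exact: sqr_ge0.
under eq_integral do rewrite I1.
rewrite ge0_integralZl_EFin//.
- by move=> w _; rewrite lee_fin sqr_ge0.
- exact/measurable_EFinP.
- by rewrite mulr_ge0 ?sqr_ge0// -lee_fin -Htau //= ltn_ord.
Qed.

(** Interface with the two options: [A] and [N] describe one step, [kappa * gamma] is what remains
    of the descent coefficient [gamma / 2] once the initial distance is absorbed, and [e / k] is the
    remaining error of stage [k]. *)
Theorem stagewise_bound (A : nat -> R) (N kappa e alpha Delta : R) (K : nat) :
  (forall t, 0 <= A t) -> 0 <= N ->
  (forall k t, (0 < k)%N -> (0 < t)%N ->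
    (\int[P]_w ((t + dl)%:R * gap D gamma (stage k w) (inner k (t + dl) w) +
       A t.+1 * enorm (pt k w - inner k t.+1 w) ^+ 2)%:E <=
     \int[P]_w (A t * enorm (pt k w - inner k t w) ^+ 2 + N)%:E)%E) ->
  0 < kappa -> 0 <= e ->
  (forall k, (0 < k <= K)%N ->
    (A 1 * fine (sqdist k) + (T k)%:R * N) / (\sum_(dl.+1 <= t < (dl + T k).+1) t%:R) <=
    (2^-1 - kappa) * gamma * fine (sqdist k) + e / k%:R) ->
  1 <= alpha -> (0 < K)%N -> (forall w, (0 < tau w <= K)%N) ->
  (forall k, (0 < k <= K)%N -> P (tau @^-1` [set k]) =
     (k%:R `^ alpha / \sum_(1 <= j < K.+1) j%:R `^ alpha)%:E) ->
  0 < Delta ->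
  (forall k, (0 < k <= K)%N ->
     (\int[P]_w (dc_objective D (stage k w) - ereal_inf (range (dc_objective D)))
      <= Delta%:E)%E) ->
  ('E_P[fun w => (enorm (prox_gradient D gamma (stage (tau w) w)) ^+ 2)%R] <=
   (gamma * (alpha + 1) / (kappa * K%:R) * (Delta + e))%:E)%E.
Proof.
move=> A0 N0 step kappa0 e0 rate alpha1 K0 tauK Htau Delta0 HF.
have lx : (ereal_inf (range (dc_objective D)) <= (objective_value D x1)%:E)%E.
  by apply: ereal_inf_lbound; exists x1 => //; rewrite (objective_fin HD).
(* [x1] bounds the infimum above, and the value [-oo] would make the integrand of the assumption at
   [k = 1] identically [+oo]. *)
have [m mE] : exists m, ereal_inf (range (dc_objective D)) = m%:E.
  move: lx; case: (ereal_inf (range _)) HF => [m _ _||] //; first by exists m.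
  move=> /(_ 1%N K0).
  rewrite (_ : (\int[P]_w _)%E = +oo%E) ?leye_eq// -[RHS](mule1) -(@probability_setT _ _ _ P).
  rewrite -integral_cst//; apply: eq_integral => w _.
  by rewrite (objective_fin HD (stage_dom 1 w)).
have m_le y : edom r y -> m <= objective_value D y.
  move=> ry; rewrite -lee_fin -mE -(objective_fin HD ry).
  by apply: ereal_inf_lbound; exists y.
have HF' k : (0 < k <= K)%N -> (excess m k <= Delta%:E)%E.
  move=> kK; apply: le_trans (HF k kK); rewrite mE le_eqVlt; apply/orP; left; apply/eqP.
  by apply: eq_integral => w _; rewrite (objective_fin HD (stage_dom k w)) EFinB.
have rec := stage_recursion m_le HF' weights_gt0
  (fun k k0 => gap_stage_bound A0 N0 k0 (step k ^~ k0)).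
pose a k := fine (excess m k); pose q k := fine (sqdist k).
have c0 : 0 < kappa * gamma by rewrite mulr_gt0.
have aK : 0 <= a K.+1 by apply: fine_ge0; exact: excess_ge0.
have a_le k : (0 < k <= K)%N -> a k <= Delta by move=> kK; have [] := rec k kK.
have arec k : (0 < k <= K)%N -> kappa * gamma * q k + a k.+1 <= a k + e / k%:R.
  move=> kK; have [_ _ h] := rec k kK; have h2 := rate k kK.
  have {h2} := le_trans h (lerD h2 (lexx _)); rewrite -/(a k.+1) -/(a k) -/(q k).
  by move: (e / k%:R) (a k.+1) (a k) (q k) => b1 b2 b3 b4; lra.
have bound := weighted_average_le alpha1 K0 e0 aK c0 (ltW Delta0) a_le arec.
rewrite unlock (expectation_tau tauK Htau).
under eq_bigr => i _.
  have [-> _ _] := rec i.+1 (ltn_ord i : (0 < i.+1 <= K)%N).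
  rewrite -EFinM; over.
rewrite sumEFin lee_fin.
set s := \sum_(1 <= j < K.+1) _ in bound *.
have -> : \sum_(i < K) gamma ^+ 2 * (i.+1%:R `^ alpha / s) * fine (sqdist i.+1) =
    gamma ^+ 2 * \sum_(i < K) i.+1%:R `^ alpha / s * q i.+1.
  by rewrite mulr_sumr; apply: eq_bigr => i _; rewrite -mulrA.
have g20 : 0 < gamma ^+ 2 by rewrite exprn_gt0.
have KR : 0 < K%:R :> R by rewrite ltr0n.
(* [prox_gradient] carries [gamma ^+ 2]; the constant [kappa * gamma] of the recursion cancels one
   factor. *)
rewrite -(ler_pM2l g20) in bound; apply: le_trans bound _.
rewrite le_eqVlt; apply/orP; left; apply/eqP; field.
by rewrite !gt_eqF.
Qed.

End process.

(** * The two variants *)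

Lemma ge0_integral_lin2 (R : realType) d (T : measurableType d) (mu : probability T R)
    (f1 f2 : T -> R) (a1 a2 c1 c2 : R) :
  measurable_fun setT f1 -> measurable_fun setT f2 ->
  (forall x, 0 <= f1 x) -> (forall x, 0 <= f2 x) -> 0 <= a1 -> 0 <= a2 ->
  (\int[mu]_x (f1 x)%:E <= c1%:E)%E -> (\int[mu]_x (f2 x)%:E <= c2%:E)%E ->
  (\int[mu]_x (a1 * f1 x + a2 * f2 x)%:E <= (a1 * c1 + a2 * c2)%:E)%E.
Proof.
move=> m1 m2 f10 f20 a10 a20 h1 h2.
under eq_integral do rewrite EFinD (EFinM a1) (EFinM a2).
rewrite ge0_integralD//.
- rewrite !ge0_integralZl_EFin// ?[X in (_ <= X)%E]EFinD;
    do ?[by move=> x _; rewrite lee_fin]; do ?[exact/measurable_EFinP].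
  by rewrite !EFinM; apply: leeD; apply: lee_wpmul2l.
- by move=> x _; rewrite -EFinM lee_fin mulr_ge0.
- by apply: measurable_funeM; exact/measurable_EFinP.
- by move=> x _; rewrite -EFinM lee_fin mulr_ge0.
- by apply: measurable_funeM; exact/measurable_EFinP.
Qed.

Section options.
Variables (R : realType) (n : nat) (d1 d2 : measure_display).
Variables (Xi : measurableType d1) (Pxi : probability Xi R).
Variables (Vs : measurableType d2) (Pvs : probability Vs R).
Variables (D : dc_problem R n Xi Vs) (HD : dc_assumptions Pxi Pvs D).
Variables (gamma : R) (gamma0 : 0 < gamma) (G : R) (G0 : 0 < G).
Local Notation r := (dc_r D).
Let rprop := dc_r_proper HD.
Let rNy := rprop.1.

Lemma unconstrained_region : solver_region D gamma (fun=> setT).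
Proof.
split=> //.
- by move=> eta x y v eta0 _; apply: spg_argminT => //; [exact: dc_r_lsc HD|exact: dc_r_convex HD].
- move=> b e y c b0 ry e0; exists e => // y' c' p p' ry' _ cc' mp mp'.
  apply: le_trans cc'; apply: (prox_nonexpansive rNy (dc_r_convex HD) _ b0 _ _ mp mp') => //.
    by move=> t x z _ _ _; rewrite !mulr0 !mul0r; lra.
  by exists y.
Qed.

Lemma ball_region :
  (forall x, edom r x -> exists2 s,
     (forall y, edom r y -> (r x + (dotv s (y - x))%:E <= r y)%E) & enorm s <= G) ->
  solver_region D gamma (spg_region D gamma G).
Proof.
move=> rsub; split.
- by move=> x rx; split=> //; rewrite subrr enorm0 divr_ge0 ?mulr_ge0// ltW.
- by move=> x; exact: (region_cvx rNy (dc_r_convex HD) (c := x) (rho := 3 * G / gamma)).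
- by move=> eta x y v _ rx; apply: spg_argmin_region => //; exact: dc_r_lsc HD.
- move=> b e y c b0 ry e0.
  exact: (region_argmin_continuous gamma0 G0 rprop (dc_r_lsc HD) (dc_r_convex HD) rsub b0 c ry e0).
Qed.

(** [x] is the stage point, where [h] is sampled, and [y] the inner iterate, where [g] is
    sampled. *)
Definition noise x y (p : Xi * Vs) : 'rV[R]_n :=
  dnoise (dc_sg D y) (dc_sh D x) (mean_sg Pxi D y) (dc_dh D x) p.

Definition noisy_dist (eta : R) x y p : R :=
  enorm (y - prox_point D gamma x - eta *: noise x y p) ^+ 2.

Definition second_moments x y (p : Xi * Vs) : R :=
  enorm (dc_sg D y p.1) ^+ 2 + enorm (dc_sh D x p.2) ^+ 2 + 4 * G ^+ 2.

Lemma directionE x y p :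
  dc_sg D y p.1 - dc_sh D x p.2 = mean_sg Pxi D y - dc_dh D x + noise x y p.
Proof. by apply/rowP => i; rewrite /noise /dnoise !mxE; ring. Qed.

Section measurable_state.
Variables (d : measure_display) (T : measurableType d).
Variables (X Y : T -> borel_rV R n) (a : T -> Xi) (b : T -> Vs).
Hypotheses (mX : measurable_fun setT X) (mY : measurable_fun setT Y)
  (ma : measurable_fun setT a) (mb : measurable_fun setT b).

Lemma measurable_noise i : measurable_fun setT (fun w => noise (X w) (Y w) (a w, b w) 0 i).
Proof.
rewrite (_ : (fun w => _) = fun w => (dc_sg D (Y w) (a w) 0 i - mean_sg Pxi D (Y w) 0 i) -
    (dc_sh D (X w) (b w) 0 i - dc_dh D (X w) 0 i)).
  2: by apply/funext => w; rewrite /noise /dnoise !(coordD, coordN).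
apply: measurable_funB; apply: measurable_funB.
- exact: (measurable_sg HD).
- exact: (measurable_mean_sg HD).
- exact: (measurable_sh HD).
- exact: (measurable_dh HD).
Qed.

Lemma measurable_noisy_dist eta :
  measurable_fun setT (fun w => noisy_dist eta (X w) (Y w) (a w, b w)).
Proof.
apply: measurable_enorm2 => i.
rewrite (_ : (fun w => _) = fun w => (Y w : 'rV[R]_n) 0 i - prox_point D gamma (X w) 0 i -
    eta * noise (X w) (Y w) (a w, b w) 0 i).
  2: by apply/funext => w; rewrite coordD coordN coordZ coordD coordN.
apply: measurable_funB; last by apply: measurable_funM => //; exact: measurable_noise.
apply: measurable_funB; first exact: measurable_coord_comp.
by apply: measurable_coord_comp; exact: (measurable_prox_point HD gamma0).
Qed.

Lemma measurable_noise_sqr :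
  measurable_fun setT (fun w => enorm (noise (X w) (Y w) (a w, b w)) ^+ 2).
Proof. by apply: measurable_enorm2 => i; exact: measurable_noise. Qed.

Lemma measurable_second_moments :
  measurable_fun setT (fun w => second_moments (X w) (Y w) (a w, b w)).
Proof.
apply: measurable_funD => //; apply: measurable_funD; apply: measurable_enorm2 => i.
- exact: (measurable_sg HD).
- exact: (measurable_sh HD).
Qed.

End measurable_state.

Section variance.
Variables (x y : 'rV[R]_n).
Hypotheses
  (vg : (\int[Pxi]_a (enorm (dc_sg D y a - mean_sg Pxi D y) ^+ 2)%:E <= (G ^+ 2)%:E)%E)
  (vh : (\int[Pvs]_b (enorm (dc_sh D x b - dc_dh D x) ^+ 2)%:E <= (G ^+ 2)%:E)%E).

Let dhE : dc_dh D x = vexpectation Pvs (dc_sh D x) := esym (dc_sh_unbiased HD x).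

Lemma integral_noisy_dist eta :
  (\int[Pxi \x Pvs]_p (noisy_dist eta x y p)%:E <=
   (enorm (prox_point D gamma x - y) ^+ 2 + 2 * eta ^+ 2 * G ^+ 2)%:E)%E.
Proof.
rewrite enormB; apply: (integral_dnoise_le (dc_sg_integrable HD y) (dc_sh_integrable HD x)) => //.
by rewrite sqr_ge0.
Qed.

Lemma integral_noise_sqr :
  (\int[Pxi \x Pvs]_p (enorm (noise x y p) ^+ 2)%:E <= (2 * G ^+ 2)%:E)%E.
Proof.
have := integral_dnoise_le (dc_sg_integrable HD y) (dc_sh_integrable HD x) erefl dhE 1 0
  (sqr_ge0 G) vg vh.
rewrite enorm0 !expr0n !expr1n add0r mulr1; apply: le_trans.
rewrite le_eqVlt; apply/orP; left; apply/eqP; apply: eq_integral => p _.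
by rewrite sub0r scale1r enormN.
Qed.

End variance.

Lemma integral_second_moments x y :
  (\int[Pxi]_a (enorm (dc_sg D y a) ^+ 2)%:E <= (G ^+ 2)%:E)%E ->
  (\int[Pvs]_b (enorm (dc_sh D x b) ^+ 2)%:E <= (G ^+ 2)%:E)%E ->
  (\int[Pxi \x Pvs]_p (second_moments x y p)%:E <= (6 * G ^+ 2)%:E)%E.
Proof.
move=> hg hh.
have mg : measurable_fun setT (fun a => enorm (dc_sg D y a) ^+ 2).
  apply: measurable_enorm2 => i.
  by have /integrableP[/measurable_EFinP] := dc_sg_integrable HD y i.
have mh : measurable_fun setT (fun b => enorm (dc_sh D x b) ^+ 2).
  apply: measurable_enorm2 => i.
  by have /integrableP[/measurable_EFinP] := dc_sh_integrable HD x i.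
have mgp : measurable_fun setT (fun p : Xi * Vs => enorm (dc_sg D y p.1) ^+ 2).
  exact: (measurableT_comp mg measurable_fst).
have mhp : measurable_fun setT (fun p : Xi * Vs => enorm (dc_sh D x p.2) ^+ 2).
  exact: (measurableT_comp mh measurable_snd).
have s0 (T : Type) (F : T -> 'rV[R]_n) (p : T) : (0 <= (enorm (F p) ^+ 2)%:E)%E.
  by rewrite lee_fin sqr_ge0.
have Ig : (\int[Pxi \x Pvs]_p (enorm (dc_sg D y p.1) ^+ 2)%:E <= (G ^+ 2)%:E)%E.
  rewrite fubini_tonelli1 /fubini_F //=; last exact/measurable_EFinP.
  by under eq_integral do rewrite integral_probability_cst.
have Ih : (\int[Pxi \x Pvs]_p (enorm (dc_sh D x p.2) ^+ 2)%:E <= (G ^+ 2)%:E)%E.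
  rewrite fubini_tonelli2 /fubini_G //=; last exact/measurable_EFinP.
  by under eq_integral do rewrite integral_probability_cst.
rewrite /second_moments; under eq_integral do rewrite EFinD.
rewrite ge0_integralD//; last 3 first.
- by move=> p _; rewrite lee_fin addr_ge0 ?sqr_ge0.
- by apply/measurable_EFinP; exact: measurable_funD.
- by move=> p _; rewrite lee_fin mulr_ge0 ?sqr_ge0.
under eq_integral do rewrite EFinD.
rewrite ge0_integralD//; last 2 first.
- exact/measurable_EFinP.
- exact/measurable_EFinP.
rewrite integral_probability_cst.
apply: le_trans (leeD (leeD Ig Ih) (lexx _)) _.
by rewrite -!EFinD lee_fin; lra.
Qed.

End options.

Section steps.
Variables (R : realType) (n : nat) (d d1 d2 : measure_display).
Variables (Om : measurableType d) (P : probability Om R).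
Variables (Xi : measurableType d1) (Pxi : probability Xi R).
Variables (Vs : measurableType d2) (Pvs : probability Vs R).
Variables (D : dc_problem R n Xi Vs) (HD : dc_assumptions Pxi Pvs D).
Variables (xi : nat -> nat -> {RV P >-> Xi}) (vs : nat -> nat -> {RV P >-> Vs}).
Variable tau : {RV P >-> nat}.
Hypotheses (Hxi : forall k t, has_law (xi k t) Pxi)
  (Hvs : forall k t, has_law (vs k t) Pvs).
Hypothesis Hindep : mutually_independent P
  (draws_sigma (fun k t => xi k t : Om -> Xi) (fun k t => vs k t : Om -> Vs) tau).
Variables (gamma : R) (gamma0 : 0 < gamma) (G : R) (G0 : 0 < G).
Local Notation r := (dc_r D).
Variables (T : nat -> nat) (T0 : forall k, (0 < k)%N -> (0 < T k)%N).
Variables (x1 : 'rV[R]_n) (rx1 : edom r x1).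

Let rprop := dc_r_proper HD.

(* The algorithm evaluates the two oracles at different points, so their
   variances are bounded separately, which doubles the variance bound. *)
Lemma condition_S_variance L x : condition_S Pxi Pvs D L G ->
  (\int[Pxi]_a (enorm (dc_sg D x a - mean_sg Pxi D x) ^+ 2)%:E <= (G ^+ 2)%:E)%E /\
  (\int[Pvs]_b (enorm (dc_sh D x b - dc_dh D x) ^+ 2)%:E <= (G ^+ 2)%:E)%E.
Proof.
move=> [_ H]; exact: (variance_le (dc_sg_integrable HD x) (dc_sh_integrable HD x)
  erefl (esym (dc_sh_unbiased HD x)) (H x)).
Qed.

Lemma smooth_mean_lipschitz L x y : smooth L (dc_g D) ->
  enorm (mean_sg Pxi D x - mean_sg Pxi D y) <= L * enorm (x - y).
Proof.
move=> [dg lg]; have E z : mean_sg Pxi D z = gradient (dc_g D) z.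
  exact: subgradient_gradient (dg z) (dc_sg_unbiased HD z).
by rewrite !E.
Qed.

Section expected_step.
Variables (C : 'rV[R]_n -> set 'rV[R]_n) (HC : solver_region D gamma C).
Variables (eta : nat -> R) (eta0 : forall t, (0 < t)%N -> 0 < eta t) (dl : nat).
Local Notation X := (stage D xi vs gamma C eta T dl x1).
Local Notation Y := (inner D xi vs gamma C eta T dl x1).
Local Notation pt k w := (prox_point D gamma (X k w)).

Lemma inner_in_dom k t w : edom r (Y k t w) /\ C (X k w) (Y k t w).
Proof. exact: (inner_dom HD HC eta0 t (stage_dom HD xi vs HC eta0 T0 dl rx1 k w)). Qed.

(** Turns a pointwise one-step bound into one on expectations; [f2] is the squared noise in the
    smooth case and [second_moments] in the nonsmooth one. *)
Lemma expected_step k t (f : Om -> R) (f2 : 'rV[R]_n -> 'rV[R]_n -> Xi * Vs -> R)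
    (a b c : R) : (0 < k)%N -> (0 < t)%N -> 0 <= a -> 0 <= b ->
  measurable_fun setT f -> (forall w, 0 <= f w) ->
  measurable_fun setT (fun z : ((borel_rV R n * borel_rV R n) * Xi) * Vs =>
    f2 z.1.1.1 z.1.1.2 (z.1.2, z.2)) -> (forall x y p, 0 <= f2 x y p) ->
  (forall x y, measurable_fun setT (f2 x y)) ->
  (forall w, f w <= a * noisy_dist Pxi D gamma (eta t) (X k w) (Y k t w) (xi k t w, vs k t w) +
     b * f2 (X k w) (Y k t w) (xi k t w, vs k t w)) ->
  (forall x y, edom r x -> edom r y -> C x y ->
    [/\ (\int[Pxi]_a (enorm (dc_sg D y a - mean_sg Pxi D y) ^+ 2)%:E <= (G ^+ 2)%:E)%E,
        (\int[Pvs]_b (enorm (dc_sh D x b - dc_dh D x) ^+ 2)%:E <= (G ^+ 2)%:E)%E &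
        (\int[Pxi \x Pvs]_p (f2 x y p)%:E <= c%:E)%E]) ->
  (\int[P]_w (f w)%:E <= \int[P]_w (a * enorm (pt k w - Y k t w) ^+ 2 +
     (a * (2 * eta t ^+ 2 * G ^+ 2) + b * c))%:E)%E.
Proof.
move=> k0 t0 a0 b0 mf f0 mf2 f20 mf2' le_f moments.
pose psi (z : ((borel_rV R n * borel_rV R n) * Xi) * Vs) : R :=
  a * noisy_dist Pxi D gamma (eta t) z.1.1.1 z.1.1.2 (z.1.2, z.2) +
  b * f2 z.1.1.1 z.1.1.2 (z.1.2, z.2).
have psi0 z : 0 <= psi z by rewrite addr_ge0// mulr_ge0// sqr_ge0.
have mX : measurable_fun setT (X k : Om -> borel_rV R n).
  exact: (measurable_stage HD xi vs tau gamma0 HC eta0 T0 dl rx1 k0).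
have mY : measurable_fun setT (Y k t : Om -> borel_rV R n).
  exact: (measurable_inner HD xi vs tau gamma0 HC eta0 T0 dl rx1 k0).
have mpsi : measurable_fun setT psi.
  have m1 : measurable_fun setT (fun z : ((borel_rV R n * borel_rV R n) * Xi) * Vs => z.1.1).
    exact: (measurableT_comp measurable_fst measurable_fst).
  apply: measurable_funD; apply: measurable_funM => //.
  apply: (measurable_noisy_dist HD gamma0).
  - exact: (measurableT_comp measurable_fst m1).
  - exact: (measurableT_comp measurable_snd m1).
  - exact: (measurableT_comp measurable_snd measurable_fst).
  - exact: measurable_snd.
pose B x y := a * enorm (prox_point D gamma x - y) ^+ 2 +
  (a * (2 * eta t ^+ 2 * G ^+ 2) + b * c).
have mpt : measurable_fun setT (fun w => pt k w : borel_rV R n).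
  exact: (measurable_prox_point HD gamma0).
have mB : measurable_fun setT (fun w => B (X k w) (Y k t w)).
  by apply: measurable_funD => //; apply: measurable_funM => //; exact: measurable_enorm2B.
have psiB x y : edom r x -> edom r y -> C x y ->
    (\int[Pxi \x Pvs]_p (psi (((x, y), p.1), p.2))%:E <= (B x y)%:E)%E.
  move=> rx ry Cxy; have [vg vh h2] := moments x y rx ry Cxy.
  have mn : measurable_fun setT (noisy_dist Pxi D gamma (eta t) x y).
    have := measurable_noisy_dist HD gamma0 (X := cst x) (Y := cst y)
      (measurable_cst _) (measurable_cst _) measurable_fst measurable_snd (eta t).
    by congr measurable_fun; apply/funext => -[].
  rewrite /B addrA -mulrDr.
  have := ge0_integral_lin2 mn (mf2' x y) (fun p => sqr_ge0 _) (f20 x y) a0 b0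
    (integral_noisy_dist HD gamma vg vh (eta t)) h2.
  apply: le_trans; rewrite le_eqVlt; apply/orP; left; apply/eqP.
  by apply: eq_integral => -[].
apply: le_trans (step_expectation HD Hxi Hvs Hindep gamma0 HC eta0 T0 rx1
   k0 t0 mpsi psi0 mB psiB).
apply: ge0_le_integral => //.
- by move=> w _; rewrite lee_fin.
- exact/measurable_EFinP.
- apply/measurable_EFinP; apply: (measurableT_comp mpsi); apply: measurable_fun_pair => //.
  by apply: measurable_fun_pair => //; apply: measurable_fun_pair.
- by move=> w _; rewrite lee_fin; exact: le_f.
Qed.

Lemma measurable_step_lhs k s t (a b : R) : (0 < k)%N -> (0 < s)%N -> (0 < t)%N ->
  measurable_fun setT (fun w => a * gap D gamma (X k w) (Y k s w) +
    b * enorm (pt k w - Y k t w) ^+ 2).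
Proof.
move=> k0 s0 t0.
have mX : measurable_fun setT (X k : Om -> borel_rV R n).
  exact: (measurable_stage HD xi vs tau gamma0 HC eta0 T0 dl rx1 k0).
have mY i : (0 < i)%N -> measurable_fun setT (Y k i : Om -> borel_rV R n).
  exact: (measurable_inner HD xi vs tau gamma0 HC eta0 T0 dl rx1 k0).
have mpt : measurable_fun setT (fun w => pt k w : borel_rV R n).
  exact: (measurable_prox_point HD gamma0).
apply: measurable_funD; apply: measurable_funM => //.
  by apply: (measurable_gap HD) => //; exact: mY.
by apply: measurable_enorm2B => //; exact: mY.
Qed.

End expected_step.

Section smooth_case.
Variables (L : R) (L0 : 0 < L) (HS : condition_S Pxi Pvs D L G) (Lg : 3 * L <= gamma).

Let eta (t : nat) : R := 3 / (gamma * (t%:R + 1)).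
Let HC := unconstrained_region HD gamma0.

Let eta0 t : (0 < t)%N -> 0 < eta t.
Proof. by move=> _; rewrite divr_gt0// mulr_gt0// ltr_wpDl. Qed.

Local Notation X := (stage D xi vs gamma (fun=> setT) eta T 1 x1).
Local Notation Y := (inner D xi vs gamma (fun=> setT) eta T 1 x1).

Lemma smooth_stage_step k t : (0 < k)%N -> (0 < t)%N ->
  (\int[P]_w ((t + 1)%:R * gap D gamma (X k w) (Y k (t + 1) w) +
     gamma * (t.+1%:R + 1) ^+ 2 / 6 * enorm (prox_point D gamma (X k w) - Y k t.+1 w) ^+ 2)%:E <=
   \int[P]_w (gamma * (t%:R + 1) ^+ 2 / 6 * enorm (prox_point D gamma (X k w) - Y k t w) ^+ 2
     + 12 * G ^+ 2 / gamma)%:E)%E.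
Proof.
move=> k0 t0.
have t1 : 1 <= t%:R :> R by rewrite ler1n.
have a0 s : 0 <= gamma * (s%:R + 1) ^+ 2 / 6.
  by rewrite divr_ge0// mulr_ge0 ?sqr_ge0// ltW.
have b0 : 0 <= 9 / (2 * gamma) by rewrite divr_ge0// mulr_ge0// ltW.
(* [3 * G ^+ 2 / gamma] from the distance and [9 * G ^+ 2 / gamma] from the squared noise. *)
have -> : 12 * G ^+ 2 / gamma = gamma * (t%:R + 1) ^+ 2 / 6 * (2 * eta t ^+ 2 * G ^+ 2) +
    9 / (2 * gamma) * (2 * G ^+ 2).
  by rewrite /eta; field; rewrite !gt_eqF//= ltr_wpDl.
apply: (expected_step HC eta0
  (f2 := fun x y p => enorm (noise Pxi D x y p) ^+ 2)) => //.
- by apply: (measurable_step_lhs HC eta0) => //; rewrite addn1.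
- move=> w; rewrite addr_ge0// mulr_ge0 ?sqr_ge0//; apply: (gap_ge0 HD gamma0).
  by have [] := inner_in_dom HC eta0 1 k (t + 1) w.
- have m1 : measurable_fun setT (fun z : ((borel_rV R n * borel_rV R n) * Xi) * Vs => z.1.1).
    exact: (measurableT_comp measurable_fst measurable_fst).
  apply: (measurable_noise_sqr HD).
  + exact: (measurableT_comp measurable_fst m1).
  + exact: (measurableT_comp measurable_snd m1).
  + exact: (measurableT_comp measurable_snd measurable_fst).
  + exact: measurable_snd.
- by move=> x y p; exact: sqr_ge0.
- move=> x y.
  have := measurable_noise_sqr HD (X := cst x) (Y := cst y)
      (measurable_cst _) (measurable_cst _) measurable_fst measurable_snd.
  by congr measurable_fun; apply/funext => -[].
- move=> w; have t2 : t.+1%:R + 1 = t%:R + 2 :> R by rewrite -natr1 -addrA.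
  rewrite addn1 t2 -natr1 /gap.
  have := smooth_step gamma0 rprop (dc_r_convex HD)
    (directionE Pxi D (X k w) (Y k t w) (xi k t w, vs k t w))
    (prox_point_dom gamma0 (dc_g_lsc HD) (dc_gcvx HD) rprop (dc_r_lsc HD) (dc_r_convex HD) (X k w))
    (mean_sg_subgradient HD _ _) t1 L0 Lg
    (descent (Y k t w) (Y k t.+1 w) (mean_sg_subgradient HD)
       (fun x y => smooth_mean_lipschitz x y HS.1)).
  apply; rewrite (innerS HD)//.
  exact: (region_argmin HC _ _ (eta0 t0) (stage_dom HD xi vs HC eta0 T0 1 rx1 k w)).
- move=> x y _ _ _; have [vg _] := condition_S_variance y HS.
  have [_ vh] := condition_S_variance x HS; split=> //.
  exact: (integral_noise_sqr HD vg vh).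
Qed.

End smooth_case.

Section nonsmooth_case.
Hypothesis HN : condition_N Pxi Pvs D G.

(** Brings both alternatives on [r] to one form; for an indicator the vector [0] works. *)
Lemma condition_N_subgradient x : edom r x -> exists2 s,
  (forall y, edom r y -> (r x + (dotv s (y - x))%:E <= r y)%E) & enorm s <= G.
Proof.
move=> rx; have [_ [[A [_ _ rA]]|rs]] := HN; last first.
  by have [s ss sG] := rs x rx; exists s => // y _; exact: ss.
exists 0; last by rewrite enorm0 ltW.
move=> y _; rewrite dotv0l adde0; move: rx; rewrite /edom/= rA /eindicator.
by case: ifP => // _ _; case: ifP => // _; rewrite leey.
Qed.

(** A second moment splits into squared mean and variance, each at most [G ^+ 2]: the means are for
    [prox_point_dist], the variances for the noise. *)
Lemma condition_N_moments x y : edom r x -> edom r y ->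
  [/\ (\int[Pxi]_a (enorm (dc_sg D y a - mean_sg Pxi D y) ^+ 2)%:E <= (G ^+ 2)%:E)%E,
      (\int[Pvs]_b (enorm (dc_sh D x b - dc_dh D x) ^+ 2)%:E <= (G ^+ 2)%:E)%E &
      (\int[Pxi \x Pvs]_p (second_moments D G x y p)%:E <= (6 * G ^+ 2)%:E)%E] /\
  enorm (mean_sg Pxi D y) <= G /\ enorm (dc_dh D x) <= G.
Proof.
move=> rx ry; have [moments _] := HN.
have [hg _] := moments _ ry; have [_ hh] := moments _ rx.
rewrite unlock in hg; rewrite unlock in hh.
have eg : (\int[Pxi]_a (enorm (mean_sg Pxi D y + 1 *: (dc_sg D y a - mean_sg Pxi D y)) ^+ 2)%:E
    <= (G ^+ 2)%:E)%E.
  by under eq_integral do rewrite scale1r addrC subrK.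
have eh : (\int[Pvs]_b (enorm (dc_dh D x + 1 *: (dc_sh D x b - dc_dh D x)) ^+ 2)%:E
    <= (G ^+ 2)%:E)%E.
  by under eq_integral do rewrite scale1r addrC subrK.
have [mg vg] := integral_enorm2_le (dc_sg_integrable HD y) erefl (expr1n _ _) eg.
have [mh vh] := integral_enorm2_le (dc_sh_integrable HD x) (esym (dc_sh_unbiased HD x))
  (expr1n _ _) eh.
split; last by split; rewrite -(@ler_pXn2r _ 2)// nnegrE ?enorm_ge0// ltW.
by split=> //; exact: (integral_second_moments HD hg hh).
Qed.

Let eta (t : nat) : R := 4 / (gamma * t%:R).
Let HC := ball_region HD gamma0 G0 condition_N_subgradient.

Let eta0 t : (0 < t)%N -> 0 < eta t.
Proof. by move=> t0; rewrite divr_gt0// mulr_gt0// ltr0n. Qed.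

Local Notation X := (stage D xi vs gamma (spg_region D gamma G) eta T 0 x1).
Local Notation Y := (inner D xi vs gamma (spg_region D gamma G) eta T 0 x1).

Let prox_dist x : edom r x -> enorm (prox_point D gamma x - x) <= 3 * G / gamma.
Proof.
move=> rx; have [_ [mG hG]] := condition_N_moments rx rx.
exact: (prox_point_dist gamma0 G0 rprop (dc_r_lsc HD) (dc_r_convex HD) condition_N_subgradient
  (dc_g_lsc HD) (dc_gcvx HD) (mean_sg_subgradient HD x) mG hG rx).
Qed.

(** A bound on the initial distance that leaves nothing for the descent term to absorb, which
    permits [kappa = 2^-1]. *)
Lemma nonsmooth_sqdist k : (0 < k)%N ->
  (sqdist D xi vs gamma (spg_region D gamma G) eta T 0 x1 k <= (9 * G ^+ 2 / gamma ^+ 2)%:E)%E.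
Proof.
move=> k0; rewrite -(integral_probability_cst P).
apply: ge0_le_integral => //.
- by move=> w _; rewrite lee_fin sqr_ge0.
- by apply/measurable_EFinP; exact: (measurable_dist_stage HD xi vs tau gamma0 HC eta0 T0 0 rx1 k0).
- move=> w _; rewrite lee_fin enormB.
  have -> : 9 * G ^+ 2 / gamma ^+ 2 = (3 * G / gamma) ^+ 2.
    by field; rewrite gt_eqF.
  have := prox_dist (stage_dom HD xi vs HC eta0 T0 0 rx1 k w).
  by move=> h; rewrite !expr2 ler_pM ?enorm_ge0.
Qed.

Lemma nonsmooth_stage_step k t : (0 < k)%N -> (0 < t)%N ->
  (\int[P]_w ((t + 0)%:R * gap D gamma (X k w) (Y k (t + 0) w) +
     gamma * t.+1%:R ^+ 2 / 8 * enorm (prox_point D gamma (X k w) - Y k t.+1 w) ^+ 2)%:E <=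
   \int[P]_w (gamma * t%:R ^+ 2 / 8 * enorm (prox_point D gamma (X k w) - Y k t w) ^+ 2
     + 76 * G ^+ 2 / gamma)%:E)%E.
Proof.
move=> k0 t0; rewrite addn0.
have t1 : 1 <= t%:R :> R by rewrite ler1n.
have a0 s : 0 <= gamma * s%:R ^+ 2 / 8.
  by rewrite divr_ge0// mulr_ge0 ?sqr_ge0// ltW.
have b0 : 0 <= 12 / gamma by rewrite divr_ge0// ltW.
(* [4 * G ^+ 2 / gamma] from the distance and [72 * G ^+ 2 / gamma] from the second moments. *)
have -> : 76 * G ^+ 2 / gamma = gamma * t%:R ^+ 2 / 8 * (2 * eta t ^+ 2 * G ^+ 2) +
    12 / gamma * (6 * G ^+ 2).
  by rewrite /eta; field; rewrite !gt_eqF// ltr0n.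
apply: (expected_step HC eta0 (f2 := second_moments D G)) => //.
- exact: (measurable_step_lhs HC eta0).
- move=> w; rewrite addr_ge0// mulr_ge0 ?sqr_ge0//; apply: (gap_ge0 HD gamma0).
  by have [] := inner_in_dom HC eta0 0 k t w.
- have m1 : measurable_fun setT (fun z : ((borel_rV R n * borel_rV R n) * Xi) * Vs => z.1.1).
    exact: (measurableT_comp measurable_fst measurable_fst).
  apply: (measurable_second_moments HD).
  + exact: (measurableT_comp measurable_fst m1).
  + exact: (measurableT_comp measurable_snd m1).
  + exact: (measurableT_comp measurable_snd measurable_fst).
  + exact: measurable_snd.
- by move=> x y p; rewrite !addr_ge0 ?sqr_ge0// mulr_ge0 ?sqr_ge0.
- move=> x y.
  have := measurable_second_moments HD G (X := cst x) (Y := cst y)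
      (measurable_cst _) (measurable_cst _) measurable_fst measurable_snd.
  by congr measurable_fun; apply/funext => -[].
- move=> w; rewrite -natr1 /gap.
  have rX := stage_dom HD xi vs HC eta0 T0 0 rx1 k w.
  have [rY CY] := inner_in_dom HC eta0 0 k t w.
  have rpt := prox_point_dom gamma0 (dc_g_lsc HD) (dc_gcvx HD) rprop (dc_r_lsc HD)
    (dc_r_convex HD) (X k w).
  have [s ss sG] := condition_N_subgradient rY.
  apply: (nonsmooth_step gamma0 rprop (dc_r_convex HD)
    (directionE Pxi D (X k w) (Y k t w) (xi k t w, vs k t w)) rpt
    (mean_sg_subgradient HD _ _) t1 G0 erefl ss sG rX CY) => //.
    by split => //; exact: prox_dist.
  rewrite (innerS HD)//.
  exact: (region_argmin HC _ _ (eta0 t0) rX).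
- by move=> x y rx ry _; have [] := condition_N_moments rx ry.
Qed.

End nonsmooth_case.
End steps.

Lemma nat_ceil_ge (R : realType) (a : R) : a <= (nat_ceil a)%:R.
Proof.
apply: le_trans (ceil_ge a) _; rewrite /nat_ceil natr_absz ler_int.
exact: ler_norm.
Qed.

Lemma sum_weights (R : realType) dl m :
  \sum_(dl.+1 <= t < (dl + m).+1) t%:R = m%:R * (m%:R + 2 * dl%:R + 1) / 2 :> R.
Proof.
elim: m => [|m IH]; first by rewrite addn0 big_geq// !mul0r.
rewrite addnS big_nat_recr/=; last by rewrite ltnS leq_addr.
rewrite IH -!natr1 natrD; by field.
Qed.

Theorem theorem3
  (R : realType) (n : nat)
  (d d1 d2 : measure_display)
  (Om : measurableType d) (P : probability Om R)
  (Xi : measurableType d1) (Pxi : probability Xi R)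
  (Vs : measurableType d2) (Pvs : probability Vs R)
  (D : dc_problem R n Xi Vs) (HD : dc_assumptions Pxi Pvs D)
  (xi : nat -> nat -> {RV P >-> Xi}) (vs : nat -> nat -> {RV P >-> Vs})
  (tau : {RV P >-> nat})
  (Hxi : forall k t, has_law (xi k t) Pxi)
  (Hvs : forall k t, has_law (vs k t) Pvs)
  (Hindep : mutually_independent P
     (draws_sigma (fun k t => xi k t : Om -> Xi)
                  (fun k t => vs k t : Om -> Vs) tau))
  (K : nat) (HK : (1 <= K)%N)
  (alpha : R) (Halpha : 1 <= alpha)
  (Htau_range : forall w, (1 <= tau w <= K)%N)
  (Htau : forall k, (1 <= k <= K)%N ->
     P (tau @^-1` [set k]) =
       (k%:R `^ alpha / \sum_(1 <= j < K.+1) j%:R `^ alpha)%:E)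
  (x1 : 'rV[R]_n) (Hx1 : edom (dc_r D) x1)
  (Delta : R) (HDelta : 0 < Delta)
  (G : R) (HG : 0 < G) (gamma : R) :
  (forall L : R, 0 < L -> condition_S Pxi Pvs D L G -> 3 * L <= gamma ->
     let eta t := 3 / (gamma * (t%:R + 1)) in
     let T k := nat_ceil (3 * L * k%:R / gamma + 3) in
     let x k w := stagewise (spg_option1 D gamma eta) x1 T
                    (fun j t => xi j t w) (fun j t => vs j t w) k in
     (forall k, (1 <= k <= K)%N ->
        (\int[P]_w (dc_objective D (x k w) -
                    ereal_inf (range (dc_objective D))) <= Delta%:E)%E) ->
     ('E_P[fun w => (enorm (prox_gradient D gamma (x (tau w) w)) ^+ 2)%R]
      <= (8 * gamma * Delta * (alpha + 1) / K%:R
          + 32 * G ^+ 2 * gamma * (alpha + 1) / (L * K%:R))%:E)%E)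
  /\
  (condition_N Pxi Pvs D G -> 0 < gamma ->
     let eta t := 4 / (gamma * t%:R) in
     let T k := nat_ceil (k%:R / gamma + 1) in
     let x k w := stagewise (spg_option2 D gamma G eta) x1 T
                    (fun j t => xi j t w) (fun j t => vs j t w) k in
     (forall k, (1 <= k <= K)%N ->
        (\int[P]_w (dc_objective D (x k w) -
                    ereal_inf (range (dc_objective D))) <= Delta%:E)%E) ->
     ('E_P[fun w => (enorm (prox_gradient D gamma (x (tau w) w)) ^+ 2)%R]
      <= (8 * gamma * Delta * (alpha + 1) / K%:R
          + 448 * G ^+ 2 * gamma * (alpha + 1) / K%:R)%:E)%E).
Proof.
have K1 : (0 < K)%N := HK.
have KR : 0 < K%:R :> R by rewrite ltr0n.
split.
- move=> L L0 HS Lg eta T x HF.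
  have gamma0 : 0 < gamma by lra.
  have eta0 t : (0 < t)%N -> 0 < eta t.
    by move=> _; rewrite divr_gt0// mulr_gt0// ltr_wpDl.
  have T_ge k : 3 * L * k%:R / gamma + 3 <= (T k)%:R := nat_ceil_ge _.
  have T3 k : 3 <= (T k)%:R :> R.
    apply: le_trans (T_ge k); rewrite lerDr divr_ge0 ?(ltW gamma0)//.
    by rewrite mulr_ge0// mulr_ge0// ltW.
  have T0 k : (0 < k)%N -> (0 < T k)%N.
    by move=> _; rewrite -(ltr0n R); apply: lt_le_trans (T3 k).
  have HC := unconstrained_region HD gamma0.
  (* Over the total weight [T * (T + 3) / 2], the noise of a stage is
     [24 * G ^+ 2 / (gamma * (T + 3))], and [gamma * (T + 3) >= 3 * L * k]. *)
  have e0 : 0 <= 8 * G ^+ 2 / L by rewrite divr_ge0 ?(ltW L0)// mulr_ge0 ?sqr_ge0.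
  have q4 : 0 < 4^-1 :> R by [].
  have A0 (t : nat) : 0 <= gamma * (t%:R + 1) ^+ 2 / 6.
    by rewrite divr_ge0// mulr_ge0 ?sqr_ge0// ltW.
  have N0 : 0 <= 12 * G ^+ 2 / gamma by rewrite divr_ge0 ?(ltW gamma0)// mulr_ge0 ?sqr_ge0.
  have := stagewise_bound HD Hindep gamma0 HC eta0 T0 Hx1 A0 N0
    (smooth_stage_step HD Hxi Hvs Hindep gamma0 T0 Hx1 L0 HS Lg) q4 e0 _ Halpha K1 Htau_range
    Htau HDelta HF.
  move=> /(_ _)/le_trans; apply.
    move=> k /andP[k0 _]; set q := fine _.
    have q0 : 0 <= q by apply: fine_ge0; exact: sqdist_ge0.
    have kR : 0 < k%:R :> R by rewrite ltr0n.
    have := T_ge k; have := T3 k; rewrite sum_weights; move: ((T k)%:R) => t t3 tk.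
    have t0 : 0 < t by lra.
    have gt : 3 * L * k%:R <= gamma * (t + 3).
      have : 3 * L * k%:R / gamma <= t + 3 by move: tk; move: (3 * L * k%:R / gamma) => b; lra.
      by rewrite ler_pdivrMr// [leRHS]mulrC.
    have u0 : 0 < t * (t + 3) / 2 by rewrite divr_gt0// mulr_gt0//; lra.
    (* [T >= 3] makes the total weight at least [9], more than enough to bring [A 1 = 2 * gamma / 3]
       below [gamma / 4]. *)
    have u9 : 9 <= t * (t + 3) / 2.
      rewrite ler_pdivlMr//; have : 3 * 6 <= t * (t + 3) by apply: ler_pM => //; lra.
      lra.
    have h1 : gamma * (1 + 1) ^+ 2 / 6 * q / (t * (t + 3) / 2) <= (2^-1 - 4^-1) * gamma * q.
      rewrite ler_pdivrMr// [leRHS]mulrC; have gq : 0 <= gamma * q by rewrite mulr_ge0// ltW.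
      have := ler_wpM2r gq u9; lra.
    have h2 : t * (12 * G ^+ 2 / gamma) / (t * (t + 3) / 2) <= 8 * G ^+ 2 / L / k%:R.
      have -> : t * (12 * G ^+ 2 / gamma) / (t * (t + 3) / 2) =
          8 * G ^+ 2 * (3 / (gamma * (t + 3))).
        by field; rewrite !gt_eqF//; lra.
      have -> : 8 * G ^+ 2 / L / k%:R = 8 * G ^+ 2 * (1 / (L * k%:R)).
        by field; rewrite !gt_eqF.
      apply: ler_wpM2l; first by rewrite mulr_ge0 ?sqr_ge0.
      rewrite ler_pdivlMr ?mulr_gt0// mulrAC ler_pdivrMr ?mul1r ?mulrA//.
      by rewrite mulr_gt0//; lra.
    have -> : t + 2 * 1%:R + 1 = t + 3 by ring.
    by rewrite mulrDl lerD.
  (* The coefficient of [G ^+ 2] matches exactly; that of [Delta] is [4] against the [8] of the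
     claim. *)
  rewrite lee_fin -subr_ge0.
  have -> : 8 * gamma * Delta * (alpha + 1) / K%:R +
      32 * G ^+ 2 * gamma * (alpha + 1) / (L * K%:R) -
      gamma * (alpha + 1) / (4^-1 * K%:R) * (Delta + 8 * G ^+ 2 / L) =
      4 * gamma * Delta * (alpha + 1) / K%:R.
    by field; rewrite !gt_eqF.
  by rewrite divr_ge0 ?(ltW KR)// mulr_ge0 ?mulr_ge0 ?(ltW gamma0) ?(ltW HDelta)//; lra.
- move=> HN gamma0 eta T x HF.
  have eta0 t : (0 < t)%N -> 0 < eta t.
    by move=> t0; rewrite divr_gt0// mulr_gt0// ltr0n.
  have T_ge k : k%:R / gamma + 1 <= (T k)%:R := nat_ceil_ge _.
  have T1 k : 1 <= (T k)%:R :> R.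
    by apply: le_trans (T_ge k); rewrite lerDr divr_ge0// ltW.
  have T0 k : (0 < k)%N -> (0 < T k)%N.
    by move=> _; rewrite -(ltr0n R); apply: lt_le_trans (T1 k).
  have HC := ball_region HD gamma0 HG (condition_N_subgradient HG HN).
  (* [155 / 2] rounds up [9 / 8 + 76], the initial distance plus the noise in units of
     [G ^+ 2 / gamma], using [T >= 1]. *)
  have e0 : 0 <= 155 * G ^+ 2 by rewrite mulr_ge0 ?sqr_ge0.
  have q2 : 0 < 2^-1 :> R by [].
  have A0 (t : nat) : 0 <= gamma * t%:R ^+ 2 / 8.
    by rewrite divr_ge0// mulr_ge0 ?sqr_ge0// ltW.
  have N0 : 0 <= 76 * G ^+ 2 / gamma by rewrite divr_ge0 ?(ltW gamma0)// mulr_ge0 ?sqr_ge0.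
  have := stagewise_bound HD Hindep gamma0 HC eta0 T0 Hx1 A0 N0
    (nonsmooth_stage_step HD Hxi Hvs Hindep gamma0 HG T0 Hx1 HN) q2 e0 _ Halpha K1 Htau_range
    Htau HDelta HF.
  move=> /(_ _)/le_trans; apply.
    move=> k /andP[k0 _]; set q := fine _.
    have q_le : q <= 9 * G ^+ 2 / gamma ^+ 2.
      have h := nonsmooth_sqdist HD xi vs tau gamma0 HG T0 Hx1 HN k0.
      rewrite -lee_fin fineK// ge0_fin_numE ?sqdist_ge0//.
      by apply: le_lt_trans h _; rewrite ltry.
    have kR : 0 < k%:R :> R by rewrite ltr0n.
    have := T_ge k; have := T1 k; rewrite sum_weights; move: ((T k)%:R) => t t1 tk.
    have t0 : 0 < t by lra.
    have gt : k%:R <= gamma * (t + 1).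
      have : k%:R / gamma <= t + 1 by move: tk; move: (k%:R / gamma) => b; lra.
      by rewrite ler_pdivrMr// [leRHS]mulrC.
    have G2 : 0 <= G ^+ 2 / gamma by rewrite divr_ge0 ?sqr_ge0// ltW.
    have h1 : gamma * 1%:R ^+ 2 / 8 * q <= 9 / 8 * (G ^+ 2 / gamma).
      have g8 : 0 <= gamma * 1%:R ^+ 2 / 8 by exact: (A0 1%N).
      apply: le_trans (ler_wpM2l g8 q_le) _; rewrite le_eqVlt; apply/orP; left.
      by apply/eqP; field; rewrite gt_eqF.
    have h2 : 1 * (G ^+ 2 / gamma) <= t * (G ^+ 2 / gamma) by apply: ler_wpM2r.
    have h3 : gamma * 1%:R ^+ 2 / 8 * q + t * (76 * G ^+ 2 / gamma) <=
        155 / 2 * t * (G ^+ 2 / gamma).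
      have -> : t * (76 * G ^+ 2 / gamma) = 76 * (t * (G ^+ 2 / gamma)) by ring.
      rewrite -[X in _ <= X]mulrA; move: h1 h2.
      move: (gamma * 1%:R ^+ 2 / 8 * q) (t * (G ^+ 2 / gamma)) (G ^+ 2 / gamma) G2 => b1 b2 b3.
      by lra.
    have u0 : 0 < t * (t + 2 * 0%:R + 1) / 2.
      by rewrite mulr0 addr0 divr_gt0// mulr_gt0//; lra.
    rewrite subrr !mul0r add0r ler_pdivrMr//; apply: (le_trans h3).
    have -> : 155 * G ^+ 2 / k%:R * (t * (t + 2 * 0%:R + 1) / 2) =
        155 / 2 * t * (G ^+ 2 / gamma) * (gamma * (t + 1) / k%:R).
      by field; rewrite !gt_eqF.
    rewrite ler_peMr//; first by rewrite mulr_ge0// mulr_ge0// ltW.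
    by rewrite ler_pdivlMr// mul1r.
  (* The coefficients obtained are [2] for [Delta] and [310] for [G ^+ 2], against [8] and [448]. *)
  rewrite lee_fin -subr_ge0.
  have -> : 8 * gamma * Delta * (alpha + 1) / K%:R +
      448 * G ^+ 2 * gamma * (alpha + 1) / K%:R -
      gamma * (alpha + 1) / (2^-1 * K%:R) * (Delta + 155 * G ^+ 2) =
      (6 * Delta + 138 * G ^+ 2) * gamma * (alpha + 1) / K%:R.
    by field; rewrite !gt_eqF.
  rewrite divr_ge0 ?(ltW KR)// mulr_ge0 ?mulr_ge0 ?(ltW gamma0)//; last by lra.
  by rewrite addr_ge0// mulr_ge0 ?sqr_ge0// ltW.
Qed.
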